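(* In the setting described in the context, suppose that the spaces $V_h\times\Lambda_h$ satisfy the following assumption: there are constants $C_z,c_z>0$ independent of $h$ such that for every $v_h\in V_h$ there exists $z_h(v_h)\in\Lambda_h$ with $$\int_{\partial\Omega}u_h\,(\nabla v_h\cdot n+z_h(v_h))\,\mathrm{d}s\le C_z\|\nabla u_h\|_{L^2(\Omega)}\|\nabla v_h\|_{L^2(\Omega)}\quad\forall u_h\in V_h,$$ $$\|h^{\frac12}z_h(v_h)\|_{L^2(\partial\Omega)}\le c_z\|\nabla v_h\|_{L^2(\Omega)}.$$ Then there is a constant $C>0$, independent of $h$, such that for all $(u_h,\lambda_h)\in V_h\times\Lambda_h$ $$\|u_h\|_{1,h}+\|\lambda_h\|_{L_h}\le C\sup_{(w_h,\nu_h)\in (V_h\times\Lambda_h)\setminus\{(0,0)\}}\frac{A_{BH}[(u_h,\lambda_h),(w_h,\nu_h)]}{\|w_h\|_{1,h}+\|\nu_h\|_{L_h}}.$$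
   Context: $\Omega\subset\mathbb{R}^2$ is a bounded, open, connected domain with polygonal boundary $\partial\Omega$ and outward unit normal $n$. $\{\mathcal{T}_h\}_h$ is a shape-regular, quasi-uniform family of triangulations fitted to $\Omega$, with mesh size $h$. It is assumed that each face (side) of the polygonal boundary is meshed with a sufficient number of elements, this number depending only on the shape regularity. $V_h\subset H^1(\Omega)$ is the standard space of continuous functions that are piecewise polynomial on $\mathcal{T}_h$ (of a fixed degree at least $1$), with no boundary condition imposed. $\Lambda_h\subset L^2(\partial\Omega)$ is a finite-dimensional multiplier space. The non-symmetric Barbosa–Hughes bilinear form, with a fixed stabilisation parameter $\gamma>0$ independent of $h$, is $$A_{BH}[(u_h,\lambda_h),(v_h,\mu_h)]:=\int_\Omega\nabla u_h\cdot\nabla v_h\,\mathrm{d}x+\int_{\partial\Omega}\lambda_hv_h\,\mathrm{d}s-\int_{\partial\Omega}\mu_hu_h\,\mathrm{d}s+\gamma\int_{\partial\Omega}h(\lambda_h+\nabla u_h\cdot n)(\mu_h+\nabla v_h\cdot n)\,\mathrm{d}s.$$ Norms: $\|\lambda_h\|_{L_h}:=\|h^{\frac12}\lambda_h\|_{L^2(\partial\Omega)}$ and $\|u_h\|_{1,h}^2:=\|\nabla u_h\|_{L^2(\Omega)}^2+\zeta\|h^{-\frac12}u_h\|_{L^2(\partial\Omega)}^2$, where $\zeta>0$ is a fixed constant independent of $h$ (different choices of $\zeta$ give equivalent norms, uniformly in $h$).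
   Formalization: The assumption that each side is meshed with sufficiently many elements counts only elements with an edge on that side that meet the rest of the boundary nowhere else; counting all elements with an edge on the side, the claim fails (rings meshed by a single layer of triangles). *)

(* Defs.v *)
From HB Require Import structures.
From mathcomp Require Import all_boot all_order all_algebra.
From mathcomp Require Import all_classical all_reals all_analysis.

Set Implicit Arguments.
Unset Strict Implicit.
Unset Printing Implicit Defensive.

Import Order.TTheory GRing.Theory Num.Theory.
Import numFieldNormedType.Exports.

Local Open Scope classical_set_scope.
Local Open Scope ring_scope.

(* The library norm of R * R is the max norm, hence the Euclidean one here. *)
Definition dot (R : realType) (x y : R * R) : R := x.1 * y.1 + x.2 * y.2.
Definition enorm (R : realType) (x : R * R) : R := Num.sqrt (dot x x).

(* A side of a polygon is the pair of its end points, listed so that the domain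
   lies to the left when going from the first to the second. *)
Notation side R := ((R * R) * (R * R))%type.
Notation triangle R := (3.-tuple (R * R)).

Definition side_point (R : realType) (s : side R) (t : R) : R * R :=
  s.1 + t *: (s.2 - s.1).
Definition closed_side (R : realType) (s : side R) : set (R * R) :=
  side_point s @` `[0, 1].
Definition open_side (R : realType) (s : side R) : set (R * R) :=
  side_point s @` `]0, 1[.
Definition side_length (R : realType) (s : side R) : R := enorm (s.2 - s.1).
Definition side_normal (R : realType) (s : side R) : R * R :=
  (side_length s)^-1 *: ((s.2 - s.1).2, - (s.2 - s.1).1).

Definition polygon_boundary (R : realType) (Omega : set (R * R)) :
    set (R * R) := closure Omega `\` Omega.

(* The last clause says that [side_normal s] is the outward normal along s: near
   an interior point of s, the domain is exactly a half-plane.  In particular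
   slits, which have no outward normal, are excluded. *)
Definition polygonal_domain (R : realType) (Omega : set (R * R))
    (sides : seq (side R)) : Prop :=
  [/\ [/\ open Omega, connected Omega, bounded_set Omega & Omega !=set0],
      uniq sides /\ (forall s, s \in sides -> s.1 != s.2),
      polygon_boundary Omega =
        [set x | exists2 s, s \in sides & closed_side s x],
      (forall s s', s \in sides -> s' \in sides -> s != s' ->
         open_side s `&` closed_side s' = set0)
    & (forall s x, s \in sides -> open_side s x ->
         \forall y \near x, Omega y <-> dot (y - x) (side_normal s) < 0)].

Definition hull (R : realType) (s : seq (R * R)) : set (R * R) :=
  [set x | exists w : nat -> R,
     [/\ forall i, 0 <= w i, \sum_(i < size s) w i = 1
       & x = \sum_(i < size s) w i *: s`_i]].

Definition area2 (R : realType) (T : triangle R) : R :=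
  let a := T`_0 in let b := T`_1 - a in let c := T`_2 - a in
  b.1 * c.2 - b.2 * c.1.

Definition diam (R : realType) (T : triangle R) : R :=
  \big[Num.max/0]_(x <- T) \big[Num.max/0]_(y <- T) enorm (x - y).

(* A triangle is given by its three vertices; two triangles meet in the hull of
   their common vertices, i.e. in nothing, a vertex or a whole edge. *)
Definition triangulation (R : realType) (Omega : set (R * R))
    (sides : seq (side R)) (Th : seq (triangle R)) : Prop :=
  [/\ uniq Th /\ (forall T, T \in Th -> area2 T != 0),
      (forall T T', T \in Th -> T' \in Th -> T != T' ->
         ~~ perm_eq T T' /\
         hull T `&` hull T' = hull [seq x <- T | x \in (T' : seq (R * R))]),
      closure Omega = [set x | exists2 T, T \in Th & hull T x]
    & (forall s, s \in sides ->
         (exists2 T, T \in Th & s.1 \in (T : seq (R * R))) /\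
         (exists2 T, T \in Th & s.2 \in (T : seq (R * R))))].

Definition mesh_size (R : realType) (Th : seq (triangle R)) : R :=
  \big[Num.max/0]_(T <- Th) diam T.

Definition shape_regular (R : realType) (kappa : R)
    (Th : seq (triangle R)) : Prop :=
  forall T, T \in Th -> exists x r,
    [/\ 0 < r, diam T <= kappa * r & [set y | enorm (y - x) <= r] `<=` hull T].

Definition quasi_uniform (R : realType) (rho : R)
    (Th : seq (triangle R)) : Prop :=
  forall T, T \in Th -> mesh_size Th <= rho * diam T.

(* The elements meshing the side s: those with an edge on s that do not also
   touch another part of the boundary.  Counting the elements shared between s
   and other sides as well would not do: on an annulus between two polygons with
   many sides, meshed by one layer of elements, each side may carry arbitrarily
   many edges while the mean flux of every piecewise affine function through the
   boundary vanishes, so that constants are not controlled. *)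
Definition meshes_side (R : realType) (Omega : set (R * R)) (s : side R)
    (T : triangle R) : Prop :=
  (exists x y, [/\ x \in (T : seq (R * R)), y \in (T : seq (R * R)), x != y,
                   closed_side s x & closed_side s y]) /\
  hull T `&` polygon_boundary Omega `<=` closed_side s.

Definition sides_resolved (R : realType) (N : nat) (Omega : set (R * R))
    (sides : seq (side R)) (Th : seq (triangle R)) : Prop :=
  forall s, s \in sides -> (N <= count (fun T => `[< meshes_side Omega s T >]) Th)%N.

Definition poly2 (R : realType) (k : nat) (p : R * R -> R) : Prop :=
  exists c : nat -> nat -> R, p =
    fun x => \sum_(i < k.+1) \sum_(j < (k - i).+1) c i j * x.1 ^+ i * x.2 ^+ j.

(* Functions are total on the plane; only their values on the closure of Omega
   matter below. *)
Definition FE_space (R : realType) (k : nat) (Omega : set (R * R))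
    (Th : seq (triangle R)) : set (R * R -> R) :=
  [set u | {within closure Omega, continuous u} /\
     forall T, T \in Th ->
       exists2 p, poly2 k p & forall x, hull T x -> u x = p x].

(* Off the edges of the mesh, a null set, this is the classical gradient. *)
Definition grad (R : realType) (u : R * R -> R) (x : R * R) : R * R :=
  ('D_(1, 0) u x, 'D_(0, 1) u x).

(* At a boundary point the gradient is taken from inside the domain; for u in
   [FE_space], inside an edge of an element T on s, this is the normal component
   of the gradient of the polynomial that u coincides with on T. *)
Definition dnormal (R : realType) (u : R * R -> R) (s : side R) (x : R * R) : R :=
  lim ((u x - u (x - t *: side_normal s)) / t @[t --> (0 : R)^'+]).

Definition domain_int (R : realType) (Omega : set (R * R)) (f : R * R -> R) : R :=
  \int[(@lebesgue_measure R \x @lebesgue_measure R)%E]_(x in Omega) f x.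

(* Integral with respect to arc length; the integrand may depend on the side, as
   the normal derivative does. *)
Definition bnd_int (R : realType) (sides : seq (side R))
    (f : side R -> R * R -> R) : R :=
  \sum_(s <- sides) side_length s *
    \int[@lebesgue_measure R]_(t in `[0, 1]%classic) f s (side_point s t).

Definition grad_norm (R : realType) (Omega : set (R * R)) (u : R * R -> R) : R :=
  Num.sqrt (domain_int Omega (fun x => dot (grad u x) (grad u x))).

Definition bnd_norm (R : realType) (sides : seq (side R))
    (f : R * R -> R) : R :=
  Num.sqrt (bnd_int sides (fun _ x => f x ^+ 2)).

Definition bnd_L2 (R : realType) (sides : seq (side R))
    (f : R * R -> R) : Prop :=
  forall s, s \in sides ->
    measurable_fun (`[0, 1]%classic : set R) (fun t => f (side_point s t)) /\
    (@lebesgue_measure R).-integrable (`[0, 1]%classic : set R)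
      (fun t => (f (side_point s t) ^+ 2)%:E).

Definition bnd_ae_zero (R : realType) (sides : seq (side R))
    (f : R * R -> R) : Prop :=
  forall s, s \in sides ->
    {ae @lebesgue_measure R,
      forall t, `[0, 1]%classic t -> f (side_point s t) = 0}.

(* Finite-dimensional subspaces of L^2 of the boundary, spanned by
   representatives of a generating family. *)
Definition multiplier_space (R : realType) (sides : seq (side R))
    (L : set (R * R -> R)) : Prop :=
  exists (n : nat) (b : 'I_n -> R * R -> R),
    (forall j, bnd_L2 sides (b j)) /\
    L = [set l | exists c : 'I_n -> R, l = fun x => \sum_(j < n) c j * b j x].

Definition A_BH (R : realType) (Omega : set (R * R))
    (sides : seq (side R)) (gamma h : R)
    (u l v m : R * R -> R) : R :=
  domain_int Omega (fun x => dot (grad u x) (grad v x))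
  + bnd_int sides (fun _ x => l x * v x)
  - bnd_int sides (fun _ x => m x * u x)
  + gamma * bnd_int sides
      (fun s x => h * (l x + dnormal u s x) * (m x + dnormal v s x)).

Definition norm_Lh (R : realType) (sides : seq (side R)) (h : R)
    (l : R * R -> R) : R :=
  bnd_norm sides (fun x => Num.sqrt h * l x).

Definition norm_1h (R : realType) (Omega : set (R * R))
    (sides : seq (side R)) (zeta h : R) (u : R * R -> R) : R :=
  Num.sqrt (grad_norm Omega u ^+ 2
            + zeta * bnd_norm sides (fun x => (Num.sqrt h)^-1 * u x) ^+ 2).

Definition multiplier_assumption (R : realType) (Omega : set (R * R))
    (sides : seq (side R)) (h : R) (V L : set (R * R -> R))
    (Cz cz : R) : Prop :=
  forall v, V v -> exists2 z, L z &
    (forall u, V u ->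
       bnd_int sides (fun s x => u x * (dnormal v s x + z x))
         <= Cz * grad_norm Omega u * grad_norm Omega v) /\
    bnd_norm sides (fun x => Num.sqrt h * z x) <= cz * grad_norm Omega v.

(* (w, m) represents the zero element of V x L. *)
Definition pair_zero (R : realType) (Omega : set (R * R))
    (sides : seq (side R)) (w m : R * R -> R) : Prop :=
  (forall x, Omega x -> w x = 0) /\ bnd_ae_zero sides m.

(* The supremum is taken in the extended reals, so that it never degenerates to
   a default value. *)
Definition BH_sup (R : realType) (Omega : set (R * R))
    (sides : seq (side R)) (gamma zeta h : R)
    (V L : set (R * R -> R)) (u l : R * R -> R) : \bar R :=
  ereal_sup [set q | exists w m, [/\ V w, L m, ~ pair_zero Omega sides w m
    & q = (A_BH Omega sides gamma h u l w m /
           (norm_1h Omega sides zeta h w + norm_Lh sides h m))%:E]].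

(* Main.v *)
Require Import Defs.
From HB Require Import structures.
From mathcomp Require Import all_boot all_order all_algebra.
From mathcomp Require Import all_classical all_reals all_analysis.
From mathcomp Require Import measurable_realfun.
From mathcomp Require Import ring lra.
Import Order.TTheory GRing.Theory Num.Theory.
Import numFieldNormedType.Exports.
Local Open Scope classical_set_scope.
Local Open Scope ring_scope.

Set Implicit Arguments.
Unset Strict Implicit.
Unset Printing Implicit Defensive.

(* Fix a mesh of size h and test (u, l) against (u + d w, l + d z), where w is the
   piecewise affine function with w = u at the boundary vertices and w = 0 at the
   interior ones, z lifts w through the multiplier assumption and d is small.
   Testing with (u, l) alone gives |grad u|^2 + gamma h |l + d_n u|^2, so what is
   missing is the boundary term A, the sum of u^2 over the boundary edges, and it
   comes from the flux of w.  By inverse inequalities u varies by o_T on the element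
   T, with sum o_T^2 <= C |grad u|^2.  If T has an edge on a side and its third
   vertex inside, w vanishes there, hence d_n w ~ u / h and u d_n w >= u^2 / (2 h)
   up to o_T^2 / h.  An edge element with its third vertex on another side only
   contributes an arbitrarily small multiple of - u^2 / h; such elements lie near
   corners, so their number is bounded, and as each side carries at least one element
   of the first kind, following the side from a bad edge to a good one through bad
   ones bounds u there.  Thus the flux of w controls A up to C |grad u|^2. *)

(** * Integrals and null sets *)

(** The lift z is chosen for the sign of the coupling. With the defect nu(w, z) = z + d_n w, the
    term - int z u equals int u d_n w - int u nu(w, z): the first integral is the flux to be bounded
    below, the second is exactly what the multiplier assumption bounds by energies. So the flux
    estimate concerns piecewise polynomials alone. Every other mixed term has a factor controlled by
    the diagonal, the energy of u or h |nu(u, l)|^2, and Young's inequality pays the rest with a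
    fixed part of A. As A carries no weight, h A stands for the squared trace of u up to the energy,
    which fits both powers of h in the norms.

    The obstacle is the bad elements: their flux has no sign, so their share must be small against
    that of good ones, of which a side may have only one. Hence their number needs a bound free of
    h. It rests on a quantitative fact about Omega, that a side comes close to another one only near
    its own ends, and on packing disjoint boxes.

    Gradients and normal derivatives are limits with default values; all integrals are first moved
    to subsets with null complement where these are given by polynomials. *)

Section NullSets.
Context d (T : measurableType d) (R : realType).
Variable mu : {measure set T -> \bar R}.
Import HBNNSimple.

(* No measurability of f is needed: the integral of a nonnegative function is
   a supremum over simple functions, which may be cut off on a null set. *)
Lemma integral_null (D D' N : set T) (f : T -> \bar R) :
  D' `<=` D -> D `\` D' `<=` N -> measurable N -> mu N = 0%E ->
  (\int[mu]_(x in D) f x = \int[mu]_(x in D') f x)%E.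
Proof.
move=> sD sN mN N0.
suff key (g g' : T -> \bar R) : (forall x, 0 <= g x)%E -> (forall x, 0 <= g' x)%E ->
    (forall x, ~ N x -> g x = g' x) ->
    (ereal_sup [set sintegral mu h | h in [set h : {nnsfun T >-> R} | forall x, (h x)%:E <= g x]]
     <= ereal_sup [set sintegral mu h | h in [set h : {nnsfun T >-> R} | forall x, (h x)%:E <= g' x]])%E.
  have E x : ~ N x -> (f \_ D) x = (f \_ D') x.
    move=> Nx; rewrite !patchE; case: ifPn; case: ifPn => //.
      rewrite notin_setE inE => D'x Dx; exfalso; apply: Nx; exact: sN.
    by rewrite notin_setE inE => D'x /(_ (sD _ D'x)).
  rewrite /integral; congr (_ - _)%E; apply/eqP; rewrite eq_le; apply/andP; split; apply: key => // x Nx;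
   by rewrite /= ?funeposE ?funenegE E.
move=> g0 g0' gg; apply: ereal_sup_le => _ [h /= hg <-].
pose h' := proj_nnsfun h (measurableC mN).
exists h'.
  move=> x; change (h' x) with (h x * \1_(~` N) x); rewrite indicE; case: (boolP (x \in ~` N)).
    by rewrite inE => Nx; rewrite mulr1 -gg.
  by rewrite mulr0.
rewrite /sintegral; apply: eq_fsbigr => r _.
have [->|r0] := eqVneq r 0; first by rewrite !mul0e.
congr (_ * _)%E; rewrite (measureDI mu (B := N) (A := h @^-1` [set r]))//.
rewrite [X in _ = (_ + X)%E](_ : _ = 0%E) ?adde0; last first.
  by apply: (subset_measure0 _ mN _ N0) => //; exact: measurableI.
congr (mu _); apply/seteqP; split => x; change ((h @^-1` [set r] `\` N) x) with (h x = r /\ ~ N x); change ((h' @^-1` [set r]) x) with (h x * \1_(~` N) x = r).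
  rewrite indicE; case: (boolP (x \in ~` N)) => [|_].
    by rewrite inE mulr1.
  by rewrite mulr0 => r00; rewrite -r00 eqxx in r0.
by move=> [<- Nx]; rewrite indicE mem_set// mulr1.
Qed.
End NullSets.

(** Cauchy-Schwarz for semidefinite forms: the quadratic is the value of the form at f + t g, so its
    discriminant is nonpositive. *)
Lemma quadratic_cauchy (R : realFieldType) (a b c : R) : 0 <= a -> 0 <= c ->
  (forall t, 0 <= a + t * b *+ 2 + t ^+ 2 * c) -> b ^+ 2 <= a * c.
Proof.
move=> a0 c0 H; have [c00|cN0] := eqVneq c 0.
  have [->|bN0] := eqVneq b 0; first by rewrite expr0n c00 mulr0.
  (* With c = 0 the expression is affine in t, and this t gives it the value -1. *)
  have := H (- (a + 1) / (2 * b)); rewrite c00 mulr0 addr0.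
  have -> : - (a + 1) / (2 * b) * b *+ 2 = - (a + 1).
    by rewrite mulr2n; field.
  by rewrite opprD addrA subrr add0r oppr_ge0 ler10.
have cp : 0 < c by rewrite lt_def cN0.
have := H (- b / c).
have -> : a + - b / c * b *+ 2 + (- b / c) ^+ 2 * c = (a * c - b ^+ 2) / c.
  by rewrite mulr2n; field.
by rewrite pmulr_lge0 ?invr_gt0// subr_ge0.
Qed.

Section SquareIntegrable.
Context d (T : measurableType d) (R : realType).
Variables (mu : {measure set T -> \bar R}) (D : set T).
Hypothesis mD : measurable D.

(** Measurability is demanded separately because integrability of the square does not imply it. *)
Definition sqint (f : T -> R) : Prop :=
  measurable_fun D f /\ mu.-integrable D (fun x => (f x ^+ 2)%:E).

Lemma sqintM f g : sqint f -> sqint g ->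
  mu.-integrable D (fun x => (f x * g x)%:E).
Proof.
move=> [mf If] [mg Ig].
apply: (le_integrable mD _ _ (integrableD mD If Ig)).
  by apply/measurable_EFinP; exact: measurable_funM.
move=> x Dx /=; rewrite lee_fin ler_norml ger0_norm ?addr_ge0 ?sqr_ge0//.
by have := sqr_ge0 (f x + g x); have := sqr_ge0 (f x - g x); have := sqr_ge0 (f x); have := sqr_ge0 (g x); rewrite !expr2; nra.
Qed.

Lemma sqintZ f (c : R) : sqint f -> sqint (fun x => c * f x).
Proof.
move=> [mf If]; split; first exact: measurable_funM.
have := integrableZl mD (c ^+ 2) If.
by apply: eq_integrable => // x _; rewrite exprMn.
Qed.

Lemma sqintD f g : sqint f -> sqint g -> sqint (fun x => f x + g x).
Proof.
move=> Lf Lg; split; first by apply: measurable_funD; [case: Lf|case: Lg].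
have I2 := integrableZl mD 2 (sqintM Lf Lg).
have I3 := integrableD mD (integrableD mD Lf.2 Lg.2) I2.
apply: (eq_integrable mD _ _ _ I3).
by move=> x _; rewrite /= -EFinM -!EFinD; congr EFin; ring.
Qed.

Lemma sqint_sum (I : Type) (r : seq I) (F : I -> T -> R) :
  (forall i, sqint (F i)) -> sqint (fun x => \sum_(i <- r) F i x).
Proof.
move=> H; elim: r => [|i r IH].
  split; first by under eq_fun do rewrite big_nil; exact: measurable_cst.
  under eq_fun do rewrite big_nil expr0n.
  exact: integrable0.
under eq_fun do rewrite big_cons; exact: sqintD.
Qed.

Lemma sqint_bounded (f : T -> R) (B : R) : (mu D < +oo)%E -> measurable_fun D f ->
  (forall x, D x -> `|f x| <= B) -> sqint f.
Proof.
move=> fD mf fB; split => //.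
apply: measurable_bounded_integrable => //.
  exact: measurable_funX.
exists (B ^+ 2); split; first exact: num_real.
move=> y By x /fB fxB /=; rewrite ger0_norm ?sqr_ge0// (le_trans _ (ltW By))//.
rewrite -real_normK ?num_real//.
by rewrite ler_pXn2r ?nnegrE ?(le_trans _ fxB).
Qed.

Lemma sqint_eq f g : {in D, f =1 g} -> sqint f -> sqint g.
Proof.
move=> fg [mf If]; split.
  exact: eq_measurable_fun mf.
by apply: eq_integrable If => // x xD; rewrite fg.
Qed.

Lemma indic_integrable (A : set T) : measurable A -> (mu A < +oo)%E ->
  mu.-integrable D (EFin \o (\1_A : T -> R)).
Proof.
move=> mA fA; apply/integrableP; split.
  by apply/measurable_EFinP; exact: measurable_indic.
rewrite (eq_integral (fun x => (\1_A x)%:E)); last first.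
  by move=> x _ /=; rewrite ger0_norm// indicE.
rewrite integral_indic//; apply: le_lt_trans fA.
by apply: le_measure; rewrite ?inE//; exact: measurableI.
Qed.

Section Step.
Variables (I : eqType) (r : seq I) (c : I -> R) (B : I -> set T).
Hypothesis hB : forall i, i \in r -> [/\ measurable (B i), B i `<=` D & (mu (B i) < +oo)%E].

(** Passages between integrals and sums over elements go through such functions, where [B i] is a
    box inside an element, its interior, or its part of a side. *)
Let step x := \sum_(i <- r) c i * \1_(B i) x.

Lemma step_integrable : mu.-integrable D (EFin \o step).
Proof.
rewrite /step; elim: r hB => [|i s IH] hs.
  rewrite [X in _.-integrable _ X](_ : _ = cst 0%E); last first.
    by apply/funext => x; rewrite /= big_nil.
  exact: integrable0.
have Ii : mu.-integrable D (fun x => ((c i)%:E * (\1_(B i) x)%:E)%E).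
  have [? ? ?] := hs _ (mem_head _ _).
  by apply: integrableZl => //; exact: indic_integrable.
have := integrableD mD Ii (IH (fun j js => hs j (@mem_behead _ (i :: s) j js))).
by apply: eq_integrable => // x _; rewrite /= big_cons EFinD EFinM.
Qed.

Lemma Rintegral_step :
  \int[mu]_(x in D) step x = \sum_(i <- r) c i * fine (mu (B i)).
Proof.
have := step_integrable; rewrite /step; elim: r hB => [|i s IH] hs Is.
  rewrite big_nil -[RHS](_ : \int[mu]_(x in D) 0 = 0).
    by apply: eq_Rintegral => x _; rewrite big_nil.
  by rewrite /Rintegral integral0.
have [mi si fi] := hs _ (mem_head _ _).
have Ii : mu.-integrable D (EFin \o (fun x => c i * \1_(B i) x)).
  have := integrableZl mD (c i) (indic_integrable mi fi).
  by apply: eq_integrable => // x _ /=.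
have hs' j (js : j \in s) := hs j (@mem_behead _ (i :: s) j js).
have Is' : mu.-integrable D (EFin \o (fun x => \sum_(j <- s) c j * \1_(B j) x)).
  have := integrableB mD Is Ii; apply: eq_integrable => // x _.
  by rewrite /= big_cons -EFinB addrAC subrr add0r.
rewrite big_cons -(IH hs' Is').
transitivity (\int[mu]_(x in D) (c i * \1_(B i) x + \sum_(j <- s) c j * \1_(B j) x)).
  by apply: eq_Rintegral => x _; rewrite big_cons.
rewrite RintegralD//; congr (_ + _).
rewrite RintegralZl//; last exact: indic_integrable.
by rewrite /Rintegral integral_indic// setIidl.
Qed.

Lemma step_le_Rintegral f : mu.-integrable D (EFin \o f) ->
  (forall x, D x -> step x <= f x) ->
  \sum_(i <- r) c i * fine (mu (B i)) <= \int[mu]_(x in D) f x.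
Proof.
by move=> If H; rewrite -Rintegral_step; apply: le_Rintegral => //; exact: step_integrable.
Qed.

Lemma Rintegral_le_step f : mu.-integrable D (EFin \o f) ->
  (forall x, D x -> f x <= step x) ->
  \int[mu]_(x in D) f x <= \sum_(i <- r) c i * fine (mu (B i)).
Proof.
by move=> If H; rewrite -Rintegral_step; apply: le_Rintegral => //; exact: step_integrable.
Qed.

End Step.
End SquareIntegrable.

(** * Reverse bounds for polynomials *)

Section PolynomialBounds.
Variable R : realType.
Implicit Types (g : {poly R}).

Lemma poly_bounded_lipschitz g (K : R) : exists2 C, 0 <= C &
  forall y y', `|y| <= K -> `|y'| <= K ->
    `|g.[y]| <= C /\ `|g.[y] - g.[y']| <= C * `|y - y'|.
Proof.
elim/poly_ind: g => [|p c [C C0 IH]].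
  by exists 0 => // y y' _ _; rewrite !horner0 subrr normr0 mul0r.
have cK : 0 <= `|K| by [].
exists (C * `|K| + C + `|c|); first by rewrite !addr_ge0// mulr_ge0.
move=> y y' yK y'K; have [py pyy] := IH _ _ yK y'K; rewrite !hornerMXaddC.
have [py' _] := IH _ _ y'K y'K.
have KK := ler_norm K; split.
  apply: (le_trans (ler_normD _ _)); rewrite normrM.
  have : `|p.[y]| * `|y| <= C * `|K| by apply: ler_pM => //; exact: le_trans KK.
  lra.
rewrite (_ : _ - _ = (p.[y] - p.[y']) * y + p.[y'] * (y - y')); last by ring.
apply: (le_trans (ler_normD _ _)); rewrite !normrM.
have H1 : `|p.[y] - p.[y']| * `|y| <= C * `|y - y'| * `|K|.
  by apply: ler_pM => //; exact: le_trans KK.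
have H2 : `|p.[y']| * `|y - y'| <= C * `|y - y'| by apply: ler_wpM2r.
have : 0 <= `|c| * `|y - y'| by apply: mulr_ge0.
nra.
Qed.

(* The nodes j / (4 (k + 1)), j <= k, all lie in [0, 1/4]. *)
Definition node (k j : nat) : R := j%:R / (4 * k.+1%:R).

Lemma node_inj k : injective (node k).
Proof.
move=> i j /mulIf; rewrite invr_eq0 mulf_neq0 ?pnatr_eq0// => /(_ isT) /eqP.
by rewrite eqr_nat => /eqP.
Qed.

Lemma node_itv k j : (j <= k)%N -> 0 <= node k j <= 4^-1.
Proof.
move=> jk; rewrite divr_ge0//= /node invfM mulrA -mulrAC ler_piMl ?invr_ge0//.
by rewrite ler_pdivrMr ?ltr0n// mul1r ler_nat leqW.
Qed.

Lemma poly_interpolation (k : nat) (K : R) : exists2 C, 0 < C &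
  forall g (a r M : R), (size g <= k.+1)%N -> 0 < r -> 0 <= M ->
    (forall j, (j <= k)%N -> `|g.[a + r * node k j]| <= M) ->
  forall y y', `|y - a| <= K * r -> `|y' - a| <= K * r ->
    `|g.[y]| <= C * M /\ `|g.[y] - g.[y']| <= C * M * `|y - y'| / r.
Proof.
pose L (i : 'I_k.+1) := tnth (k.+1.-lagrange (node k)) i.
have [B B0 HB] : exists2 B : 'I_k.+1 -> R, (forall i, 0 <= B i) &
    forall i y y', `|y| <= K -> `|y'| <= K ->
      `|(L i).[y]| <= B i /\ `|(L i).[y] - (L i).[y']| <= B i * `|y - y'|.
  pose P (i : 'I_k.+1) (b : R) := 0 <= b /\ forall y y', `|y| <= K -> `|y'| <= K ->
      `|(L i).[y]| <= b /\ `|(L i).[y] - (L i).[y']| <= b * `|y - y'|.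
  have [i|B HB] := @choice _ _ P.
    by have [C C0 HC] := poly_bounded_lipschitz (L i) K; exists C.
  by exists B => i; have [] := HB i.
have normalized g M : (size g <= k.+1)%N -> 0 <= M ->
    (forall j, (j <= k)%N -> `|g.[node k j]| <= M) ->
    forall y y', `|y| <= K -> `|y'| <= K ->
    `|g.[y]| <= (\sum_i B i + 1) * M /\
    `|g.[y] - g.[y']| <= (\sum_i B i + 1) * M * `|y - y'|.
  move=> sg M0 gM y y' yK y'K.
  have gE z : g.[z] = \sum_(i < k.+1) g.[node k i] * (L i).[z].
    rewrite {1}(lagrange_gen (ltn0Sn k) (@node_inj k) sg) horner_sum.
    by apply: eq_bigr => i _; rewrite hornerM hornerC.
  split.
    rewrite gE (le_trans (ler_norm_sum _ _ _))// mulrDl mul1r mulr_suml.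
    apply: ler_wpDr => //; apply: ler_sum => i _; rewrite normrM mulrC.
    apply: ler_pM => //; first by have [] := HB i _ _ yK y'K.
    by apply: gM; rewrite -ltnS.
  rewrite !gE -sumrB (le_trans (ler_norm_sum _ _ _))// !mulrDl mul1r !mulr_suml.
  apply: ler_wpDr; first exact: mulr_ge0.
  apply: ler_sum => i _; rewrite -mulrBr normrM mulrC -mulrA [M * _]mulrC mulrA.
  apply: ler_pM => //; first by have [] := HB i _ _ yK y'K.
  by apply: gM; rewrite -ltnS.
exists (\sum_i B i + 1); first by rewrite ltr_pwDr// sumr_ge0.
move=> g a r M sg r0 M0 gM y y' ya y'a.
pose q := g \Po (r *: 'X + a%:P).
have qE z : q.[z] = g.[a + r * z] by rewrite /q horner_comp !hornerE addrC.
have sq : (size q <= k.+1)%N.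
  rewrite (leq_trans (size_comp_poly_leq _ _))//.
  have s2 : ((size (r *: 'X + a%:P)%R).-1 <= 1)%N.
    rewrite -subn1 leq_subLR (leq_trans (size_polyD _ _))// geq_max.
    rewrite (leq_trans (size_scale_leq _ _)) ?size_polyX//.
    by rewrite (leq_trans (size_polyC_leq1 _)).
  by rewrite ltnS (leq_trans (leq_mul (leqnn _) s2))// muln1 -subn1 leq_subLR.
have scale z : `|z - a| <= K * r -> `|(z - a) / r| <= K.
  by move=> H; rewrite normrM normfV (gtr0_norm r0) ler_pdivrMr.
have back z : a + r * ((z - a) / r) = z.
  by rewrite mulrCA divff ?gt_eqF// mulr1 addrC subrK.
have := normalized q M sq M0 _ _ _ (scale _ ya) (scale _ y'a).
rewrite !qE !back -mulrBl opprB addrA subrK normrM normfV (gtr0_norm r0) mulrA.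
by apply => j jk; rewrite qE; exact: gM.
Qed.
End PolynomialBounds.

Section BivariatePolynomials.
Variable R : realType.
Implicit Types (c : nat -> nat -> R) (x y z v : R * R).

Definition box x (r : R) : set (R * R) :=
  [set y | `|y.1 - x.1| <= r /\ `|y.2 - x.2| <= r].

(** The degree is bounded in each variable, not in total as in [poly2]: slices along the axes are
    then univariate of degree at most k, and tensor grids control them. *)
Definition bipoly (k : nat) (q : R * R -> R) : Prop := exists c, q =
  fun x => \sum_(i < k.+1) \sum_(j < k.+1) c i j * x.1 ^+ i * x.2 ^+ j.

Lemma bipoly_slice1 k q (s : R) : bipoly k q ->
  exists2 g : {poly R}, (size g <= k.+1)%N & forall t, g.[t] = q (t, s).
Proof.
case=> c ->; exists (\poly_(i < k.+1) \sum_(j < k.+1) c i j * s ^+ j).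
  exact: size_poly.
move=> t; rewrite horner_poly; apply: eq_bigr => i _.
by rewrite mulr_suml; apply: eq_bigr => j _ /=; rewrite mulrAC.
Qed.

Lemma bipoly_slice2 k q (s : R) : bipoly k q ->
  exists2 g : {poly R}, (size g <= k.+1)%N & forall t, g.[t] = q (s, t).
Proof.
case=> c ->; exists (\poly_(j < k.+1) \sum_(i < k.+1) c i j * s ^+ i).
  exact: size_poly.
move=> t; rewrite horner_poly exchange_big; apply: eq_bigr => j _.
by rewrite mulr_suml.
Qed.

(* The box around b is a neighbourhood, of size proportional to r, of the node
   of a tensor grid at which |q| is largest. *)
Lemma bipoly_reverse_bound (k : nat) (K : R) : 1 <= K ->
  exists delta C : R, [/\ 0 < delta, 0 < C &
  forall q, bipoly k q -> forall x (r : R), 0 < r -> exists b (S : R),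
  [/\ 0 <= S, (forall y, box x (K * r) y -> `|q y| <= S),
      box b (delta * r) `<=` box x (r / 2) &
      forall z, box b (delta * r) z -> S <= C * `|q z|]].
Proof.
move=> K1; have [C C0 HC] := poly_interpolation k K.
(* [delta] is small for two reasons: (C^2 + C) delta <= 1/2 keeps |q| above half its maximum over
   the grid, and delta <= 1/4 keeps the box inside [box x (r / 2)], as the nodes lie within r / 4 of
   x. *)
pose delta := (2 * (C ^+ 2 + C) + 4)^-1.
have D0 : 0 < 2 * (C ^+ 2 + C) + 4 by rewrite expr2; nra.
have d0 : 0 < delta by rewrite invr_gt0.
have d4 : delta <= 4^-1 by rewrite lef_pV2 ?posrE// expr2; nra.
have dC : (C ^+ 2 + C) * delta <= 2^-1.
  by rewrite ler_pdivrMr// ; rewrite expr2; nra.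
exists delta, (2 * C ^+ 2); split => // [|q Hq x r r0].
  by rewrite mulr_gt0// exprn_gt0.
pose nd (p : 'I_k.+1 * 'I_k.+1) := (x.1 + r * node R k p.1, x.2 + r * node R k p.2).
have [p _ pmax] := @Order.TotalTheory.arg_maxP _ _ _ (ord0, ord0) predT (fun p => `|q (nd p)|) isT.
pose M : R := `|q (nd p)|.
have M0 : 0 <= M by exact: normr_ge0.
have nodeK j : (j <= k)%N -> `|r * node R k j| <= r / 4.
  move=> /(node_itv R) /andP[n0 n4].
  by rewrite ger0_norm ?(mulr_ge0 (ltW r0))// ler_wpM2l// ltW.
have gridM i j : (i <= k)%N -> (j <= k)%N ->
    `|q (x.1 + r * node R k i, x.2 + r * node R k j)| <= M.
  rewrite -ltnS => ik; rewrite -ltnS => jk.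
  exact: (pmax (Ordinal ik, Ordinal jk)).
have slice1 j : (j <= k)%N -> forall y y' : R, `|y - x.1| <= K * r -> `|y' - x.1| <= K * r ->
    let s := x.2 + r * node R k j in
    `|q (y, s)| <= C * M /\ `|q (y, s) - q (y', s)| <= C * M * `|y - y'| / r.
  move=> jk y y' hy hy' s; have [g sg gE] := bipoly_slice1 s Hq.
  rewrite -!gE; apply: (HC g x.1 r M sg r0 M0 _ y y' hy hy') => i ik.
  by rewrite gE; exact: gridM.
have slice2 (s : R) : `|s - x.1| <= K * r -> forall y y' : R, `|y - x.2| <= K * r -> `|y' - x.2| <= K * r ->
    `|q (s, y)| <= C ^+ 2 * M /\ `|q (s, y) - q (s, y')| <= C ^+ 2 * M * `|y - y'| / r.
  move=> hs y y' hy hy'; have [g sg gE] := bipoly_slice2 s Hq.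
  have CM0 : 0 <= C * M by rewrite mulr_ge0// ltW.
  rewrite -!gE expr2 -[C * C * M]mulrA.
  apply: (HC g x.2 r (C * M) sg r0 CM0 _ y y' hy hy') => j jk.
  by rewrite gE; exact: (slice1 _ jk _ _ hs hs).1.
have bx : box x (r / 4) (nd p).
  by split; rewrite /= addrC addKr; apply: nodeK; rewrite -ltnS.
have sub : box (nd p) (delta * r) `<=` box x (r / 2).
  have dr : delta * r <= r / 4 by rewrite mulrC ler_wpM2l// ltW.
  have E (a b c : R) : `|a - b| <= delta * r -> `|b - c| <= r / 4 -> `|a - c| <= r / 2.
    move=> ab bc; have := ler_normD (a - b) (b - c); rewrite addrA subrK; lra.
  by move=> z [z1 z2]; split; [exact: E bx.1|exact: E bx.2].
have rK : r / 2 <= K * r by rewrite mulrC ler_wpM2r// ?ltW//; lra.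
have rK4 : r / 4 <= K * r by lra.
exists (nd p), (C ^+ 2 * M); split => //.
- by rewrite mulr_ge0// exprn_ge0// ltW.
- by move=> [y1 y2] [/= h1 h2]; exact: (slice2 _ h1 _ _ h2 h2).1.
move=> z zb; have [z1 z2] := sub _ zb; have [b1 b2] := bx.
suff Mq : M <= 2 * `|q z| by have := ler_wpM2l (sqr_ge0 C) Mq; rewrite mulrA [_ * 2]mulrC.
have S2 := (slice2 z.1 (le_trans z1 rK) z.2 (nd p).2 (le_trans z2 rK) (le_trans b2 rK4)).2.
have pk : (p.2 <= k)%N by rewrite -ltnS.
have S1 := (slice1 _ pk z.1 (nd p).1 (le_trans z1 rK) (le_trans b1 rK4)).2.
have T2 : C ^+ 2 * M * `|z.2 - (nd p).2| / r <= C ^+ 2 * M * delta.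
  rewrite -mulrA; apply: ler_wpM2l; first by rewrite mulr_ge0// exprn_ge0// ltW.
  by rewrite ler_pdivrMr//; exact: zb.2.
have T1 : C * M * `|z.1 - (nd p).1| / r <= C * M * delta.
  rewrite -mulrA; apply: ler_wpM2l; first by rewrite mulr_ge0// ltW.
  by rewrite ler_pdivrMr//; exact: zb.1.
have : `|q z - q (nd p)| <= (C ^+ 2 + C) * delta * M.
  rewrite (_ : q z - q (nd p) = (q (z.1, z.2) - q (z.1, (nd p).2)) + (q (z.1, (nd p).2) - q ((nd p).1, (nd p).2))).
    apply: (le_trans (ler_normD _ _)); rewrite /= in S1 S2 T1 T2 *; nra.
  by rewrite addrA subrK -!surjective_pairing.
have H1 : (C ^+ 2 + C) * delta * M <= 2^-1 * M by exact: ler_wpM2r.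
have := ler_normB (q z) (q z - q (nd p)); rewrite opprB addrCA subrr addr0 -/M; lra.
Qed.

Lemma bipolyD k q q' : bipoly k q -> bipoly k q' -> bipoly k (fun x => q x + q' x).
Proof.
move=> [c ->] [c' ->]; exists (fun i j => c i j + c' i j); apply/funext => x.
rewrite -big_split; apply: eq_bigr => i _; rewrite -big_split; apply: eq_bigr => j _.
by rewrite /= !mulrDl.
Qed.

Lemma bipolyZ k a q : bipoly k q -> bipoly k (fun x => a * q x).
Proof.
move=> [c ->]; exists (fun i j => a * c i j); apply/funext => x.
rewrite mulr_sumr; apply: eq_bigr => i _; rewrite mulr_sumr; apply: eq_bigr => j _.
by rewrite !mulrA.
Qed.

Lemma bipoly_sum k n (F : 'I_n -> R * R -> R) : (forall i, bipoly k (F i)) ->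
  bipoly k (fun x => \sum_(i < n) F i x).
Proof.
move=> H; elim: (index_enum _) => [|i s IH].
  exists (fun _ _ => 0); apply/funext => x; rewrite big_nil big1// => i _.
  by rewrite big1// => j _; rewrite !mul0r.
by under eq_fun do rewrite big_cons; exact: bipolyD.
Qed.

Lemma bipoly_monomial k i j : (i <= k)%N -> (j <= k)%N ->
  bipoly k (fun x => x.1 ^+ i * x.2 ^+ j).
Proof.
move=> ik jk; exists (fun a b => ((a == i) && (b == j))%:R); apply/funext => x.
rewrite -ltnS in ik; rewrite -ltnS in jk.
rewrite (bigD1 (Ordinal ik))//= (bigD1 (Ordinal jk))//= !eqxx mul1r.
rewrite !big1 ?addr0// => [a ai|b bj].
  apply: big1 => b _; rewrite (_ : (_ == i :> nat) = false) ?mul0r//.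
  exact: negbTE.
by rewrite (_ : (_ == j :> nat) = false) ?mul0r//; exact: negbTE.
Qed.

Lemma is_derive_quotient (f : R * R -> R) x v (l : R) :
  (forall h, h != 0 -> f (h *: v + x) - f x = h * l) -> is_derive x v f l.
Proof.
move=> H.
have L : h^-1 *: ((f \o shift x) (h *: v) - f x) @[h --> 0^'] --> l.
  apply: cvg_near_cst; near=> h.
  have h0 : h != 0 by near: h; exact: nbhs_dnbhs_neq.
  by rewrite /= H// scalerA mulVf// scale1r.
by apply: DeriveDef; [apply/cvg_ex; exists l|apply: cvg_lim].
Unshelve. all: by end_near. Qed.

(** A single formula for all directions v serves the gradient, the normal derivative and the mean
    value theorem along segments. *)
Lemma poly2_derive k p : poly2 k p -> exists p1 p2, [/\ bipoly k p, bipoly k p1, bipoly k p2 &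
  forall x v, is_derive x v p (v.1 * p1 x + v.2 * p2 x)].
Proof.
case=> c pE.
pose m i j x := c i j * (x.1 ^+ i * x.2 ^+ j).
pose m1 i j x := c i j * i%:R * (x.1 ^+ i.-1 * x.2 ^+ j).
pose m2 i j x := c i j * j%:R * (x.1 ^+ i * x.2 ^+ j.-1).
pose s (f : nat -> nat -> R * R -> R) x := \sum_(i < k.+1) \sum_(j < (k - i).+1) f i j x.
have bd i j : (i < k.+1)%N -> (j < (k - i).+1)%N -> (i <= k)%N /\ (j <= k)%N.
  by rewrite !ltnS => ik /leq_trans->//; rewrite leq_subr.
have sB f : (forall i j, (i <= k)%N -> (j <= k)%N -> bipoly k (f i j)) -> bipoly k (s f).
  move=> H; apply: bipoly_sum => i; apply: bipoly_sum => j.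
  by have [ik jk] := bd _ _ (ltn_ord i) (ltn_ord j); exact: H.
have pE' : p = s m.
  rewrite pE; apply/funext => x; apply: eq_bigr => i _; apply: eq_bigr => j _.
  by rewrite /m mulrA.
exists (s m1), (s m2); split.
- by rewrite pE'; apply: sB => i j ik jk; apply/bipolyZ/bipoly_monomial.
- by apply: sB => i j ik jk; apply/bipolyZ/bipoly_monomial => //; rewrite (leq_trans (leq_pred _)).
- by apply: sB => i j ik jk; apply/bipolyZ/bipoly_monomial => //; rewrite (leq_trans (leq_pred _)).
move=> x v; rewrite pE'.
have dm i j : is_derive x v (m i j) (v.1 * m1 i j x + v.2 * m2 i j x).
  have d1 : is_derive x v (@fst R R) v.1.
    by apply: is_derive_quotient => h _ /=; rewrite addrK.
  have d2 : is_derive x v (@snd R R) v.2.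
    by apply: is_derive_quotient => h _ /=; rewrite addrK.
  have := is_deriveZ (c i j) (is_deriveM (is_deriveX i d1) (is_deriveX j d2)).
  rewrite (_ : _ \*: _ = m i j); last first.
    by apply/funext => y; rewrite /m /= !fctE.
  move/is_derive_eq; apply; rewrite /m1 /m2 /= !fctE /GRing.scale /=; ring.
have -> : s m = \sum_(i < k.+1) \sum_(j < (k - i).+1) m i j.
  by apply/funext => y; rewrite fct_sumE; apply: eq_bigr => i _; rewrite fct_sumE.
have := is_derive_sum (fun i : 'I_k.+1 => is_derive_sum (fun j : 'I_(k - i).+1 => dm i j)).
move/is_derive_eq; apply; rewrite /s !mulr_sumr -big_split; apply: eq_bigr => i _.
by rewrite !mulr_sumr -big_split.
Qed.
End BivariatePolynomials.

(** * Triangles *)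

Section Triangles.
Variable R : realType.
Implicit Types (x y p q g : R * R) (T : triangle R) (s : seq (R * R)).

Lemma dotC x y : dot x y = dot y x.
Proof. by rewrite /dot mulrC [x.2 * _]mulrC. Qed.

Lemma dotDr x y p : dot x (y + p) = dot x y + dot x p.
Proof. by rewrite /dot /=; ring. Qed.

Lemma dotBr x y p : dot x (y - p) = dot x y - dot x p.
Proof. by rewrite /dot /=; ring. Qed.

Lemma dotZr x (a : R) y : dot x (a *: y) = a * dot x y.
Proof. by rewrite /dot /= /GRing.scale /=; ring. Qed.

Lemma dot_sumr x (I : Type) (r : seq I) (F : I -> R * R) :
  dot x (\sum_(i <- r) F i) = \sum_(i <- r) dot x (F i).
Proof.
elim: r => [|i r IH]; first by rewrite !big_nil /dot /= !mulr0 addr0.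
by rewrite !big_cons dotDr IH.
Qed.

Lemma dot_ge0 x : 0 <= dot x x.
Proof. by rewrite /dot -!expr2 addr_ge0// sqr_ge0. Qed.

Lemma dot_eq0 x : (dot x x == 0) = (x == 0).
Proof.
rewrite /dot -!expr2 paddr_eq0 ?sqr_ge0// !sqrf_eq0.
by case: x => a b; rewrite xpair_eqE.
Qed.

Lemma enorm_ge0 x : 0 <= enorm x. Proof. exact: sqrtr_ge0. Qed.

Lemma enorm_sqr x : enorm x ^+ 2 = dot x x.
Proof. by rewrite sqr_sqrtr// dot_ge0. Qed.

Lemma enorm_gt0 x : (0 < enorm x) = (x != 0).
Proof. by rewrite sqrtr_gt0 lt_def dot_ge0 andbT dot_eq0. Qed.

Lemma enormZ (a : R) x : enorm (a *: x) = `|a| * enorm x.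
Proof.
rewrite /enorm dotZr dotC dotZr mulrA -expr2 sqrtrM ?sqr_ge0//.
by rewrite sqrtr_sqr.
Qed.

Lemma dot_cauchy x y : `|dot x y| <= enorm x * enorm y.
Proof.
rewrite -sqrtrM ?dot_ge0// -sqrtr_sqr ler_sqrt ?mulr_ge0 ?dot_ge0//.
have := sqr_ge0 (x.1 * y.2 - x.2 * y.1); rewrite /dot !expr2; nra.
Qed.

Lemma enorm_coord x : `|x.1| <= enorm x /\ `|x.2| <= enorm x.
Proof.
by split; rewrite -sqrtr_sqr ler_sqrt ?dot_ge0// /dot -!expr2 ?lerDl ?lerDr sqr_ge0.
Qed.

Lemma enorm_le_coord x (r : R) : 0 <= r -> `|x.1| <= r -> `|x.2| <= r -> enorm x <= 2 * r.
Proof.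
move=> r0 /ler_normlP[h1 h1'] /ler_normlP[h2 h2'].
rewrite -[2 * r]ger0_norm ?mulr_ge0// -sqrtr_sqr ler_sqrt ?sqr_ge0// /dot expr2; nra.
Qed.

Lemma enorm_le1 x : dot x x <= 1 -> enorm x <= 1.
Proof. by move=> x1; rewrite -[leRHS]sqrtr1 ler_sqrt. Qed.

(** The value of an affine function at a convex combination is the combination of its values.
    Carrying phi with its gradient g lets barycentric coordinates, linear bounds and differences of
    interpolants all fit. *)
Lemma hull_sub s p (phi : R * R -> R) g : (forall x y, phi x = phi y + dot g (x - y)) ->
  (forall x, x \in s -> 0 <= phi x) -> hull s p -> 0 <= phi p.
Proof.
move=> aff s0 [w [w0 w1 ->]]; set c := \sum_(_ < _) _.
have -> : phi c = \sum_(i < size s) w i * phi s`_i.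
  have E x : phi x = phi 0 + dot g x by rewrite (aff x 0) subr0.
  rewrite E dot_sumr -[phi 0]mul1r -w1 mulr_suml -big_split; apply: eq_bigr => i _.
  by rewrite (E s`_i) /dot /= /GRing.scale /=; ring.
by apply: sumr_ge0 => i _; rewrite mulr_ge0// s0// mem_nth.
Qed.

Lemma hull_eq0 s p (phi : R * R -> R) g : (forall x y, phi x = phi y + dot g (x - y)) ->
  (forall x, x \in s -> phi x = 0) -> hull s p -> phi p = 0.
Proof.
move=> aff s0 hp; apply/eqP; rewrite eq_le; apply/andP; split; last first.
  by apply: (hull_sub aff _ hp) => x /s0 ->.
rewrite -oppr_ge0; apply: (@hull_sub s p (fun x => - phi x) (- g)) hp => [x y|x /s0 ->].
  by rewrite (aff x y) /dot /=; ring.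
by rewrite oppr0.
Qed.

Definition cross (x y : R * R) : R := x.1 * y.2 - x.2 * y.1.

(** Cramer's rule: the doubled signed area of the triangle with v replaced by p, over that of T.
    Taking b and c after v in cyclic order keeps the orientation. *)
Definition bary T v p : R :=
  let i := index v T in
  let b := T`_((i + 1) %% 3) in let c := T`_((i + 2) %% 3) in
  cross (b - p) (c - p) / area2 T.

Definition gbary T v : R * R :=
  let i := index v T in
  let b := T`_((i + 1) %% 3) in let c := T`_((i + 2) %% 3) in
  (area2 T)^-1 *: (b.2 - c.2, c.1 - b.1).

Lemma baryE T v p q : bary T v p = bary T v q + dot (gbary T v) (p - q).
Proof.
rewrite /bary /gbary /=; set b := T`_ _; set c := T`_ _.
rewrite /cross /dot /= /GRing.scale /=; ring.
Qed.

Lemma tri_seq T : exists a b c, T = [:: a; b; c] :> seq _ /\ area2 T = cross (b - a) (c - a).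
Proof. by case/tupleP: T => a T; case/tupleP: T => b T; case/tupleP: T => c T; rewrite tuple0; exists a, b, c. Qed.

Section Nondegenerate.
Variable T : triangle R.
Hypothesis T0 : area2 T != 0.

Lemma tri_uniq : uniq T.
Proof.
have [a [b [c [E A]]]] := tri_seq T; move: T0; rewrite A E /= !inE negb_or.
rewrite -!andbA andbT => A0; apply/and3P; split; apply: contra A0 => /eqP->;
  by rewrite /cross; apply/eqP; rewrite /=; ring.
Qed.

Lemma bary_vertices p :
  exists a b c, [/\ T = [:: a; b; c] :> seq _, cross (b - a) (c - a) != 0,
   [/\ bary T a p = cross (b - p) (c - p) / cross (b - a) (c - a),
       bary T b p = cross (c - p) (a - p) / cross (b - a) (c - a)
     & bary T c p = cross (a - p) (b - p) / cross (b - a) (c - a)] &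
   forall (V : nmodType) (h : R * R -> V), \sum_(v <- T) h v = h a + h b + h c].
Proof.
have [a [b [c [E A]]]] := tri_seq T; have := tri_uniq.
exists a, b, c; split => //; first by rewrite -A.
  move: H; rewrite /bary A E /= !inE negb_or -!andbA andbT => /and3P[ab ac bc].
  by rewrite !eqxx (negbTE ab) (negbTE ac) (negbTE bc) /=.
by move=> V h; rewrite E !big_cons big_nil addr0 addrA.
Qed.

Ltac unfold_bary := rewrite /cross /dot /= ?/GRing.scale /=.

Lemma bary_sum p : \sum_(v <- T) bary T v p = 1.
Proof.
have [a [b [c [_ A [Ea Eb Ec] hE]]]] := bary_vertices p; rewrite hE Ea Eb Ec.
rewrite -!mulrDl; apply: (mulIf A); rewrite mulfVK// mul1r; unfold_bary; ring.
Qed.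

Lemma bary_comb p : \sum_(v <- T) bary T v p *: v = p.
Proof.
have [a [b [c [_ A [Ea Eb Ec] hE]]]] := bary_vertices p; rewrite hE Ea Eb Ec.
move: A {Ea Eb Ec hE}; case: a b c p => [a1 a2] [b1 b2] [c1 c2] [p1 p2].
rewrite /cross /= => A; congr pair; rewrite /= /GRing.scale /=; field; exact: A.
Qed.

Lemma bary_at v x : v \in T -> x \in T -> bary T v x = (v == x)%:R.
Proof.
have [a [b [c [E A [Ha Hb Hc] _]]]] := bary_vertices x; have := tri_uniq.
have memE w : (w \in T) = (w \in [:: a; b; c]) by rewrite -E.
rewrite !memE E /= !inE negb_or -!andbA andbT => /and3P[ab ac bc].
case/or3P => /eqP-> /or3P[] /eqP xE; rewrite ?Ha ?Hb ?Hc xE ?eqxx;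
  rewrite ?(negbTE ab) ?(negbTE ac) ?(negbTE bc) ?[b == a]eq_sym ?[c == a]eq_sym ?[c == b]eq_sym;
  rewrite ?(negbTE ab) ?(negbTE ac) ?(negbTE bc);
  apply: (mulIf A); rewrite mulfVK//; unfold_bary; ring.
Qed.

(** Differentiates [bary_sum]. It lets a constant be subtracted from nodal values without changing
    the gradient of the interpolant. *)
Lemma gbary_sum : \sum_(v <- T) gbary T v = 0.
Proof.
have H (e : R * R) : \sum_(v <- T) dot (gbary T v) e = 0.
  have := subrr (1 : R); rewrite -{1}(bary_sum e) -(bary_sum 0) -sumrB => S0.
  rewrite -[RHS]S0; apply: eq_bigr => v _.
  by rewrite (baryE _ _ e 0) addrAC subrr add0r subr0.
apply/eqP; rewrite -dot_eq0 dot_sumr; apply/eqP; rewrite -[RHS](H (\sum_(v <- T) gbary T v)).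
by apply: eq_bigr => v _; rewrite dotC.
Qed.

Lemma hull_baryP p : hull T p <-> forall v, v \in T -> 0 <= bary T v p.
Proof.
split=> [hp v vT|H].
  apply: (hull_sub (fun x y => baryE T v x y)) hp => x xT.
  by rewrite bary_at// ler0n.
exists (fun i => if (i < 3)%N then bary T T`_i p else 0); rewrite size_tuple; split.
- by move=> i; case: ltnP => // i3; rewrite H// mem_nth// size_tuple.
- rewrite -[RHS](bary_sum p) [RHS](big_nth 0) size_tuple big_mkord.
  by apply: eq_bigr => i _; rewrite ltn_ord.
- rewrite -[LHS](bary_comb p) [LHS](big_nth 0) size_tuple big_mkord.
  by apply: eq_bigr => i _; rewrite ltn_ord.
Qed.

Lemma vertex_hull v : v \in T -> hull T v.
Proof. by move=> vT; apply/hull_baryP => x xT; rewrite bary_at// ler0n. Qed.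

Lemma bary_le1 v p : hull T p -> v \in T -> bary T v p <= 1.
Proof.
move=> /hull_baryP hp vT; rewrite -(bary_sum p) (big_rem v)//= lerDl.
by rewrite big_seq sumr_ge0// => x /mem_rem; exact: hp.
Qed.

(** The sum formula is stated for every V because it is applied to numbers and to points alike;
    later arguments then need not know the positions of x and y in the tuple. *)
Lemma third_vertex x y : x \in T -> y \in T -> x != y -> exists z,
  [/\ z \in T, z != x, z != y, (forall v, v \in T -> [\/ v = x, v = y | v = z]) &
      forall (V : nmodType) (h : R * R -> V), \sum_(v <- T) h v = h x + h y + h z].
Proof.
have [a [b [c [E A _ hE]]]] := bary_vertices 0.
have memE w : (w \in T) = (w \in [:: a; b; c]) by rewrite -E.
have : uniq [:: a; b; c] by rewrite -E tri_uniq.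
rewrite !memE /= !inE negb_or -!andbA andbT => /and3P[ab ac bc].
have fin u v w : [:: a; b; c] =i [:: u; v; w] -> w != u -> w != v ->
    (forall (V : nmodType) (h : R * R -> V), h a + h b + h c = h u + h v + h w) ->
    exists z, [/\ z \in T, z != u, z != v, (forall t, t \in T -> [\/ t = u, t = v | t = z]) &
      forall (V : nmodType) (h : R * R -> V), \sum_(t <- T) h t = h u + h v + h z].
  move=> M wu wv hw; exists w; split => //; last by move=> V h; rewrite hE hw.
    by rewrite memE M !inE eqxx !orbT.
  move=> t; rewrite memE M !inE => /or3P[] /eqP; [constructor 1|constructor 2|constructor 3] => //.
have perm u v w : perm_eq [:: a; b; c] [:: u; v; w] -> w != u -> w != v ->
    exists z, [/\ z \in T, z != u, z != v, (forall t, t \in T -> [\/ t = u, t = v | t = z]) &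
      forall (V : nmodType) (h : R * R -> V), \sum_(t <- T) h t = h u + h v + h z].
  move=> P wu wv; apply: fin (perm_mem P) wu wv _ => V h.
  have : \sum_(t <- [:: a; b; c]) h t = \sum_(t <- [:: u; v; w]) h t by exact: perm_big.
  by rewrite !big_cons !big_nil !addr0 !addrA.
have ba : b != a by rewrite eq_sym.
have ca : c != a by rewrite eq_sym.
have cb : c != b by rewrite eq_sym.
case/or3P => /eqP-> /or3P[] /eqP ->; rewrite ?eqxx// => _.
- exact: (perm a b c).
- by apply: (perm a c b) => //; apply/permP => P /=; ring.
- by apply: (perm b a c) => //; apply/permP => P /=; ring.
- by apply: (perm b c a) => //; apply/permP => P /=; ring.
- by apply: (perm c a b) => //; apply/permP => P /=; ring.
- by apply: (perm c b a) => //; apply/permP => P /=; ring.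
Qed.

(** [dot e (p - q)] is affine in p and in q, so its maximum over the hull is attained at vertices,
    where [diam] measures it. *)
Lemma hull_dot_diam e p q : dot e e <= 1 -> hull T p -> hull T q -> dot e (p - q) <= diam T.
Proof.
move=> e1 hp hq.
have V v w : v \in T -> w \in T -> dot e (v - w) <= diam T.
  move=> vT wT; apply: (@le_trans _ _ (enorm (v - w))).
    apply: le_trans (ler_norm _) (le_trans (dot_cauchy _ _) _).
    by rewrite ler_piMl ?enorm_ge0 ?enorm_le1.
  rewrite /diam; apply: (@le_trans _ _ (\big[Num.max/0]_(y <- T) enorm (v - y))).
    exact: (@le_bigmax_seq _ _ _ _ _ w predT (fun y => enorm (v - y)) wT isT).
  exact: (@le_bigmax_seq _ _ _ _ _ v predT (fun x => \big[Num.max/0]_(y <- T) enorm (x - y)) vT isT).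
rewrite -subr_ge0.
apply: (@hull_sub T q (fun q => diam T - dot e (p - q)) e) hq => [x y|w wT].
  by rewrite !dotBr; ring.
apply: (@hull_sub T p (fun p => diam T - dot e (p - w)) (- e)) hp => [x y|v vT].
  by rewrite /dot /=; ring.
by rewrite subr_ge0 V.
Qed.

Lemma hull_diam p q : hull T p -> hull T q -> `|p.1 - q.1| <= diam T /\ `|p.2 - q.2| <= diam T.
Proof.
move=> hp hq; have H e : dot e e <= 1 -> `|dot e (p - q)| <= diam T.
  move=> e1; rewrite ler_norml hull_dot_diam// andbT lerNl.
  rewrite (_ : - dot _ _ = dot e (q - p)); first exact: hull_dot_diam.
  by rewrite !dotBr opprB.
split.
  have := H (1, 0); rewrite /dot /= !mul1r !mul0r !addr0; exact.
have := H (0, 1); rewrite /dot /= !mul1r !mul0r !add0r; exact.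
Qed.

(* The barycentric coordinates vary by at most 1 over an inscribed ball. *)
Lemma gbary_bound x (r : R) v : 0 < r -> [set y | enorm (y - x) <= r] `<=` hull T -> v \in T ->
  `|(gbary T v).1| <= r^-1 /\ `|(gbary T v).2| <= r^-1.
Proof.
move=> r0 sub vT.
have H e : dot e e <= 1 -> dot (gbary T v) e <= r^-1.
  move=> e1; have hx : hull T x by apply: sub; rewrite /= subrr /enorm /dot /= !mulr0 addr0 sqrtr0 ltW.
  have he : hull T (x + r *: e).
    apply: sub; rewrite /= addrAC subrr add0r enormZ gtr0_norm// ler_piMr ?enorm_le1 ?(ltW r0)//.
  have b1 := bary_le1 he vT; have b0 := (hull_baryP x).1 hx v vT.
  move: b1; rewrite (baryE _ _ _ x) addrAC subrr add0r dotZr => b1.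
  by rewrite -[r^-1]mul1r ler_pdivlMr// mulrC; lra.
move: (gbary T v) H => g H.
have E1 : dot (1, 0) (1, 0) <= 1 :> R by rewrite /dot /=; lra.
have E2 : dot (0, 1) (0, 1) <= 1 :> R by rewrite /dot /=; lra.
have E3 : dot (-1, 0) (-1, 0) <= 1 :> R by rewrite /dot /=; lra.
have E4 : dot (0, -1) (0, -1) <= 1 :> R by rewrite /dot /=; lra.
move: (H _ E1) (H _ E2) (H _ E3) (H _ E4); rewrite /dot /= => h1 h2 h3 h4.
by split; rewrite ler_norml; apply/andP; split; lra.
Qed.

End Nondegenerate.
End Triangles.

(** * Lebesgue measure in the plane *)

Section PlaneMeasure.
Variable R : realType.
Notation mu := (@lebesgue_measure R).
Definition plane_measure := [the measure _ _ of (mu \x mu)%E].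
Notation mu2 := plane_measure.

Lemma plane_measureX (A B : set R) : measurable A -> measurable B ->
  mu2 (A `*` B) = (mu A * mu B)%E.
Proof. by move=> mA mB; exact: product_measure1E. Qed.
Implicit Types (x g p : R * R).

Lemma boxE x (r : R) : box x r = `[x.1 - r, x.1 + r] `*` `[x.2 - r, x.2 + r].
Proof.
by apply/seteqP; split => y /=; rewrite /box /= !in_itv /= !ler_distl.
Qed.

Lemma measurable_box x (r : R) : measurable (box x r).
Proof. by rewrite boxE; apply: measurableX; exact: measurable_itv. Qed.

Lemma measure_box x (r : R) : 0 <= r -> mu2 (box x r) = ((2 * r) ^+ 2)%:E.
Proof.
move=> r0; rewrite boxE.
have E (a : R) : mu `[a - r, a + r]%classic = (2 * r)%:E.
  rewrite lebesgue_measure_itv /= lte_fin; case: ltP => [_|].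
    by rewrite -EFinB; congr EFin; ring.
  move=> H; have r00 : r = 0 by lra.
    by rewrite r00 mulr0.
rewrite plane_measureX; [|exact: measurable_itv|exact: measurable_itv].
transitivity ((2 * r)%:E * (2 * r)%:E)%E; last by rewrite -EFinM expr2.
by congr (_ * _)%E; exact: E.
Qed.

Lemma measurable_dot g : measurable_fun setT (dot g).
Proof.
apply: measurable_funD; apply: measurable_funM => //; exact: measurable_cst.
Qed.

(** A vertical line is a product with a one-point factor; every other line has one-point
    sections. *)
Lemma line_null g (c : R) : g != 0 ->
  measurable [set p | dot g p = c] /\ mu2 [set p | dot g p = c] = 0%E.
Proof.
move=> g0.
have mA : measurable [set p | dot g p = c].
  rewrite (_ : [set _ | _] = setT `&` dot g @^-1` [set c]); last by rewrite setTI.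
  exact: measurable_dot.
split => //; have [g20|g2N0] := eqVneq g.2 0.
  have g1N0 : g.1 != 0.
    by apply: contra g0 => /eqP g10; case: g g10 g20 mA => a b /= -> ->.
  have -> : [set p | dot g p = c] = [set c / g.1] `*` setT.
    apply/seteqP; split=> p /=; rewrite /dot g20 mul0r addr0.
      by move=> <-; split => //; rewrite mulrAC divff// mul1r.
    by move=> [-> _]; rewrite mulrCA divff// mulr1.
  rewrite plane_measureX; [|exact: measurable_set1|exact: measurableT].
  by transitivity (0 * mu setT)%E; [congr (_ * _)%E; exact: lebesgue_measure_set1|rewrite mul0e].
rewrite /plane_measure /product_measure1 /=; apply: integral0_eq => t _ /=.
suff -> : xsection [set p | dot g p = c] t = [set (c - g.1 * t) / g.2].
  exact: lebesgue_measure_set1.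
apply/seteqP; split => y /=; rewrite /xsection /= inE /= /dot /=.
  by move=> <-; rewrite addrAC subrr add0r mulrAC divff// mul1r.
by move=> ->; rewrite mulrCA divff// mulr1 addrC subrK.
Qed.

Lemma measurable_bipoly k (q : R * R -> R) : bipoly k q -> measurable_fun setT q.
Proof.
case=> c ->; apply: measurable_sum => i; apply: measurable_sum => j.
apply: measurable_funM; last exact: measurable_funX.
by apply: measurable_funM => //; exact: measurable_funX.
Qed.

Lemma bipoly_bounded k (q : R * R -> R) (B : R) : bipoly k q ->
  exists C, forall x, box 0 B x -> `|q x| <= C.
Proof.
case=> c ->; exists (\sum_(i < k.+1) \sum_(j < k.+1) `|c i j| * B ^+ i * B ^+ j).
move=> x [x1 x2]; rewrite !subr0 in x1 x2.
apply: le_trans (ler_norm_sum _ _ _) _; apply: ler_sum => i _.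
apply: le_trans (ler_norm_sum _ _ _) _; apply: ler_sum => j _.
rewrite !normrM !normrX; apply: ler_pM => //; rewrite ?mulr_ge0 ?exprn_ge0//.
  by apply: ler_pM => //; rewrite ?exprn_ge0// lerXn2r ?nnegrE// (le_trans _ x1).
by rewrite lerXn2r ?nnegrE// (le_trans _ x2).
Qed.

End PlaneMeasure.

(** * Sides of the polygon *)

Lemma dot_continuous (R : realType) (g : R * R) : continuous (dot g).
Proof.
move=> x; apply: cvgD; apply: cvgM; try exact: cvg_cst; [exact: cvg_fst|exact: cvg_snd].
Qed.

Section Sides.
Variable R : realType.
Implicit Types (x y z p q g w : R * R) (s : side R).

Lemma side_pointE s (t u : R) : side_point s t = side_point s u + (t - u) *: (s.2 - s.1).
Proof. by congr pair; rewrite /= /GRing.scale /=; ring. Qed.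

Lemma side_length_gt0 s : s.1 != s.2 -> 0 < side_length s.
Proof. by move=> s12; rewrite enorm_gt0 subr_eq0 eq_sym. Qed.

Section NondegenerateSide.
Variable s : side R.
Hypothesis s12 : s.1 != s.2.
Let d := s.2 - s.1.
Let n := side_normal s.

Lemma side_dirE : d = side_length s *: (- n.2, n.1).
Proof.
have l0 := side_length_gt0 s12; have lN0 : side_length s != 0 by rewrite gt_eqF.
rewrite /n /side_normal; move: (side_length s) lN0 => l lN0.
by congr pair; rewrite /= /GRing.scale /=; field.
Qed.

Lemma normal_unit : dot n n = 1.
Proof.
have l0 := side_length_gt0 s12; have lN0 : side_length s != 0 by rewrite gt_eqF.
apply: (mulfI (expf_neq0 2 lN0)); rewrite mulr1.
have := enorm_sqr d; rewrite {2 3}side_dirE => E; rewrite [RHS]E.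
rewrite /dot /= /GRing.scale /=; ring.
Qed.

Lemma normal_dir : dot n d = 0.
Proof. rewrite side_dirE /dot /= /GRing.scale /=; ring. Qed.

Lemma dot_normal_decomp g w : dot g d = 0 -> dot g w = dot g n * dot n w.
Proof.
have lN0 : side_length s != 0 by rewrite gt_eqF// side_length_gt0.
move=> gd; have e : g.1 * n.2 = g.2 * n.1.
  move: gd; rewrite side_dirE dotZr => /eqP; rewrite mulf_eq0 (negbTE lN0)/= /dot /= => /eqP; lra.
have n1 := normal_unit; rewrite /dot in n1 *.
rewrite -[LHS]mulr1 -n1.
transitivity (g.1 * n.1 * (n.1 * w.1) + g.2 * n.2 * (n.2 * w.2) + (g.1 * n.2) * (n.2 * w.1) + (g.2 * n.1) * (n.1 * w.2)); first by ring.
rewrite e -e.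
transitivity (g.1 * n.1 * (n.1 * w.1) + g.2 * n.2 * (n.2 * w.2) + (g.2 * n.1) * (n.2 * w.1) + (g.1 * n.2) * (n.1 * w.2)); last by ring.
by rewrite e.
Qed.

Definition side_param p : R := dot (p - s.1) d / side_length s ^+ 2.

Lemma side_pointK : cancel (side_point s) side_param.
Proof.
move=> t; have lN0 : side_length s != 0 by rewrite gt_eqF// side_length_gt0.
rewrite /side_param /side_point addrAC subrr add0r dotC dotZr.
by rewrite enorm_sqr mulfK// -enorm_sqr sqrf_eq0.
Qed.

Lemma on_lineP x p : dot n (p - x) = 0 -> (exists t, x = side_point s t) -> exists t, p = side_point s t.
Proof.
have lN0 : side_length s != 0 by rewrite gt_eqF// side_length_gt0.
move=> np [t xE]; rewrite xE {xE x} in np; exists (t + dot (p - side_point s t) (- n.2, n.1) / side_length s).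
rewrite (side_pointE _ _ t) [t + _]addrC addrK -/d side_dirE scalerA mulfVK//.
suff H w m : dot m m = 1 -> dot m w = 0 -> w = dot w (- m.2, m.1) *: (- m.2, m.1) :> R * R.
  by rewrite -(H (p - side_point s t) n)// ?normal_unit// addrC subrK.
case: w m => [w1 w2] [m1 m2]; rewrite /dot /= /GRing.scale /= => mm mw.
congr pair; rewrite /= /GRing.scale /=.
  transitivity (w1 * (m1 * m1 + m2 * m2) - m1 * (m1 * w1 + m2 * w2)); last by ring.
  by rewrite mm mw mulr0 subr0 mulr1.
transitivity (w2 * (m1 * m1 + m2 * m2) - m2 * (m1 * w1 + m2 * w2)); last by ring.
by rewrite mm mw mulr0 subr0 mulr1.
Qed.

Lemma closed_side_normal x y : closed_side s x -> closed_side s y -> dot n (x - y) = 0.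
Proof.
move=> [t _ <-] [u _ <-]; rewrite (side_pointE s t u) addrAC subrr add0r dotZr.
by rewrite normal_dir mulr0.
Qed.

End NondegenerateSide.
End Sides.

Section Polygon.
Variables (R : realType) (Omega : set (R * R)) (sides : seq (side R)).
Hypothesis hOmega : polygonal_domain Omega sides.
Implicit Types (x y z p q : R * R) (s : side R).

Lemma side_neq s : s \in sides -> s.1 != s.2.
Proof. by case: hOmega => _ [_ H] _ _ _; exact: H. Qed.

Lemma closed_side_boundary s p : s \in sides -> closed_side s p -> polygon_boundary Omega p.
Proof. by case: hOmega => _ _ -> _ _ ss sp; exists s. Qed.

Lemma boundary_closed_side p : polygon_boundary Omega p -> exists2 s, s \in sides & closed_side s p.
Proof. by case: hOmega => _ _ -> _ _. Qed.

(** A point q strictly beyond the side has a neighbourhood free of Omega, so it is not in the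
    closure. This is what forces elements onto the inner side of s. *)
Lemma near_closure_halfplane s p : s \in sides -> open_side s p ->
  \forall q \near p, closure Omega q -> dot (q - p) (side_normal s) <= 0.
Proof.
move=> ss sp; case: hOmega => _ _ _ _ /(_ s p ss sp) H.
have H' : \forall q \near p, \forall y \near q, Omega y <-> dot (y - p) (side_normal s) < 0.
  exact: (near_join H).
near=> q => cq; rewrite leNgt; apply/negP => d0.
have Hq : \forall y \near q, Omega y <-> dot (y - p) (side_normal s) < 0 by near: q.
have cont : \forall y \near q, 0 < dot (y - p) (side_normal s).
  have qp : dot (side_normal s) p < dot (side_normal s) q.
    by move: d0; rewrite dotC dotBr subr_gt0.
  have C : \forall y \near q, dot (side_normal s) p < dot (side_normal s) y.
    exact: (@dot_continuous _ _ q _ (lt_nbhsr qp)).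
  by apply: filterS C => y; rewrite [dot (y - p) _]dotC dotBr subr_gt0.
have [y [Oy /= [y1 y2]]] := cq _ (filterI Hq cont).
by have := y1.1 Oy; rewrite ltNge (ltW y2).
Unshelve. all: by end_near. Qed.


Lemma near_segment (p z : R * R) (P : R * R -> Prop) : (\forall q \near p, P q) ->
  exists2 t : R, 0 < t <= 1 & P (p + t *: (z - p)).
Proof.
move=> H.
have c0 : (fun t : R => p + t *: (z - p)) @ 0^'+ --> p.
  have -> : nbhs p = nbhs (p + (0 : R) *: (z - p)) by rewrite scale0r addr0.
  apply: cvgD; first exact: cvg_cst.
  by apply: cvgZr_tmp; apply: cvg_at_right_filter; exact: cvg_id.
have : \forall t \near 0^'+, P (p + t *: (z - p)) by exact: c0.
move=> Ht.
have [t [[t0 t1] Pt]] : exists t : R, (0 < t /\ t <= 1) /\ P (p + t *: (z - p)).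
  apply: (@filter_ex _ (0 : R)^'+ _ (fun t => (0 < t /\ t <= 1) /\ P (p + t *: (z - p)))).
  near=> t; split; last by near: t.
  by split; near: t; [exact: nbhs_right_gt|exact: nbhs_right_le].
by exists t => //; rewrite t0.
Unshelve. all: by end_near. Qed.

(** The supporting lines cross, are parallel, or coincide. Where the sides stay apart, e lies below
    their distance and the conclusion is vacuous; otherwise points of s approach s' only at an end
    of s, at a linear rate that e records. *)
Lemma sides_apart s s' : s \in sides -> s' \in sides -> s != s' ->
  exists2 e : R, 0 < e & forall p q, closed_side s p -> closed_side s' q -> forall r : R,
    `|(p - q).1| <= r -> `|(p - q).2| <= r -> r < e ->
    box s.1 (r / e) p \/ box s.2 (r / e) p.
Proof.
move=> ss ss' nss.
have disj p : open_side s p -> closed_side s' p -> False.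
  case: hOmega => _ _ _ /(_ s s' ss ss' nss) H _ op cp.
  by have : set0 p by rewrite -H.
have disj' p : open_side s' p -> closed_side s p -> False.
  case: hOmega => _ _ _ /(_ s' s ss' ss) H _ op cp.
  by have : set0 p by rewrite -H// eq_sym.
set d := s.2 - s.1; set d' := s'.2 - s'.1; set e0 := s'.1 - s.1.
have d0 : d != 0 by rewrite subr_eq0 eq_sym side_neq.
pose c := cross d d'; pose D := `|d.1| + `|d.2| + `|d'.1| + `|d'.2| + 1.
have D1 : 1 <= D by rewrite lerDr !addr_ge0.
have crossb a v (r : R) : `|v.1| <= r -> `|v.2| <= r -> `|a.1| <= D -> `|a.2| <= D -> `|cross v a| <= 2 * D * r.
  move=> v1 v2 a1 a2; apply: le_trans (ler_normB _ _) _; rewrite !normrM.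
  have := ler_pM (normr_ge0 _) (normr_ge0 _) v1 a2.
  have := ler_pM (normr_ge0 _) (normr_ge0 _) v2 a1; lra.
have [dD1 dD2] : `|d.1| <= D /\ `|d.2| <= D.
  by rewrite /D; split; have := normr_ge0 d.1; have := normr_ge0 d.2; have := normr_ge0 d'.1; have := normr_ge0 d'.2; lra.
have [dD1' dD2'] : `|d'.1| <= D /\ `|d'.2| <= D.
  by rewrite /D; split; have := normr_ge0 d.1; have := normr_ge0 d.2; have := normr_ge0 d'.1; have := normr_ge0 d'.2; lra.
have boxI x y v (r : R) : y - x = v -> `|v.1| <= r -> `|v.2| <= r -> box x r y by move=> <-.
have at1 (t e : R) (r : R) : 0 < e -> `|t| * D <= r / e -> box s.1 (r / e) (side_point s t).
  move=> e_gt0 H; apply: (boxI _ _ (t *: d)); first by rewrite /side_point addrC addKr.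
    by rewrite /= /GRing.scale /= normrM; apply: le_trans H; rewrite ler_wpM2l.
  by rewrite /= /GRing.scale /= normrM; apply: le_trans H; rewrite ler_wpM2l.
have at2 (t e : R) (r : R) : 0 < e -> `|t - 1| * D <= r / e -> box s.2 (r / e) (side_point s t).
  move=> e_gt0 H.
  have -> : side_point s t = s.2 + (t - 1) *: d.
    by rewrite (side_pointE _ _ 1) /side_point scale1r [s.1 + _]addrC subrK.
  apply: (boxI _ _ ((t - 1) *: d)); first by rewrite addrC addKr.
    by rewrite /= /GRing.scale /= normrM; apply: le_trans H; rewrite ler_wpM2l.
  by rewrite /= /GRing.scale /= normrM; apply: le_trans H; rewrite ler_wpM2l.
have far (a : R) : 0 <= a <= 1 \/ exists2 m : R, 0 < m & forall t, 0 <= t <= 1 -> m <= `|t - a|.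
  case: (ltP a 0) => a0; last case: (ltP 1 a) => a1.
  - right; exists (- a); first by rewrite oppr_gt0.
    by move=> t /andP[t0 _]; apply: le_trans (ler_norm _); rewrite lerDr.
  - right; exists (a - 1); first by rewrite subr_gt0.
    by move=> t /andP[_ t1]; rewrite distrC; apply: le_trans (ler_norm _); lra.
  - by left.
have pick (e : R) : 0 < e -> (forall t u, 0 <= t <= 1 -> 0 <= u <= 1 -> forall r : R, 0 <= r ->
    `|(side_point s t - side_point s' u).1| <= r -> `|(side_point s t - side_point s' u).2| <= r ->
    r < e -> box s.1 (r / e) (side_point s t) \/ box s.2 (r / e) (side_point s t)) ->
    exists2 e : R, 0 < e & forall p q, closed_side s p -> closed_side s' q -> forall r : R,
    `|(p - q).1| <= r -> `|(p - q).2| <= r -> r < e -> box s.1 (r / e) p \/ box s.2 (r / e) p.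
  move=> e_gt0 H; exists e => // p q [t t01 <-] [u u01 <-] r r1 r2 re.
  by apply: (H t u) => //; exact: le_trans r1.
have pq t u : side_point s t - side_point s' u = t *: d - u *: d' - e0.
  by congr pair; rewrite /= /GRing.scale /=; ring.
have [c0|cN0] := eqVneq c 0; last first.
  (* The lines cross at parameter a of s and b of s', by Cramer's rule. Cross products with d' and d
     bound |t - a| and |u - b| by 2 D r / |c|. *)
  pose a := cross e0 d' / c; pose b := cross e0 d / c.
  have sol : e0 = a *: d - b *: d'.
    by rewrite /a /b; move: cN0; rewrite /c /cross => cN0; congr pair; rewrite /= /GRing.scale /=; field.
  have cn0 : 0 < `|c| by rewrite normr_gt0.
  have ta t u (r : R) : `|(side_point s t - side_point s' u).1| <= r -> `|(side_point s t - side_point s' u).2| <= r ->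
      `|t - a| * `|c| <= 2 * D * r /\ `|u - b| * `|c| <= 2 * D * r.
    move=> r1 r2; rewrite -!normrM; split.
      rewrite (_ : _ * _ = cross (side_point s t - side_point s' u) d'); first exact: crossb.
      by rewrite pq sol /c /cross /= /GRing.scale /=; ring.
    rewrite (_ : _ * _ = cross (side_point s t - side_point s' u) d); first exact: crossb.
    by rewrite pq sol /c /cross /= /GRing.scale /=; ring.
  (* Either one of the two segments misses the crossing point by a margin m, or both contain it;
     since the open side s does not meet s', it is then an end of s. *)
  have [[m m0 hm]|ab01] : (exists2 m : R, 0 < m & forall t u, 0 <= t <= 1 -> 0 <= u <= 1 -> m <= `|t - a| \/ m <= `|u - b|) \/ (a = 0 \/ a = 1).
  - case: (far a) => [/andP[a0 a1]|[m m0 hm]]; last by left; exists m => // t u t01 _; left; exact: hm.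
    case: (far b) => [b01|[m m0 hm]]; last by left; exists m => // t u _ u01; right; exact: hm.
    right; case: (eqVneq a 0) => [|aN0]; [by left|case: (eqVneq a 1) => [|aN1]; [by right|]].
    exfalso; apply: (disj (side_point s a)).
      by exists a => //=; rewrite in_itv /= lt_neqAle eq_sym aN0 a0 lt_neqAle aN1 a1.
    exists b; first by rewrite /= in_itv.
    by apply/eqP; rewrite -subr_eq0 -opprB pq sol subrr oppr0.
  - apply: (pick (m * `|c| / (2 * D))) => [|t u t01 u01 r r0 r1 r2 re].
      by rewrite divr_gt0 ?mulr_gt0//; lra.
    exfalso; move: re; apply/negP; rewrite -leNgt ler_pdivrMr; last by lra.
    have [h1 h2] := ta _ _ _ r1 r2.
    by case: (hm _ _ t01 u01) => hh; [apply: le_trans (ler_wpM2r (ltW cn0) hh) _|apply: le_trans (ler_wpM2r (ltW cn0) hh) _]; rewrite [r * _]mulrC.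
  - have e_gt0 : 0 < `|c| / (2 * D ^+ 2) by rewrite divr_gt0// mulr_gt0// exprn_gt0//; lra.
    apply: (pick _ e_gt0) => t u t01 u01 r r0 r1 r2 re.
    have [h1 _] := ta _ _ _ r1 r2.
    have h3 : `|t - a| * D <= r / (`|c| / (2 * D ^+ 2)).
      rewrite ler_pdivlMr// mulrA ler_pdivrMr; last by rewrite mulr_gt0// exprn_gt0//; lra.
      have -> : `|t - a| * D * `|c| = (`|t - a| * `|c|) * D by ring.
      have -> : r * (2 * D ^+ 2) = 2 * D * r * D by ring.
      by apply: ler_wpM2r => //; lra.
    case: ab01 h3 => ->; first by rewrite subr0 => h3; left; exact: at1.
    by move=> h3; right; exact: at2.
pose w := cross e0 d.
have [w0|wN0] := eqVneq w 0; last first.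
  have w_gt0 : 0 < `|w| by rewrite normr_gt0.
  have e_gt0 : 0 < `|w| / (2 * D) by rewrite divr_gt0//; lra.
  apply: (pick _ e_gt0) => t u t01 u01 r r0 r1 r2 re.
  exfalso; move: re; apply/negP; rewrite -leNgt ler_pdivrMr; last by lra.
  rewrite [r * _]mulrC -normrN.
  rewrite (_ : - w = cross (side_point s t - side_point s' u) d); first exact: crossb.
  transitivity (- w + u * c); first by rewrite c0 mulr0 addr0.
  by rewrite pq /w /c /cross /= /GRing.scale /=; ring.
apply: (pick 1) => // t u t01 u01 r r0 r1 r2 _; rewrite divr1.
(* Collinear sides: the point of s' has a parameter x outside ]0, 1[ on s, so t or 1 - t is at most
   |t - x|. *)
have [x xE] : exists x : R, side_point s' u = side_point s x.
  apply: (@on_lineP _ s (side_neq ss) s.1).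
    rewrite /dot /side_normal /= /GRing.scale /=.
    transitivity ((side_length s)^-1 * (w - u * c)); last by rewrite w0 c0 mulr0 subrr mulr0.
    by rewrite /w /c /e0 /cross /= /GRing.scale /=; ring.
  by exists 0; rewrite /side_point scale0r addr0.
have E : side_point s t - side_point s' u = (t - x) *: d.
  by rewrite xE (side_pointE _ t x) addrAC subrr add0r.
rewrite E /= /GRing.scale /= !normrM in r1 r2.
have /andP[t0 t1] := t01.
case: (lerP x 0) => x0; last case: (lerP 1 x) => x1.
- have tx : `|t| <= `|t - x|.
    by rewrite ger0_norm// (le_trans _ (ler_norm _))// lerDl oppr_ge0.
  left; apply: (boxI _ _ (t *: d)); first by rewrite /side_point addrC addKr.
    by rewrite /= /GRing.scale /= normrM; apply: le_trans r1; apply: ler_wpM2r.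
  by rewrite /= /GRing.scale /= normrM; apply: le_trans r2; apply: ler_wpM2r.
- right; have -> : side_point s t = s.2 + (t - 1) *: d.
    by rewrite (side_pointE _ _ 1) /side_point scale1r [s.1 + _]addrC subrK.
  have tx : `|t - 1| <= `|t - x|.
    by rewrite distrC [leRHS]distrC ger0_norm ?subr_ge0// (le_trans _ (ler_norm _))// lerD2r.
  apply: (boxI _ _ ((t - 1) *: d)); first by rewrite addrC addKr.
    by rewrite /= /GRing.scale /= normrM; apply: le_trans r1; apply: ler_wpM2r.
  by rewrite /= /GRing.scale /= normrM; apply: le_trans r2; apply: ler_wpM2r.
- exfalso; apply: (disj (side_point s' u)); last by exists u => //=; rewrite in_itv.
  by rewrite xE; exists x => //=; rewrite in_itv /= x0 x1.
Qed.

End Polygon.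

(** * Meshes *)

Lemma near_seq (I : eqType) (L : seq I) (T : Type) (P : I -> T -> Prop) (F : set_system T)
    {FF : Filter F} :
  (forall i, i \in L -> \forall q \near F, P i q) -> \forall q \near F, forall i, i \in L -> P i q.
Proof.
elim: L => [|i L IH] H; first exact: nearW.
have Hi := H i (mem_head _ _).
have HL := IH (fun (j : I) jL => H j (@mem_behead _ (i :: L) j jL)).
by apply: filterS2 Hi HL => q Pi PL j; rewrite inE => /orP[/eqP ->//|]; exact: PL.
Qed.

Section Mesh.
Variables (R : realType) (Omega : set (R * R)) (sides : seq (side R)).
Variables (Th : seq (triangle R)) (h K : R) (ctr : triangle R -> R * R).
Hypothesis hOmega : polygonal_domain Omega sides.
Hypothesis hTh : triangulation Omega sides Th.
Hypotheses (h0 : 0 < h) (K1 : 1 <= K).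
Hypothesis hdiam : forall T, T \in Th -> diam T <= h.
Hypothesis hball : forall T, T \in Th -> [set y | enorm (y - ctr T) <= h / K] `<=` hull T.
Implicit Types (T : triangle R) (x y z p q v : R * R) (s : side R).

(** Shape regularity and quasi-uniformity enter the estimates through this common radius of
    inscribed disks. *)
Let r0 := h / K.
Let K0 : 0 < K. Proof. exact: lt_le_trans K1. Qed.
Let r0_gt0 : 0 < r0. Proof. exact: divr_gt0. Qed.

Lemma mesh_area T : T \in Th -> area2 T != 0.
Proof. by case: hTh => -[_ H] _ _ _; exact: H. Qed.

Lemma mesh_closure T p : T \in Th -> hull T p -> closure Omega p.
Proof. by case: hTh => _ _ -> _ TTh Tp; exists T. Qed.

Lemma closure_mesh p : closure Omega p -> exists2 T, T \in Th & hull T p.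
Proof. by case: hTh => _ _ -> _. Qed.

Lemma mesh_hull_diam T p q : T \in Th -> hull T p -> hull T q ->
  `|p.1 - q.1| <= h /\ `|p.2 - q.2| <= h.
Proof.
move=> TTh hp hq; have [h1 h2] := hull_diam hp hq.
by split; [apply: le_trans h1 _|apply: le_trans h2 _]; exact: hdiam.
Qed.

Lemma other_vertex T v : T \in Th -> exists2 x, x \in T & x != v.
Proof.
move=> TTh; have aT := mesh_area TTh.
have [a [b [c [E _ _ _]]]] := bary_vertices aT 0; have := tri_uniq aT.
have [bT cT] : b \in T /\ c \in T.
  by split; rewrite -[_ \in T]/(_ \in (T : seq _)) E !inE eqxx !orbT.
rewrite E /= !inE negb_or -!andbA andbT => /and3P[ab ac bc].
have [bv|] := eqVneq b v; last by exists b.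
by exists c => //; rewrite -bv eq_sym.
Qed.

Lemma gbary_neq0 T v : T \in Th -> v \in T -> gbary T v != 0.
Proof.
move=> TTh vT; apply/negP => /eqP g0; have aT := mesh_area TTh.
have C x y : bary T v x = bary T v y by rewrite (baryE _ _ x y) g0 /dot /= !mul0r addr0 addr0.
have [x xT xv] := other_vertex v TTh.
have := C v x; rewrite !bary_at// eqxx eq_sym (negbTE xv) => /eqP.
by rewrite oner_eq0.
Qed.

Lemma ctr_box T : T \in Th -> box (ctr T) (r0 / 2) `<=` hull T.
Proof.
move=> TTh y [y1 y2]; apply: hball => //=.
have := @enorm_le_coord _ (y - ctr T) (r0 / 2) _ y1 y2.
by rewrite [2 * _]mulrC divfK//; apply; rewrite divr_ge0// ltW.
Qed.

Lemma ctr_hull T : T \in Th -> hull T (ctr T).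
Proof. by move=> TTh; apply: ctr_box => //; split; rewrite subrr normr0 divr_ge0// ltW. Qed.

Lemma hull_ctr_box T p : T \in Th -> hull T p -> box (ctr T) h p.
Proof. by move=> TTh hp; exact: (mesh_hull_diam TTh hp (ctr_hull TTh)). Qed.

Lemma gbary_mesh T v : T \in Th -> v \in T ->
  `|(gbary T v).1| <= K / h /\ `|(gbary T v).2| <= K / h.
Proof.
move=> TTh vT; rewrite -invf_div; apply: (gbary_bound (mesh_area TTh) r0_gt0 _ vT).
exact: (hball TTh).
Qed.

(* A vertex is an extreme point, so it can only lie in the intersection of two
   elements, spanned by common vertices, if it is one of them. *)
Lemma vertex_in_hull T T' v : T \in Th -> T' \in Th -> v \in T' -> hull T v -> v \in T.
Proof.
move=> TTh T'Th vT' hv; have [->//|TT'] := eqVneq T T'.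
case: hTh => _ /(_ _ _ TTh T'Th TT') [_ HI] _ _.
have : (hull T `&` hull T') v by split => //; exact: (vertex_hull (mesh_area T'Th)).
rewrite HI => hc; apply: contrapT => /negP vT.
have : bary T' v v = 0.
  apply: (hull_eq0 (fun x y => baryE T' v x y)) hc => x; rewrite mem_filter => /andP[xT' xT].
  rewrite bary_at ?(mesh_area T'Th)//; case: eqP => // vx.
  by rewrite vx xT in vT.
by rewrite bary_at ?(mesh_area T'Th)// eqxx => /eqP; rewrite oner_eq0.
Qed.

Definition tri_interior T : set (R * R) := [set p | forall v, v \in T -> 0 < bary T v p].

(** The box leaves room: points within r0 / 8 of it in each coordinate stay in the disk, as 5 sqrt 2
    / 8 < 1. A barycentric coordinate that vanished at a point with such room on all sides would
    have zero gradient. *)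
Lemma ctr_box_interior T : T \in Th -> box (ctr T) (r0 / 2) `<=` tri_interior T.
Proof.
move=> TTh p [b1 b2] v vT; have aT := mesh_area TTh.
have margin (t : R * R) : `|t.1| <= r0 / 8 -> `|t.2| <= r0 / 8 -> 0 <= bary T v (p + t).
  move=> t1 t2; suff /(hull_baryP aT) : hull T (p + t) by apply.
  apply: hball => //=.
  have c1 : `|(p + t - ctr T).1| <= 5 / 8 * r0.
    rewrite /= addrAC; apply: le_trans (ler_normD _ _) _; lra.
  have c2 : `|(p + t - ctr T).2| <= 5 / 8 * r0.
    rewrite /= addrAC; apply: le_trans (ler_normD _ _) _; lra.
  rewrite -/r0 -[r0]ger0_norm ?(ltW r0_gt0)// -sqrtr_sqr ler_sqrt ?sqr_ge0// /dot expr2.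
  move: c1 c2 => /ler_normlP[c1 c1'] /ler_normlP[c2 c2']; nra.
have r8 : 0 < r0 / 8 by rewrite divr_gt0.
have n8 : `|r0 / 8| = r0 / 8 by rewrite gtr0_norm.
rewrite lt_neqAle -[p in X in _ && X]addr0 margin ?normr0 ?(ltW r8)// andbT eq_sym; apply/eqP => b0.
have Z (t : R * R) : `|t.1| <= r0 / 8 -> `|t.2| <= r0 / 8 -> dot (gbary T v) t = 0.
  move=> t1 t2; have := margin (- t); rewrite /= !normrN => /(_ t1 t2); have := margin t t1 t2.
  rewrite !(baryE _ _ (p + _) p) b0 !add0r ![p + _]addrC !addrK => h1 h2.
  by apply/eqP; rewrite eq_le h1 andbT; move: h2; rewrite /dot /=; lra.
have := gbary_neq0 TTh vT; have := Z (r0 / 8, 0); have := Z (0, r0 / 8).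
rewrite /= n8 normr0; move: (gbary T v) => [a b]; rewrite /dot /= !mulr0 addr0 add0r.
move=> /(_ (ltW r8) (lexx _))/eqP; rewrite mulf_eq0 (gt_eqF r8) orbF => /eqP ->.
by move=> /(_ (lexx _) (ltW r8))/eqP; rewrite mulf_eq0 (gt_eqF r8) orbF => /eqP ->; rewrite eqxx.
Qed.

(** Distinct elements differ in some vertex v of T, whose barycentric coordinate vanishes on the
    hull of the common vertices. *)
Lemma tri_interior_uniq T T' p : T \in Th -> T' \in Th -> tri_interior T p -> hull T' p -> T = T'.
Proof.
move=> TTh T'Th Tp hp; apply/eqP; apply: contrapT => /negP TT'.
case: hTh => _ /(_ _ _ TTh T'Th TT') [nperm HI] _ _; have aT := mesh_area TTh.
have [v vT vT'] : exists2 v, v \in T & v \notin (T' : seq _).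
  apply: contrapT => H; move/negP: nperm; apply.
  have sub : {subset T <= (T' : seq _)}.
    by move=> v vT; apply: contrapT => /negP vT'; apply: H; exists v.
  apply: uniq_perm; rewrite ?tri_uniq ?(mesh_area T'Th)//.
  have [|_ //] := uniq_min_size (tri_uniq aT) sub.
  by rewrite !size_tuple.
have : (hull T `&` hull T') p by split => //; apply/(hull_baryP aT) => w wT; exact/ltW/Tp.
rewrite HI => hc; have := Tp v vT; rewrite (_ : bary T v p = 0) ?ltxx//.
apply: (hull_eq0 (fun x y => baryE T v x y)) hc => x.
rewrite mem_filter => /andP[xT' xT]; rewrite bary_at//.
by case: eqP => // vx; rewrite vx xT' in vT'.
Qed.

Lemma ctr_box_disjoint T T' p : T \in Th -> T' \in Th -> box (ctr T) (r0 / 2) p ->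
  box (ctr T') (r0 / 2) p -> T = T'.
Proof.
move=> TTh T'Th bp bp'; apply: (tri_interior_uniq TTh T'Th); first exact: (ctr_box_interior TTh bp).
exact: (ctr_box T'Th bp').
Qed.

(** The boxes around different centres are disjoint, so at most one term survives at p. *)
Lemma sum_indic_disjoint (S : seq (triangle R)) (c : triangle R -> R) (B : triangle R -> set (R * R)) (F : R) p :
  uniq S -> {subset S <= Th} -> (forall T, T \in S -> B T `<=` box (ctr T) (r0 / 2)) -> 0 <= F ->
  (forall T, T \in S -> B T p -> c T <= F) -> \sum_(T <- S) c T * \1_(B T) p <= F.
Proof.
move=> uS sS sB F0 cF.
have [/hasP[T TS /asboolP Tp]|N] := boolP (has (fun T => `[< B T p >]) S).
  rewrite (big_rem T)//= indicE mem_set// mulr1 big_seq big1 ?addr0 => [|T']; first exact: cF.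
  rewrite (mem_rem_uniq _ uS) inE => /andP[T'T T'S].
  rewrite indicE memNset ?mulr0// => T'p; move/eqP: T'T; apply.
  exact: (ctr_box_disjoint (sS _ T'S) (sS _ TS) (sB _ T'S _ T'p) (sB _ TS _ Tp)).
rewrite big_seq big1 // => T TS; rewrite indicE memNset ?mulr0// => Tp.
by move/hasP: N; apply; exists T => //; exact/asboolP.
Qed.

Notation mu2 := (plane_measure R).

(** Packing: disjoint boxes of area (h / K)^2 fit into a box of area (2 a h)^2. *)
Lemma mesh_count (S : seq (triangle R)) (c : R * R) (a : R) : uniq S -> {subset S <= Th} ->
  0 <= a -> (forall T, T \in S -> box (ctr T) (r0 / 2) `<=` box c (a * h)) ->
  (size S)%:R <= (2 * a * K) ^+ 2.
Proof.
move=> uS sS a0 HS.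
have ah0 : 0 <= a * h by rewrite mulr_ge0// ltW.
have mb : mu2 (box c (a * h)) = ((2 * (a * h)) ^+ 2)%:E by exact: measure_box.
have h1 : mu2.-integrable (box c (a * h)) (EFin \o cst (1 : R)).
  apply: measurable_bounded_integrable.
  - exact: measurable_box.
  - by rewrite mb ltry.
  - exact: measurable_cst.
  - by exists 1; split => // y y1 x _ /=; rewrite normr1 ltW.
have hB T : T \in S -> [/\ measurable (box (ctr T) (r0 / 2)), box (ctr T) (r0 / 2) `<=` box c (a * h) &
    (mu2 (box (ctr T) (r0 / 2)) < +oo)%E].
  move=> TS; split; [exact: measurable_box|exact: HS|].
  by rewrite measure_box ?ltry// divr_ge0// ltW.
have := @step_le_Rintegral _ _ _ mu2 _ (measurable_box c (a * h)) _ S (fun=> 1) _ hB (cst 1) h1.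
have -> : \int[mu2]_(x in box c (a * h)) cst 1 x = (2 * (a * h)) ^+ 2.
  by rewrite Rintegral_cst; [rewrite mul1r mb|exact: measurable_box].
have -> : \sum_(T <- S) 1 * fine (mu2 (box (ctr T) (r0 / 2))) = (size S)%:R * r0 ^+ 2.
  rewrite (eq_bigr (fun=> r0 ^+ 2)) => [|T _].
    by rewrite big_const_seq count_predT iter_addr_0 mulr_natl.
  rewrite mul1r measure_box; last by rewrite divr_ge0// ltW.
  by rewrite /= mulrC divfK.
move=> H; have {}H : (size S)%:R * r0 ^+ 2 <= (2 * (a * h)) ^+ 2.
  apply: H => x bx.
  apply: (@sum_indic_disjoint S (fun=> 1) (fun T => box (ctr T) (r0 / 2)) 1 x uS sS).
  - by move=> T _.
  - exact: ler01.
  - by move=> T _ _; exact: lexx.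
have r2 : 0 < r0 ^+ 2 by rewrite exprn_gt0.
rewrite -(ler_pM2r r2); apply: le_trans H _.
rewrite -exprMn le_eqVlt; apply/orP; left; apply/eqP; congr (_ ^+ 2).
have KN : K != 0 by rewrite gt_eqF.
by rewrite /r0; field.
Qed.


Lemma hull_convex T p q (r : R) : T \in Th -> hull T p -> hull T q -> 0 <= r <= 1 ->
  hull T (p + r *: (q - p)).
Proof.
move=> TTh; have aT := mesh_area TTh; move=> /(hull_baryP aT) hp /(hull_baryP aT) hq /andP[r0' r1].
apply/(hull_baryP aT) => v vT; rewrite (baryE _ _ _ p) addrAC subrr add0r dotZr.
have := hp v vT; have := hq v vT; rewrite (baryE _ _ q p); nra.
Qed.

(** Were all vertices on the line through x with normal n, so would be x + n, an affine combination
    of them, and n would be orthogonal to itself. *)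
Lemma vertex_off_line T x (n : R * R) : T \in Th -> n != 0 ->
  exists2 v, v \in T & dot n (v - x) != 0.
Proof.
move=> TTh n0; apply: contrapT => H; have aT := mesh_area TTh.
have Z v : v \in T -> dot n (v - x) = 0.
  by move=> vT; apply/eqP; apply: contrapT => /negP nv; apply: H; exists v.
move: n0; rewrite -dot_eq0 (_ : dot n n = 0) ?eqxx//.
transitivity (dot n (x + n - x)); first by rewrite addrAC subrr add0r.
transitivity (\sum_(v <- T) bary T v (x + n) * dot n (v - x)).
  rewrite (eq_bigr (fun v => dot n (bary T v (x + n) *: v) - bary T v (x + n) * dot n x)) => [|v _].
    by rewrite sumrB -dot_sumr bary_comb// -mulr_suml bary_sum// mul1r dotBr.
  by rewrite dotZr dotBr mulrBr.
by rewrite big_seq big1// => v vT; rewrite Z// mulr0.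
Qed.

Lemma tri_interior_hull T : T \in Th -> tri_interior T `<=` hull T.
Proof. by move=> TTh p Tp; apply/(hull_baryP (mesh_area TTh)) => v vT; exact/ltW/Tp. Qed.

Lemma bary_continuous T v : continuous (bary T v).
Proof.
rewrite (_ : bary T v = fun p => bary T v 0 + dot (gbary T v) p); last first.
  by apply/funext => p; rewrite (baryE _ _ _ 0) subr0.
by move=> p; apply: cvgD; [exact: cvg_cst|exact: dot_continuous].
Qed.

Lemma tri_interior_open T p : tri_interior T p -> \forall q \near p, tri_interior T q.
Proof.
move=> Tp; apply: (@near_seq _ T _ (fun v q => 0 < bary T v q) (nbhs p)) => v vT.
exact: (@bary_continuous T v p _ (lt_nbhsr (Tp v vT))).
Qed.

Lemma open_side_segment s (t : R) : 0 <= t <= 1 ->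
  [\/ open_side s (side_point s t), side_point s t = s.1 | side_point s t = s.2].
Proof.
move=> /andP[t0 t1]; have [->|tN0] := eqVneq t 0.
  by constructor 2; rewrite /side_point scale0r addr0.
have [->|tN1] := eqVneq t 1.
  by constructor 3; rewrite /side_point scale1r addrC subrK.
constructor 1; exists t => //=.
by rewrite in_itv /= lt_neqAle eq_sym tN0 t0 lt_neqAle tN1 t1.
Qed.

Lemma side_ends_vertex s : s \in sides ->
  (exists2 T, T \in Th & s.1 \in T) /\ (exists2 T, T \in Th & s.2 \in T).
Proof. by case: hTh => _ _ _; apply. Qed.

(** A boundary point interior to an element has a full neighbourhood in the closure of Omega. Inside
    a side this contradicts the half-plane property; an end of a side is a mesh vertex, which no
    element contains in its interior. *)
Lemma tri_interior_sub T : T \in Th -> tri_interior T `<=` Omega.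
Proof.
move=> TTh p Tp; apply: contrapT => Op.
have hp := tri_interior_hull TTh Tp.
have [s ss [t t01 tp]] := boundary_closed_side hOmega (conj (mesh_closure TTh hp) Op).
rewrite /= in_itv /= in t01.
have novertex v T' : T' \in Th -> v \in T' -> v = p -> False.
  move=> T'Th vT' vp; have hv : hull T v by rewrite vp.
  have vT := vertex_in_hull TTh T'Th vT' hv.
  have [x xT xv] := other_vertex v TTh.
  by have := Tp x xT; rewrite -vp bary_at ?(mesh_area TTh)// (negbTE xv) ltxx.
have [[T1 T1Th v1] [T2 T2Th v2]] := side_ends_vertex ss.
have := open_side_segment s t01; rewrite tp => -[op|e1|e2].
- have N := near_closure_halfplane hOmega ss op.
  have N' := tri_interior_open Tp.
  have N2 : \forall q \near p, dot (q - p) (side_normal s) <= 0.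
    by apply: filterS2 N N' => q H1 H2; apply: H1; exact: mesh_closure (tri_interior_hull TTh H2).
  have [r /andP[r_gt0 _] H] := near_segment (p + side_normal s) N2.
  move: H; rewrite addrAC subrr add0r addrAC subrr add0r dotC dotZr.
  by rewrite (normal_unit (side_neq hOmega ss)) mulr1 leNgt r_gt0.
- exact: (novertex _ _ T1Th v1).
- exact: (novertex _ _ T2Th v2).
Qed.

(** Here every finite element function is locally a polynomial, and the rest of Omega is null. *)
Definition mesh_interior : set (R * R) := [set p | exists2 T, T \in Th & tri_interior T p].

Lemma measurable_bary T v : measurable_fun setT (bary T v).
Proof.
rewrite (_ : bary T v = fun p => bary T v 0 + dot (gbary T v) p); last first.
  by apply/funext => p; rewrite (baryE _ _ _ 0) subr0.
by apply: measurable_funD; [exact: measurable_cst|exact: measurable_dot].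
Qed.

Lemma measurable_tri_interior T : measurable (tri_interior T).
Proof.
have [a [b [c [E _]]]] := tri_seq T.
have memE w : (w \in T) = (w \in [:: a; b; c]) by rewrite -E.
have M v : measurable [set p | 0 < bary T v p].
  rewrite (_ : [set _ | _] = setT `&` bary T v @^-1` `]0, +oo[); last first.
    by rewrite setTI; apply/seteqP; split=> p /=; rewrite in_itv /= andbT.
  by apply: measurable_bary => //; exact: measurable_itv.
rewrite (_ : tri_interior T = [set p | 0 < bary T a p] `&` [set p | 0 < bary T b p] `&` [set p | 0 < bary T c p]).
  by apply: measurableI => //; exact: measurableI.
apply/seteqP; split => p /=.
  by move=> H; split; [split|]; apply: H; rewrite memE !inE eqxx ?orbT.
by move=> [[Ha Hb] Hc] v; rewrite memE !inE => /or3P[] /eqP ->.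
Qed.

Lemma mesh_interiorE : mesh_interior = \big[setU/set0]_(T <- Th) tri_interior T.
Proof.
rewrite -bigcup_seq; apply/seteqP; split => p.
  by move=> [T TTh Tp]; exists T.
by move=> [T TTh Tp]; exists T.
Qed.

Lemma measurable_mesh_interior : measurable mesh_interior.
Proof. by rewrite mesh_interiorE; apply: bigsetU_measurable => T _; exact: measurable_tri_interior. Qed.

Lemma mesh_interior_sub : mesh_interior `<=` Omega.
Proof. by move=> p [T TTh]; exact: tri_interior_sub. Qed.

(** The null set is the finite union of the lines that carry the edges. *)
Lemma mesh_interior_null : exists N : set (R * R),
  [/\ measurable N, mu2 N = 0%E & Omega `\` mesh_interior `<=` N].
Proof.
pose N0 (x : triangle R * (R * R)) : set (R * R) := [set p | bary x.1 x.2 p = 0].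
pose L := [seq (T, v) | T <- Th, v <- (T : seq (R * R))].
have null (x : triangle R * (R * R)) : x \in L -> measurable (N0 x) /\ mu2 (N0 x) = 0%E.
  move=> /allpairsPdep [T [v [TTh vT ->]]].
  rewrite /N0 /= (_ : [set p | _] = [set p | dot (gbary T v) p = - bary T v 0]).
    by apply: line_null; exact: gbary_neq0.
  apply/seteqP; split => p /=; rewrite (baryE _ _ p 0) subr0.
    by move=> /eqP; rewrite addr_eq0 => /eqP ->; rewrite opprK.
  by move=> ->; rewrite subrr.
exists (\big[setU/set0]_(x <- L) N0 x).
have [mN N00] : measurable (\big[setU/set0]_(x <- L) N0 x) /\ mu2 (\big[setU/set0]_(x <- L) N0 x) = 0%E.
  elim: L null => [|x L IH] HL; first by rewrite big_nil measure0.
  have [mx x0] := HL x (mem_head _ _).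
  have [mL L0] := IH (fun (y : triangle R * (R * R)) yL => HL y (@mem_behead _ (x :: L) y yL)).
  rewrite big_cons; split; first exact: measurableU.
  by rewrite measureU0// .
split => // p [Op ndp]; have [T TTh Tp] := closure_mesh (@subset_closure _ Omega p Op).
rewrite -bigcup_seq; apply: contrapT => np; apply: ndp; exists T => // v vT.
rewrite lt_neqAle (hull_baryP (mesh_area TTh) p).1// andbT eq_sym; apply/eqP => b0; apply: np.
by exists (T, v) => //=; apply/allpairsPdep; exists T, v.
Qed.

Definition edge_on s T : Prop := exists x y,
  [/\ x \in T, y \in T, x != y, closed_side s x & closed_side s y].

Lemma mid_open_side s x y : s \in sides -> closed_side s x -> closed_side s y -> x != y ->
  open_side s (2^-1 *: (x + y)).
Proof.
move=> ss [t t01 <-] [u u01 <-] xy; rewrite /= !in_itv /= in t01 u01.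
have tu : t != u by apply: contra xy => /eqP ->.
exists ((t + u) / 2); last by congr pair; rewrite /= /GRing.scale /=; field.
rewrite /= in_itv /=; move: t01 u01 => /andP[t0 t1] /andP[u0 u1].
by case: (ltgtP t u) tu => // tu _; apply/andP; split; lra.
Qed.

(** The coordinate of z is 0 on the line of s and 1 at z, whose distance from that line is positive
    and at most h; hence the slope - 1 / h along the outward normal. The whole positive part of the
    flux comes from this bound. *)
Lemma edge_third s T x y : s \in sides -> T \in Th -> x \in T -> y \in T -> x != y ->
  closed_side s x -> closed_side s y -> exists z,
  [/\ z \in T, z != x, z != y, (forall v, v \in T -> [\/ v = x, v = y | v = z]) &
  [/\ forall (V : nmodType) (f : R * R -> V), \sum_(v <- T) f v = f x + f y + f z,
   dot (side_normal s) (z - x) < 0, forall t, bary T z (side_point s t) = 0 &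
   dot (gbary T z) (side_normal s) <= - h^-1]].
Proof.
move=> ss TTh xT yT xy sx sy; have aT := mesh_area TTh.
have [z [zT zx zy Tz hz]] := third_vertex aT xT yT xy; exists z; split => //.
have s12 := side_neq hOmega ss; set n := side_normal s.
have n1 : dot n n = 1 := normal_unit s12.
have nyx : dot n (y - x) = 0 := closed_side_normal s12 sy sx.
have nN0 : n != 0 by rewrite -dot_eq0 n1 oner_eq0.
have nz0 : dot n (z - x) != 0.
  have [v vT] := vertex_off_line x TTh nN0.
  by case: (Tz v vT) => -> //; rewrite ?nyx ?eqxx// subrr /dot /= !mulr0 addr0 eqxx.
have nz : dot n (z - x) < 0.
  rewrite lt_neqAle nz0 /=.
  (* The edge may end at an end of s, where no half-plane description holds, but its midpoint lies
     in the open side. *)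
  pose m := 2^-1 *: (x + y).
  have om := mid_open_side ss sx sy xy.
  have [r /andP[r_gt0 r1] H] := @near_segment _ m z _ (near_closure_halfplane hOmega ss om).
  have hm : hull T (m + r *: (z - m)).
    apply: (hull_convex TTh) => //; [|exact: (vertex_hull aT)|by rewrite (ltW r_gt0)].
    rewrite (_ : m = x + 2^-1 *: (y - x)); last by rewrite /m; congr pair; rewrite /= /GRing.scale /=; field.
    by apply: (hull_convex TTh); [exact: (vertex_hull aT)|exact: (vertex_hull aT)|apply/andP; split; lra].
  have := H (mesh_closure TTh hm).
  rewrite dotC addrAC subrr add0r dotZr pmulr_rle0//.
  have E (w : R * R) : dot w (z - m) = dot w (z - x) - 2^-1 * dot w (y - x).
    by rewrite /m /dot /= /GRing.scale /=; field.
  by rewrite E nyx mulr0 subr0.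
have gz : dot (gbary T z) (s.2 - s.1) = 0.
  have : dot (gbary T z) (y - x) = 0.
    have := baryE T z y x; rewrite !bary_at// (negbTE zx) (negbTE zy) /= add0r.
    by move=> <-.
  move: sx sy xy => [t _ <-] [u _ <-] xy.
  rewrite (side_pointE s u t) addrAC subrr add0r dotZr => /eqP; rewrite mulf_eq0 => /orP[|/eqP//].
  by rewrite subr_eq0 => /eqP ut; rewrite ut eqxx in xy.
split => //.
  move=> t; have [u _ ux] := sx.
  rewrite (baryE _ _ _ x) bary_at// (negbTE zx) add0r -ux (side_pointE s t u).
  by rewrite addrAC subrr add0r dotZr gz mulr0.
have b1 : 1 = dot (gbary T z) n * dot n (z - x).
  rewrite -(dot_normal_decomp s12 (z - x) gz).
  by have := baryE T z z x; rewrite !bary_at// eqxx (negbTE zx) add0r.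
have nh : - h <= dot n (z - x).
  rewrite lerNl (_ : - _ = dot n (x - z)); last by rewrite !dotBr opprB.
  apply: le_trans (hdiam TTh); apply: hull_dot_diam => //; [by rewrite n1|exact: vertex_hull|exact: vertex_hull].
rewrite -(ler_nM2r nz) -b1 mulNr -mulrN ler_pdivrMl// mulr1 lerNl; exact: nh.
Qed.

Definition is_vertex p : Prop := exists2 T, T \in Th & p \in T.

(** All vertices of T lie in the closed half-plane at the boundary point, so those with positive
    weight lie on the line of s. There are at least two, the point being no vertex, and not three.
    That they lie on s itself is due to conformity: the ends of s are mesh vertices. *)
Lemma hull_edge_on s T (t : R) : s \in sides -> 0 <= t <= 1 -> ~ is_vertex (side_point s t) ->
  T \in Th -> hull T (side_point s t) -> exists x y,
  [/\ x \in T, y \in T, x != y, closed_side s x & closed_side s y /\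
      0 < bary T x (side_point s t) /\ 0 < bary T y (side_point s t)].
Proof.
move=> ss t01 nv TTh; set p := side_point s t => hp; have aT := mesh_area TTh.
have s12 := side_neq hOmega ss; set n := side_normal s.
have nvT v : v \in T -> v != p.
  by move=> vT; apply/eqP => vp; apply: nv; exists T => //; rewrite -/p -vp.
have op : open_side s p.
  have [[T1 T1Th v1] [T2 T2Th v2]] := side_ends_vertex ss.
  have := open_side_segment s t01; rewrite -/p => -[//|e|e]; exfalso; apply: nv; rewrite -/p e; [by exists T1|by exists T2].
have b0 v : v \in T -> 0 <= bary T v p by move: v; exact/(hull_baryP aT).
have le0 v : v \in T -> dot n (v - p) <= 0.
  move=> vT; have [r /andP[r_gt0 r1] H] := @near_segment _ p v _ (near_closure_halfplane hOmega ss op).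
  have hm : hull T (p + r *: (v - p)).
    by apply: (hull_convex TTh hp); [exact: (vertex_hull aT)|rewrite (ltW r_gt0)].
  have := H (mesh_closure TTh hm).
  by rewrite dotC addrAC subrr add0r dotZr pmulr_rle0.
have sum0 : \sum_(v <- T) bary T v p * dot n (v - p) = 0.
  rewrite (eq_bigr (fun v => dot n (bary T v p *: v) - bary T v p * dot n p)) => [|v _].
    by rewrite sumrB -dot_sumr bary_comb// -mulr_suml bary_sum// mul1r subrr.
  by rewrite dotZr dotBr mulrBr.
have on v : v \in T -> 0 < bary T v p -> dot n (v - p) = 0.
  move=> vT bv; apply/eqP; rewrite eq_le le0//=.
  move: sum0; rewrite (big_rem v)//= => /eqP; rewrite addr_eq0 => /eqP E.
  rewrite -(pmulr_rge0 _ bv) E oppr_ge0 big_seq; apply: sumr_le0 => w /mem_rem wT.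
  by rewrite mulr_ge0_le0 ?b0 ?le0.
(* p is a convex combination of vertices but not a vertex. *)
have [x [y [xT yT xy bx by_]]] : exists x y, [/\ x \in T, y \in T, x != y, 0 < bary T x p & 0 < bary T y p].
  have [x xT bx] : exists2 x, x \in T & 0 < bary T x p.
    apply: contrapT => H; have := bary_sum aT p; rewrite big_seq big1 => [/eqP|v vT].
      by rewrite eq_sym oner_eq0.
    apply/eqP; rewrite eq_le b0// andbT leNgt; apply/negP => bv; apply: H; by exists v.
  apply: contrapT => H; have Z v : v \in T -> v != x -> bary T v p = 0.
    move=> vT vx; apply/eqP; rewrite eq_le b0// andbT leNgt; apply/negP => bv; apply: H.
    by exists x, v; rewrite eq_sym.
  have bx1 : bary T x p = 1.
    rewrite -(bary_sum aT p) (big_rem x xT) /= big_seq big1 ?addr0// => v.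
    by rewrite mem_rem_uniq ?tri_uniq// inE => /andP[vx vT]; exact: Z.
  have px : p = x.
    rewrite -[LHS](bary_comb aT p) (big_rem x xT) /= bx1 scale1r big_seq big1 ?addr0// => v.
    by rewrite mem_rem_uniq ?tri_uniq// inE => /andP[vx vT]; rewrite Z// scale0r.
  by have := nvT x xT; rewrite -px eqxx.
have n1 : dot n n = 1 := normal_unit s12.
have nN0 : n != 0 by rewrite -dot_eq0 n1 oner_eq0.
have [z [zT zx zy Tz hz]] := third_vertex aT xT yT xy.
have nz : dot n (z - p) != 0.
  have [v vT] := vertex_off_line p TTh nN0.
  by case: (Tz v vT) => -> //; rewrite on// eqxx.
have bz : bary T z p = 0.
  by apply: contrapT => /eqP bz; move: nz; rewrite on ?eqxx// lt_neqAle eq_sym bz b0.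
have [a xa] := on_lineP s12 (on x xT bx) (ex_intro _ t erefl).
have [b yb] := on_lineP s12 (on y yT by_) (ex_intro _ t erefl).
have sum1 := bary_sum aT p; rewrite hz bz addr0 in sum1.
have tE : t = bary T x p * a + bary T y p * b.
  have comb (l m a' b' : R) : l *: side_point s a' + m *: side_point s b' =
      (l + m) *: s.1 + (l * a' + m * b') *: (s.2 - s.1).
    by rewrite /side_point; congr pair; rewrite /= /GRing.scale /=; ring.
  apply: (can_inj (side_pointK s12)); rewrite -/p -[LHS](bary_comb aT p) hz bz scale0r addr0.
  move: (bary T x p) (bary T y p) sum1 => l m lm.
  by rewrite xa yb comb lm scale1r.
have end_out (e : R) : e = 0 \/ e = 1 -> is_vertex (side_point s e).
  have [v1 v2] := side_ends_vertex ss; case=> ->; rewrite /side_point ?scale0r ?addr0//.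
  by rewrite scale1r addrC subrK.
(* If the edge overran s, an end e of s would lie strictly between its vertex x' and the point,
   hence in T; as a mesh vertex it would be a vertex of T, and it is none of the three. *)
have key (x' y' : R * R) (a' b' e : R) : x' \in T -> (forall v, v \in T -> [\/ v = x', v = y' | v = z]) ->
    x' = side_point s a' -> y' = side_point s b' -> 0 < bary T x' p ->
    bary T x' p + bary T y' p = 1 -> t = bary T x' p * a' + bary T y' p * b' ->
    e = 0 \/ e = 1 -> 0 < (e - a') * (t - e) -> False.
  move=> x'T Tz' xa' yb' bx' s1 tE' e01 eat.
  have [T1 T1Th vT1] := end_out e e01.
  have ta : t - a' != 0 by apply/eqP; nra.
  have he : hull T (side_point s e).
    have -> : side_point s e = p + ((t - e) / (t - a')) *: (x' - p).
      by rewrite xa' /p /side_point; congr pair; rewrite /= /GRing.scale /=; field.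
    apply: (hull_convex TTh hp); first exact: (vertex_hull aT).
    case: (ltrP 0 (t - a')) => ta0.
      by rewrite ler_pdivlMr// ler_pdivrMr//; apply/andP; split; nra.
    have {}ta0 : t - a' < 0 by rewrite lt_neqAle ta.
    by rewrite ler_ndivlMr// ler_ndivrMr//; apply/andP; split; nra.
  have eT := vertex_in_hull TTh T1Th vT1 he.
  case: (Tz' _ eT) => ev.
  - move: ev; rewrite xa' => /(can_inj (side_pointK s12)) ea; by rewrite ea subrr mul0r ltxx in eat.
  - move: ev; rewrite yb' => /(can_inj (side_pointK s12)) eb; rewrite -eb in tE'.
    have te : t - e = bary T x' p * (a' - e).
      by rewrite {1}tE' -[X in _ - X]mul1r -s1; ring.
    move: eat; rewrite te mulrCA -[e - a']opprB mulNr -expr2 mulrN oppr_gt0.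
    by rewrite pmulr_rlt0// ltNge sqr_ge0.
  - by move: nz; rewrite -ev /p (side_pointE s e t) addrAC subrr add0r dotZr normal_dir// mulr0 eqxx.
have /andP[t0 t1] := t01.
have tN0 : 0 < t.
  rewrite lt_neqAle t0 andbT; apply/eqP => t00; apply: nv; rewrite -t00; exact: end_out (or_introl erefl).
have tN1 : t < 1.
  rewrite lt_neqAle t1 andbT; apply/eqP => t11; apply: nv; rewrite t11; exact: end_out (or_intror erefl).
have Tz' v : v \in T -> [\/ v = y, v = x | v = z] by move=> /Tz[]; [constructor 2|constructor 1|constructor 3].
exists x, y; split => //; [|split => //].
  exists a => //=; rewrite in_itv /=; apply/andP; split; rewrite leNgt; apply/negP => ha.
    by apply: (key x y a b 0) => //; [left|nra].
  by apply: (key x y a b 1) => //; [right|nra].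
exists b => //=; rewrite in_itv /=; apply/andP; split; rewrite leNgt; apply/negP => hb.
  by apply: (key y x b a 0) => //; [rewrite addrC|rewrite addrC|left|nra].
by apply: (key y x b a 1) => //; [rewrite addrC|rewrite addrC|right|nra].
Qed.

End Mesh.

(** * Boundary edges *)

Lemma closed_bigsetU (I : Type) (T : topologicalType) (L : seq I) (J : I -> set T) :
  (forall i, closed (J i)) -> closed (\big[setU/set0]_(i <- L) J i).
Proof.
move=> H; elim: L => [|i L IH]; first by rewrite big_nil; exact: closed0.
by rewrite big_cons; exact: closedU.
Qed.

Section Chain.
Variables (R : realType) (I : choiceType) (L : seq I) (J : I -> set R) (good : pred I).
Variables (g : R -> R) (o : I -> R).
Hypotheses (uL : uniq L) (cJ : forall i, closed (J i)) (J01 : forall i, J i `<=` `[0, 1]).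
Hypothesis cover : forall t, 0 <= t <= 1 -> exists2 i, i \in L & J i t.
Hypotheses (J0 : forall i, i \in L -> J i !=set0) (o0 : forall i, 0 <= o i).
Hypothesis osc : forall i, i \in L -> forall t u, J i t -> J i u -> `|g t - g u| <= o i.

Let B := [seq j <- L | ~~ good j].

Let sum_bad (S : seq I) : uniq S -> {subset S <= B} ->
  \sum_(k <- S) o k <= \sum_(j <- L | ~~ good j) o j.
Proof.
move=> uS SB; rewrite -[leRHS]big_filter -/B [leRHS](perm_big (S ++ [seq j <- B | j \notin S]))/=.
  by rewrite big_cat /= lerDl sumr_ge0.
apply: uniq_perm; rewrite ?cat_uniq ?uS ?filter_uniq//=.
  by rewrite andbT; apply/hasPn => j; rewrite mem_filter => /andP[].
move=> j; rewrite mem_cat [in RHS]mem_filter.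
by case: (boolP (j \in S)) => [/SB|].
Qed.

(* If the intervals indexed by S met no others, they would form a nontrivial
   clopen subset of [0, 1]. *)
Let neighbour (S : seq I) i0 ig : i0 \in S -> {subset S <= B} -> ig \in L -> good ig ->
  exists i, [/\ i \in L, i \notin S & exists2 t, J i t & exists2 j, j \in S & J j t].
Proof.
move=> i0S SB igL goodg; apply: contrapT => sep.
have SL j : j \in S -> j \in L by move=> /SB; rewrite mem_filter => /andP[].
pose C1 := \big[setU/set0]_(j <- S) J j.
pose C2 := \big[setU/set0]_(j <- [seq j <- L | j \notin S]) J j.
have C1P t : C1 t <-> exists2 j, j \in S & J j t.
  by rewrite /C1 -bigcup_seq; split => -[j jS Jj]; exists j.
have C2P t : C2 t <-> exists2 j, j \in [seq j <- L | j \notin S] & J j t.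
  by rewrite /C2 -bigcup_seq; split => -[j jS Jj]; exists j.
have full : (`[0, 1]%classic : set R) `&` C1 = `[0, 1]%classic.
  apply: (segment_connected (a := 0) (b := 1)).
  - by have [t Jt] := J0 (SL _ i0S); exists t; split; [exact: J01 Jt|apply/C1P; exists i0].
  - exists (~` C2); first by apply: closed_openC; exact: closed_bigsetU.
    apply/seteqP; split => t [t01 Ct]; split => //.
      move=> /C2P[j]; rewrite mem_filter => /andP[jS jL] Jjt; apply: sep; exists j; split => //.
      by exists t => //; exact/C1P.
    have t01' := t01; rewrite /= in_itv /= in t01'; have [j jL Jjt] := cover t01'.
    apply/C1P; exists j => //; apply: contrapT => /negP jS; apply: Ct; apply/C2P.
    by exists j => //; rewrite mem_filter jS.
  - by exists C1 => //; exact: closed_bigsetU.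
have [t Jt] := J0 igL; have : (`[0, 1]%classic : set R) t by exact: J01 Jt.
rewrite -[X in X t]full => -[_ /C1P Ct]; apply: sep; exists ig; split => //; last by exists t.
by apply/negP => /SB; rewrite mem_filter goodg.
Qed.

(** The set S of bad intervals reached from i0 grows by a neighbour until a good one is met. Each
    bad interval enters once, so the total variation is at most the sum of their oscillations, plus
    that of the good interval. The induction is on the number of bad intervals outside S. *)
Lemma chain_to_good i0 ig : i0 \in L -> ~~ good i0 -> ig \in L -> good ig ->
  exists i, [/\ i \in L, good i & forall t u, J i0 t -> J i u ->
    `|g t - g u| <= o i + \sum_(j <- L | ~~ good j) o j].
Proof.
move=> i0L bad0 igL goodg.
suff key n : forall S, uniq S -> {subset S <= B} -> i0 \in S -> (size B - size S <= n)%N ->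
    (forall j, j \in S -> forall t u, J i0 t -> J j u -> `|g t - g u| <= \sum_(k <- S) o k) ->
    exists i, [/\ i \in L, good i & forall t u, J i0 t -> J i u ->
      `|g t - g u| <= o i + \sum_(j <- L | ~~ good j) o j].
  apply: (key (size B) [:: i0]) => //.
  - by move=> j; rewrite inE => /eqP ->; rewrite mem_filter bad0.
  - by rewrite inE.
  - by rewrite leq_subr.
  - by move=> j; rewrite inE => /eqP -> t u; rewrite big_seq1; exact: osc.
elim: n => [|n IH] S uS SB i0S sz HS;
  have [i [iL iS [t Jt [j jS Jjt]]]] := neighbour i0S SB igL goodg;
  (have far : forall t' u', J i0 t' -> J i u' -> `|g t' - g u'| <= o i + \sum_(k <- S) o k by
    move=> t' u' Jt' Ju'; have := ler_distD (g t) (g t') (g u'); have := HS j jS t' t Jt' Jjt;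
    have := osc iL Jt Ju'; lra);
  (have [gi|gi] := boolP (good i);
    first by exists i; split => // t' u' Jt' Ju'; apply: le_trans (far _ _ Jt' Ju') _; rewrite lerD2l sum_bad);
  (have iSB : {subset i :: S <= B} by
    move=> k; rewrite inE => /orP[/eqP ->|/SB//]; rewrite mem_filter gi);
  have szB : (size (i :: S) <= size B)%N by apply: uniq_leq_size => //=; rewrite iS.
- by exfalso; move: sz; rewrite leqn0 subn_eq0 => /(leq_trans szB); rewrite ltnn.
- apply: (IH (i :: S)) => //=; first by rewrite iS.
  + by rewrite inE i0S orbT.
  + by rewrite subnS -ltnS prednK ?subn_gt0.
  + move=> k; rewrite inE => /orP[/eqP -> t' u' Jt' Ju'|kS t' u' Jt' Ju']; rewrite big_cons.
      exact: far.
    by apply: le_trans (HS k kS _ _ Jt' Ju') _; rewrite lerDr.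
Qed.

End Chain.

Lemma dot_coord_bound (R : realType) (x y : R * R) (a b : R) :
  `|x.1| <= a -> `|x.2| <= a -> `|y.1| <= b -> `|y.2| <= b -> `|dot x y| <= 2 * a * b.
Proof.
move=> x1 x2 y1 y2; rewrite /dot (le_trans (ler_normD _ _))// !normrM.
have := ler_pM (normr_ge0 _) (normr_ge0 _) x1 y1.
have := ler_pM (normr_ge0 _) (normr_ge0 _) x2 y2; lra.
Qed.

Section MeshEdges.
Variables (R : realType) (Omega : set (R * R)) (sides : seq (side R)).
Variables (Th : seq (triangle R)) (h K : R) (ctr : triangle R -> R * R).
Hypothesis hOmega : polygonal_domain Omega sides.
Hypothesis hTh : triangulation Omega sides Th.
Hypotheses (h0 : 0 < h) (K1 : 1 <= K).
Hypothesis hdiam : forall T, T \in Th -> diam T <= h.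
Hypothesis hball : forall T, T \in Th -> [set y | enorm (y - ctr T) <= h / K] `<=` hull T.
Implicit Types (T : triangle R) (x y z p q v : R * R) (s : side R).

Lemma is_vertexP p : is_vertex Th p <-> p \in flatten [seq (T : seq (R * R)) | T <- Th].
Proof.
split.
  move=> [T TTh pT]; apply/flattenP; exists (T : seq (R * R)) => //.
  by apply/mapP; exists T.
by move=> /flattenP[_ /mapP[T TTh ->] pT]; exists T.
Qed.

(** All vertices of the mesh are projected, on s or not: the list is finite and contains the
    parameters of those on s. *)
Definition side_vertices s : seq R :=
  [seq side_param s v | v <- flatten [seq (T : seq (R * R)) | T <- Th]].

Lemma side_vertices_out s (t : R) : s \in sides -> t \notin side_vertices s -> ~ is_vertex Th (side_point s t).
Proof.
move=> ss tn /is_vertexP tv; move/negP: tn; apply.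
by apply/mapP; exists (side_point s t) => //; rewrite side_pointK// (side_neq hOmega ss).
Qed.

Lemma side_point_continuous s : continuous (side_point s).
Proof.
move=> t; apply: cvgD; first exact: cvg_cst.
by apply: cvgZr_tmp; exact: cvg_id.
Qed.

(** Off the vertices this is [hull_edge_on]. A vertex is a limit of other points of the side, and
    being outside all the finitely many elements with an edge on s is an open condition. *)
Lemma edges_cover s (t : R) : s \in sides -> 0 <= t <= 1 ->
  exists T, [/\ T \in Th, edge_on s T & hull T (side_point s t)].
Proof.
move=> ss t01; apply: contrapT => H.
have N : \forall u \near t, forall T, T \in Th -> edge_on s T -> ~ hull T (side_point s u).
  apply: (@near_seq _ Th _ (fun T u => edge_on s T -> ~ hull T (side_point s u)) (nbhs t)) => T TTh; have aT := mesh_area hTh TTh.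
  have [eT|nT] := pselect (edge_on s T); last by apply: nearW => u /nT.
  have [v vT bv] : exists2 v, v \in T & bary T v (side_point s t) < 0.
    apply: contrapT => nv; apply: H; exists T; split => //; apply/(hull_baryP aT) => v vT.
    by rewrite leNgt; apply/negP => bv; apply: nv; exists v.
  have c : {for t, continuous (bary T v \o side_point s)}.
    by apply: continuous_comp; [exact: side_point_continuous|exact: bary_continuous].
  have C : \forall u \near t, bary T v (side_point s u) < 0 by exact: (c _ (lt_nbhsl bv)).
  apply: filterS C => u /= bu _ /(hull_baryP aT) /(_ v vT).
  by rewrite leNgt bu.
(* Non-vertices of [0, 1] near t are found on the right when t < 1 and on the left when t = 1; F is
   the corresponding one-sided filter. *)
have fin (F : set_system R) : ProperFilter F -> (forall A, nbhs t A -> F A) ->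
    (forall a, \forall u \near F, u != a) -> (\forall u \near F, 0 <= u <= 1) -> False.
  move=> PF tF aF F01.
  have V : \forall u \near F, forall a, a \in side_vertices s -> u != a by apply: near_seq.
  have [u [[Nu u01] Vu]] := filter_ex (filterI (filterI (tF _ N) F01) V).
  have nv : ~ is_vertex Th (side_point s u).
    by apply: side_vertices_out => //; apply/negP => /Vu; rewrite eqxx.
  have su : closed_side s (side_point s u) by exists u => //=; rewrite in_itv.
  have [T TTh hT] := closure_mesh hTh (closed_side_boundary hOmega ss su).1.
  have [x [y [xT yT xy sx [sy _]]]] := hull_edge_on hOmega hTh ss u01 nv TTh hT.
  by apply: (Nu T TTh) => //; exists x, y.
have /andP[t0 t1] := t01; have [t1'|t1'] := ltP t 1.
  apply (fin _ (at_right_proper_filter t)) => [A tA|a|].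
    by apply: filterS tA => u Au _.
    have [at_|ta] := leP a t.
      by near=> u; rewrite gt_eqF// (le_lt_trans at_)//; near: u; exact: nbhs_right_gt.
    by near=> u; rewrite lt_eqF//; near: u; exact: nbhs_right_lt.
  near=> u; apply/andP; split.
    by rewrite (le_trans t0)// ltW//; near: u; exact: nbhs_right_gt.
  by near: u; exact: nbhs_right_le.
apply (fin _ (at_left_proper_filter t)) => [A tA|a|].
    by apply: filterS tA => u Au _.
  have [ta|at_] := leP t a.
    by near=> u; rewrite lt_eqF// (lt_le_trans _ ta)//; near: u; exact: nbhs_left_lt.
  by near=> u; rewrite gt_eqF//; near: u; exact: nbhs_left_gt.
near=> u; apply/andP; split.
  by near: u; apply: nbhs_left_ge; apply: lt_le_trans t1'.
by rewrite (le_trans _ t1)// ltW//; near: u; exact: nbhs_left_lt.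
Unshelve. all: by end_near. Qed.

Definition edge_set s T : set R := [set t | 0 <= t <= 1 /\ hull T (side_point s t)].

Lemma edge_set_closed s T : area2 T != 0 -> closed (edge_set s T).
Proof.
move=> aT; have [a [b [c [E _]]]] := tri_seq T.
have memE w : (w \in T) = (w \in [:: a; b; c]) by rewrite -E.
pose f v := bary T v \o side_point s.
have cf v : continuous (f v).
  by move=> t; apply: continuous_comp; [exact: side_point_continuous|exact: bary_continuous].
have cl v : closed (f v @^-1` `[0, +oo[).
  by apply: (continuous_closedP _).1 => //; exact: interval_closed.
rewrite (_ : edge_set s T = `[0, 1] `&` (f a @^-1` `[0, +oo[ `&` (f b @^-1` `[0, +oo[ `&` f c @^-1` `[0, +oo[))).
  by apply: closedI; [exact: interval_closed|do 2?apply: closedI].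
apply/seteqP; split => t; rewrite /edge_set /= !in_itv /= !andbT.
  by move=> [-> /(hull_baryP aT) H]; split=> //; split; [|split]; apply: H; rewrite memE !inE eqxx ?orbT.
move=> [-> [Ha [Hb Hc]]]; split => //; apply/(hull_baryP aT) => v.
by rewrite memE !inE => /or3P[] /eqP ->.
Qed.

(** Lower bound: the barycentric coordinate of y grows from 0 to 1 along the edge with slope at most
    2 K / h. Upper bound: two points of the edge are at most 2 h apart, so it lies in an interval of
    length 4 h around one of them. *)
Lemma edge_set_measure s T : s \in sides -> T \in Th -> edge_on s T ->
  h / (2 * K) <= side_length s * fine (lebesgue_measure (edge_set s T)) <= 4 * h.
Proof.
move=> ss TTh eT; have aT := mesh_area hTh TTh.
have s12 := side_neq hOmega ss; have l0 := side_length_gt0 s12.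
have mE : measurable (edge_set s T) by apply: closed_measurable; exact: edge_set_closed.
have [x [y [xT yT xy [a a01 xa] [b b01 yb]]]] := eT; rewrite /= !in_itv /= in a01 b01.
wlog ab : x y a b xT yT xy xa yb a01 b01 / a <= b.
  move=> W; have [ab|/ltW ba] := leP a b; first exact: (W x y a b).
  by apply: (W y x b a) => //; rewrite eq_sym.
have Ea : edge_set s T a by split => //; rewrite xa; exact: vertex_hull.
have up t u : edge_set s T t -> edge_set s T u -> (t - u) * side_length s <= 2 * h.
  move=> [_ ht] [_ hu]; have [d1 d2] := mesh_hull_diam hdiam TTh ht hu.
  rewrite (le_trans (ler_norm _))// normrM (gtr0_norm l0) -enormZ.
  rewrite (_ : _ *: _ = side_point s t - side_point s u).
    by apply: enorm_le_coord => //; exact: ltW.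
  by rewrite (side_pointE s t u) addrAC subrr add0r.
pose r := 2 * h / side_length s.
have sub : edge_set s T `<=` `[a - r, a + r].
  move=> t Et /=; rewrite in_itv /= -ler_distl ler_norml lerNl opprB.
  by rewrite !ler_pdivlMr// !up.
have sub' : `[a, b] `<=` edge_set s T.
  move=> t /=; rewrite in_itv /= => /andP[at_ tb]; split.
    by move: a01 b01 => /andP[a0 _] /andP[_ b1]; rewrite (le_trans a0)//= (le_trans tb).
  have [ab'|ab'] := eqVneq a b.
    have -> : t = a by apply/eqP; rewrite eq_le at_ ab' tb.
    by rewrite xa; exact: vertex_hull.
  have ba0 : 0 < b - a by rewrite subr_gt0 lt_neqAle ab'.
  have -> : side_point s t = x + ((t - a) / (b - a)) *: (y - x).
    have baN : b - a != 0 by rewrite gt_eqF.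
    by rewrite -xa -yb /side_point; congr pair; rewrite /= /GRing.scale /=; field.
  apply: (hull_convex hTh TTh); [exact: vertex_hull|exact: vertex_hull|].
  rewrite divr_ge0 ?subr_ge0 ?(ltW ba0)//=.
  by rewrite ler_pdivrMr// mul1r lerB.
have m1 : (lebesgue_measure `[a, b]%classic <= lebesgue_measure (edge_set s T))%E.
  by apply: le_measure => //; rewrite inE//; exact: measurable_itv.
have m2 : (lebesgue_measure (edge_set s T) <= lebesgue_measure `[(a - r)%R, (a + r)%R]%classic)%E.
  by apply: le_measure => //; rewrite inE//; exact: measurable_itv.
have itvE (c e : R) : c <= e -> lebesgue_measure `[c, e]%classic = (e - c)%:E.
  move=> ce; rewrite lebesgue_measure_itv /= lte_fin; case: ltP => // ec.
  by rewrite (_ : e = c) ?subrr//; apply/eqP; rewrite eq_le ec ce.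
have r_ge0 : 0 <= r by rewrite divr_ge0// ?mulr_ge0// ltW.
rewrite itvE// in m1; rewrite itvE in m2; last by lra.
have fm : lebesgue_measure (edge_set s T) \is a fin_num.
  by rewrite ge0_fin_numE// (le_lt_trans m2)// ltry.
rewrite -[X in (_ <= X)%E](fineK fm) lee_fin in m1.
rewrite -[X in (X <= _)%E](fineK fm) lee_fin in m2.
apply/andP; split.
  apply: le_trans (ler_wpM2l (ltW l0) m1).
  have -> : side_length s * (b - a) = enorm (y - x).
    rewrite -yb -xa (side_pointE s b a) addrAC subrr add0r enormZ mulrC.
    by rewrite ger0_norm ?subr_ge0.
  have [g1 g2] := gbary_mesh hTh h0 K1 hball TTh yT.
  have [n1 n2] := enorm_coord (y - x).
  have : 1 <= 2 * (K / h) * enorm (y - x).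
    have := baryE T y y x; rewrite !bary_at// eqxx eq_sym (negbTE xy) add0r => E.
    rewrite -[leLHS]/(true%:R : R) E.
    by rewrite (le_trans (ler_norm _))// dot_coord_bound.
  rewrite ler_pdivrMr; last by rewrite mulr_gt0// (lt_le_trans _ K1).
  by rewrite -[in X in X -> _](ler_pM2l h0) mulr1 => /le_trans; apply; rewrite le_eqVlt; apply/orP; left; apply/eqP; field; rewrite gt_eqF.
apply: le_trans (ler_wpM2l (ltW l0) m2) _.
by rewrite /r le_eqVlt; apply/orP; left; apply/eqP; field; rewrite gt_eqF.
Qed.

End MeshEdges.

Lemma uniform_positive (R : realType) (I : eqType) (L : seq I) (P : I -> R -> Prop) :
  (forall i e e', 0 < e' -> e' <= e -> P i e -> P i e') ->
  (forall i, i \in L -> exists2 e, 0 < e & P i e) ->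
  exists2 e, 0 < e & forall i, i \in L -> P i e.
Proof.
move=> mono; elim: L => [|i L IH] H; first by exists 1.
have [e e0 Pe] := H i (mem_head _ _).
have [e' e'0 Pe'] := IH (fun (j : I) jL => H j (@mem_behead _ (i :: L) j jL)).
have m0 : 0 < Num.min e e' by rewrite lt_min e0.
exists (Num.min e e') => // j; rewrite inE => /orP[/eqP ->|jL].
  by apply: mono Pe => //; rewrite ge_min lexx.
by apply: mono (Pe' j jL) => //; rewrite ge_min lexx orbT.
Qed.

Lemma box_closed (R : realType) (x : R * R) (r : R) : closed (box x r).
Proof.
rewrite boxE (_ : _ `*` _ = (fst @^-1` `[x.1 - r, x.1 + r]) `&` (snd @^-1` `[x.2 - r, x.2 + r])).
  by apply: closedI; apply: (continuous_closedP _).1; try exact: interval_closed; move=> p; [exact: cvg_fst|exact: cvg_snd].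
by apply/seteqP; split.
Qed.

(** * Elements touching two parts of the boundary *)

Section Bad.
Variables (R : realType) (Omega : set (R * R)) (sides : seq (side R)).
Hypothesis hOmega : polygonal_domain Omega sides.

Definition bad_edge (s : side R) (T : triangle R) : Prop :=
  exists2 z, z \in T & polygon_boundary Omega z /\ ~ closed_side s z.

Lemma domain_box : exists2 B : R, 0 < B & closure Omega `<=` box 0 B.
Proof.
case: hOmega => -[_ _ [M [_ HM]] _] _ _ _ _.
exists (`|M| + 1); first by rewrite ltr_wpDl.
have B : M < `|M| + 1 by rewrite (le_lt_trans (ler_norm M))// ltrDl.
rewrite [X in _ `<=` X](closure_id _).1; last exact: box_closed.
apply: closureS => p Op; have := HM _ B p Op.
move=> H; have : Num.max `|p.1| `|p.2| <= `|M| + 1 by exact: H.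
by rewrite ge_max => /andP[h1 h2]; split; rewrite subr0.
Qed.

(* Such an element comes within h of two different sides, hence of an end point of s
   unless h is bounded below; counting disjoint inscribed boxes does the rest. *)
Lemma bad_edges_bounded (K : R) : 1 <= K -> exists M : R, forall Th h ctr,
  triangulation Omega sides Th -> 0 < h ->
  (forall T, T \in Th -> diam T <= h) ->
  (forall T, T \in Th -> [set y | enorm (y - ctr T) <= h / K] `<=` hull T) ->
  forall s, s \in sides ->
  (size [seq T <- Th | `[< edge_on s T /\ bad_edge s T >]])%:R <= M.
Proof.
move=> K1; have K0 : 0 < K by apply: lt_le_trans K1.
have [e e0 He] : exists2 e : R, 0 < e & forall ss, ss \in [seq (s, s') | s <- sides, s' <- sides] ->
    ss.1 != ss.2 -> forall p q, closed_side ss.1 p -> closed_side ss.2 q -> forall r : R,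
    `|(p - q).1| <= r -> `|(p - q).2| <= r -> r < e -> box ss.1.1 (r / e) p \/ box ss.1.2 (r / e) p.
  apply: uniform_positive => [[s s'] e e' e'0 ee' H sN p q cp cq r r1 r2 re|[s s']].
    have re' : r / e <= r / e'.
      by apply: ler_wpM2l; [exact: le_trans r1|rewrite lef_pV2 ?posrE// (lt_le_trans e'0)].
    have E x : box x (r / e) p -> box x (r / e') p by move=> [b1 b2]; split; exact: le_trans re'.
    by case: (H sN p q cp cq r r1 r2 (lt_le_trans re ee')) => /E; [left|right].
  move=> /allpairsPdep[s1 [s2 [s1s s2s [-> ->]]]] /=.
  have [->|sN] := eqVneq s1 s2; first by exists 1.
  have [e e0 H] := sides_apart hOmega s1s s2s sN.
  by exists e => // _.
have [B B0 OB] := domain_box.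
(* The first square counts elements packed in [box 0 B] when h >= e. The other two count, when h <
   e, those packed within (1 / e + 2) h of either end of s: h / e to a vertex on s, h to the centre,
   at most h within the inscribed box. *)
exists ((2 * (B / e) * K) ^+ 2 + ((2 * (e^-1 + 2) * K) ^+ 2 + (2 * (e^-1 + 2) * K) ^+ 2)).
move=> Th h ctr hTh h0 hdiam hball s ss; set L := [seq T <- Th | _].
have uTh : uniq Th by case: hTh => -[].
have LP T : T \in L -> [/\ T \in Th, edge_on s T & bad_edge s T].
  by rewrite mem_filter => /andP[/asboolP[]].
have r0K : h / K / 2 <= h.
  by rewrite !ler_pdivrMr//; move: (ler_wpM2l (ltW h0) K1); rewrite mulr1; nra.
have ei0 : 0 <= e^-1 by rewrite invr_ge0 ltW.
have [he|eh] := ltP h e; last first.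
  apply: (@le_trans _ _ ((2 * (B / e) * K) ^+ 2)); last by rewrite lerDl addr_ge0// sqr_ge0.
  apply: (@le_trans _ _ ((2 * (B / h) * K) ^+ 2)).
    apply: (mesh_count hTh h0 K1 hball (c := 0)).
    - exact: filter_uniq.
    - by move=> T /LP[].
    - by rewrite divr_ge0// ltW.
    move=> T /LP[TTh _ _] y yb; rewrite mulrVK ?unitfE ?gt_eqF//.
    by apply: OB; apply: (mesh_closure hTh TTh); exact: (ctr_box h0 K1 hball).
  rewrite ler_pXn2r ?nnegrE ?mulr_ge0 ?invr_ge0 ?(ltW h0) ?(ltW B0) ?(ltW K0) ?(ltW e0)//.
  by rewrite ler_pM2r// ler_pM2l// ler_pM2l// lef_pV2 ?posrE.
pose near_end (c : R * R) T := `[< box (ctr T) (h / K / 2) `<=` box c ((e^-1 + 2) * h) >].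
have cnt c : (size [seq T <- L | near_end c T])%:R <= (2 * (e^-1 + 2) * K) ^+ 2.
  apply: (mesh_count hTh h0 K1 hball (c := c)).
  - by rewrite !filter_uniq.
  - by move=> T; rewrite mem_filter => /andP[_ /LP[]].
  - by rewrite addr_ge0.
  - by move=> T; rewrite mem_filter => /andP[/asboolP].
apply: (@le_trans _ _ ((size [seq T <- L | near_end s.1 T])%:R + (size [seq T <- L | near_end s.2 T])%:R)); last first.
  by apply: ler_wpDl; [exact: sqr_ge0|exact: lerD].
rewrite -natrD ler_nat !(size_filter (near_end _)).
rewrite -(count_predUI (near_end s.1)) (leq_trans _ (leq_addr _ _))//.
suff -> : count (predU (near_end s.1) (near_end s.2)) L = size L by [].
apply/eqP; rewrite -all_count; apply/allP => T /LP[TTh [x [y [xT yT xy sx sy]]] [z zT [Oz sz]]].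
have [s' ss' sz'] := boundary_closed_side hOmega Oz.
have sN : s != s' by apply/eqP => E; apply: sz; rewrite E.
have aT := mesh_area hTh TTh.
have hx := vertex_hull aT xT; have hz := vertex_hull aT zT.
have [d1 d2] := mesh_hull_diam hdiam TTh hx hz.
have ms : (s, s') \in [seq (s, s') | s <- sides, s' <- sides] by apply/allpairsPdep; exists s, s'.
have E c : box c (h / e) x -> near_end c T.
  move=> [b1 b2]; apply/asboolP => w [w1 w2].
  have [c1 c2] := mesh_hull_diam hdiam TTh (ctr_hull h0 K1 hball TTh) hx.
  split; rewrite mulrDl [e^-1 * h]mulrC.
    have := ler_distD (ctr T).1 w.1 c.1; have := ler_distD x.1 (ctr T).1 c.1.
    have := le_trans w1 r0K; lra.
  have := ler_distD (ctr T).2 w.2 c.2; have := ler_distD x.2 (ctr T).2 c.2.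
  have := le_trans w2 r0K; lra.
by rewrite /predU /=; case: (He _ ms sN x z sx sz' h d1 d2 he) => /E ->; rewrite ?orbT.
Qed.

End Bad.

Section EdgePoint.
Variables (R : realType) (Omega : set (R * R)) (sides : seq (side R)).
Variables (Th : seq (triangle R)) (h : R).
Hypothesis hOmega : polygonal_domain Omega sides.
Hypothesis hTh : triangulation Omega sides Th.
Hypothesis h0 : 0 < h.
Hypothesis hdiam : forall T, T \in Th -> diam T <= h.

Lemma meshes_side_good s T : s \in sides -> T \in Th -> meshes_side Omega s T ->
  edge_on s T /\ ~ bad_edge Omega s T.
Proof.
move=> ss TTh [He sub]; split=> // -[z zT [Oz nz]]; apply: nz; apply: sub; split => //.
exact: (vertex_hull (mesh_area hTh TTh) zT).
Qed.

(** Geometry of T at a point of s that is not a vertex: x and y span the edge on s, and z lies off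
    s. [edge_gz] drives the flux; [edge_inside] identifies the one-sided limit in [dnormal] with a
    derivative of the polynomial on T. *)
Record edge_at (s : side R) (T : triangle R) (t : R) (x y z : R * R) : Prop := EdgeAt {
  edge_xT : x \in T; edge_yT : y \in T; edge_zT : z \in T;
  edge_sx : closed_side s x; edge_sy : closed_side s y; edge_sz : ~ closed_side s z;
  edge_sum : forall (V : nmodType) (f : R * R -> V), \sum_(v <- T) f v = f x + f y + f z;
  edge_gz : dot (gbary T z) (side_normal s) <= - h^-1;
  edge_inside : \forall r \near (0 : R)^'+, tri_interior T (side_point s t - r *: side_normal s) }.

Lemma edge_atP s T t : s \in sides -> T \in Th -> 0 <= t <= 1 -> ~ is_vertex Th (side_point s t) ->
  hull T (side_point s t) -> exists x y z, edge_at s T t x y z.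
Proof.
move=> ss TTh t01 nv hT; have aT := mesh_area hTh TTh.
have [x [y [xT yT xy sx [sy [bx by_]]]]] := hull_edge_on hOmega hTh ss t01 nv TTh hT.
have [z [zT zx zy Tz [hz nz bz gz]]] := edge_third hOmega hTh h0 hdiam ss TTh xT yT xy sx sy.
exists x, y, z; split => //.
  move=> sz; move: nz; rewrite (closed_side_normal (side_neq hOmega ss) sz sx).
  by rewrite ltxx.
set p := side_point s t; set n := side_normal s.
have E v r : bary T v (p - r *: n) = bary T v p - r * dot (gbary T v) n.
  by rewrite (baryE _ _ _ p) /dot /= /GRing.scale /=; ring.
have pos v : 0 < bary T v p -> \forall r \near (0 : R)^'+, 0 < bary T v (p - r *: n).
  move=> bv; set c := dot (gbary T v) n.
  have c0 : 0 < bary T v p / (`|c| + 1) by rewrite divr_gt0// ltr_wpDl.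
  near=> r; rewrite E -/c subr_gt0.
  have r_gt0 : 0 < r by near: r; exact: nbhs_right_gt.
  have rc : r * (`|c| + 1) <= bary T v p.
    by rewrite -ler_pdivlMr ?ltr_wpDl//; near: r; exact: nbhs_right_le.
  apply: lt_le_trans rc; rewrite ltr_pM2l//; have := ler_norm c; lra.
have Hx := pos x bx; have Hy := pos y by_.
near=> r; move=> v vT; case: (Tz v vT) => ->.
- by near: r.
- by near: r.
have r_gt0 : 0 < r by near: r; exact: nbhs_right_gt.
rewrite E bz sub0r -mulrN mulr_gt0// oppr_gt0 (le_lt_trans gz)//.
by rewrite oppr_lt0 invr_gt0.
Unshelve. all: by end_near. Qed.

End EdgePoint.

(** * Finite element functions *)

Section LocalPolynomials.
Variables (R : realType) (k : nat).
Implicit Types (T : triangle R) (u w p : R * R -> R) (x y v : R * R) (s : side R).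

Record local_poly T u p (p1 p2 : R * R -> R) : Prop := LocalPoly {
  lp_bipoly : bipoly k p; lp_bipoly1 : bipoly k p1; lp_bipoly2 : bipoly k p2;
  lp_derive : forall x v, is_derive x v p (v.1 * p1 x + v.2 * p2 x);
  lp_eq : forall x, hull T x -> u x = p x }.

Lemma FE_local Omega Th T u : FE_space k Omega Th u -> T \in Th ->
  exists p p1 p2, local_poly T u p p1 p2.
Proof.
move=> [_ H] TTh; have [p pk pu] := H T TTh.
have [p1 [p2 [bp bp1 bp2 dp]]] := poly2_derive pk.
by exists p, p1, p2.
Qed.

Lemma local_poly_comb T u p p1 p2 w q q1 q2 (a : R) :
  local_poly T u p p1 p2 -> local_poly T w q q1 q2 ->
  local_poly T (fun x => u x + a * w x) (fun x => p x + a * q x)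
    (fun x => p1 x + a * q1 x) (fun x => p2 x + a * q2 x).
Proof.
move=> [bp bp1 bp2 dp pu] [bq bq1 bq2 dq qw]; split.
- exact/bipolyD/bipolyZ.
- exact/bipolyD/bipolyZ.
- exact/bipolyD/bipolyZ.
- move=> x v; have := is_deriveD (dp x v) (is_deriveZ a (dq x v)).
  rewrite (_ : p + a \*: q = (fun x => p x + a * q x)); last by apply/funext.
  by move/is_derive_eq; apply; rewrite /GRing.scale /=; ring.
- by move=> x hx; rewrite pu// qw.
Qed.

Lemma poly2_comb p q (a : R) : poly2 k p -> poly2 k q -> poly2 k (fun x => p x + a * q x).
Proof.
move=> [c ->] [c' ->]; exists (fun i j => c i j + a * c' i j); apply/funext => x.
rewrite mulr_sumr -big_split; apply: eq_bigr => i _.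
rewrite mulr_sumr -big_split; apply: eq_bigr => j _ /=; ring.
Qed.

Lemma FE_comb Omega Th u w (a : R) : FE_space k Omega Th u -> FE_space k Omega Th w ->
  FE_space k Omega Th (fun x => u x + a * w x).
Proof.
move=> [cu Hu] [cw Hw]; split.
  move=> x; apply: cvgD; first exact: cu.
  by apply: cvgM; [exact: cvg_cst|exact: cw].
move=> T TTh; have [p pk pu] := Hu T TTh; have [q qk qw] := Hw T TTh.
exists (fun x => p x + a * q x); first exact: poly2_comb.
by move=> x hx; rewrite pu// qw.
Qed.

Lemma local_poly_grad T u p p1 p2 x : area2 T != 0 -> local_poly T u p p1 p2 ->
  tri_interior T x -> grad u x = (p1 x, p2 x).
Proof.
move=> aT [_ _ _ dp pu] Tx.
have N : \forall y \near x, u y = p y.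
  apply: filterS (tri_interior_open Tx) => y Ty; apply: pu.
  by apply/(hull_baryP aT) => v vT; exact/ltW/Ty.
rewrite /grad !(near_eq_derive _ N) !derive_val /=.
by rewrite !mul1r !mul0r addr0 add0r.
Qed.

Lemma local_poly_dnormal T u p p1 p2 s x : local_poly T u p p1 p2 -> hull T x ->
  (\forall r \near (0 : R)^'+, hull T (x - r *: side_normal s)) ->
  dnormal u s x = (side_normal s).1 * p1 x + (side_normal s).2 * p2 x.
Proof.
set n := side_normal s => -[_ _ _ dp pu] hx hn; rewrite /dnormal -/n.
apply: cvg_lim => //.
have D : h^-1 *: (p (h *: (- n) + x) - p x) @[h --> (0 : R)^'] --> 'D_(- n) p x.
  by have [H _] := dp x (- n); exact: H.
rewrite derive_val /= in D.
have D' : - (h^-1 *: (p (h *: (- n) + x) - p x)) @[h --> (0 : R)^'+] --> n.1 * p1 x + n.2 * p2 x.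
  rewrite (_ : _ + _ = - (- n.1 * p1 x + - n.2 * p2 x)); last by ring.
  apply: cvgN; apply: cvg_trans D; apply: cvg_app; apply: within_subset => //.
  by move=> r /= r_gt0; rewrite gt_eqF.
apply: cvg_trans D'; apply: near_eq_cvg; near=> r.
rewrite pu//; rewrite pu; last by near: r.
have E : r *: (- n) + x = x - r *: n by rewrite scalerN addrC.
by rewrite E -scalerN opprB; exact: mulrC.
Unshelve. all: by end_near. Qed.

Lemma local_poly_line T u p p1 p2 : local_poly T u p p1 p2 -> forall x v (t : R),
  is_derive t 1 (fun t => p (x + t *: v)) (v.1 * p1 (x + t *: v) + v.2 * p2 (x + t *: v)).
Proof.
move=> [_ _ _ dp _] x v t.
have [D E] := dp (x + t *: v) v.
have shift : (fun h => h^-1 *: (((fun t => p (x + t *: v)) \o shift t) (h *: (1 : R)) - p (x + t *: v))) =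
    (fun h => h^-1 *: ((p \o shift (x + t *: v)) (h *: v) - p (x + t *: v))).
  apply/funext => h /=; congr (_ *: (p _ - _)).
  by congr pair; rewrite /= /GRing.scale /=; ring.
by apply: DeriveDef; [rewrite /derivable shift|rewrite /derive shift].
Qed.

Lemma line_osc (f df : R -> R) (S : R) : (forall t, is_derive t (1 : R) f (df t)) ->
  (forall t, 0 <= t <= 1 -> `|df t| <= S) -> `|f 1 - f 0| <= S.
Proof.
move=> Hf HS; have [//||c c01 ->] := @MVT R f df 0 1.
  apply: derivable_within_continuous => t _.
  exact: ex_derive.
rewrite subr0 mulr1; apply: HS; move: c01; rewrite in_itv /= => /andP[c0 c1].
by rewrite !ltW.
Qed.

Lemma local_poly_osc T u p p1 p2 x (r d S1 S2 : R) y y' : local_poly T u p p1 p2 ->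
  (forall z, box x r z -> `|p1 z| <= S1) -> (forall z, box x r z -> `|p2 z| <= S2) ->
  box x r y -> box x r y' -> `|y.1 - y'.1| <= d -> `|y.2 - y'.2| <= d ->
  `|p y - p y'| <= d * (S1 + S2).
Proof.
move=> lp H1 H2 by_ by' d1 d2; have L := local_poly_line lp y' (y - y').
have conv a b c (t : R) : 0 <= t <= 1 -> `|a - c| <= r -> `|b - c| <= r -> `|b + t * (a - b) - c| <= r.
  move=> /andP[t0 t1] ac bc.
  rewrite (_ : _ - c = t * (a - c) + (1 - t) * (b - c)); last by ring.
  apply: le_trans (ler_normD _ _) _; rewrite !normrM (ger0_norm t0) [`|1 - t|]ger0_norm ?subr_ge0//.
  have := ler_wpM2l t0 ac; have t1' : 0 <= 1 - t by rewrite subr_ge0.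
  have := ler_wpM2l t1' bc; lra.
have P1 : p y = (fun t : R => p (y' + t *: (y - y'))) 1 by rewrite scale1r addrC subrK.
have P0 : p y' = (fun t : R => p (y' + t *: (y - y'))) 0 by rewrite scale0r addr0.
rewrite P1 P0; apply: line_osc L _ => t t01.
have bz : box x r (y' + t *: (y - y')).
  by split; apply: conv => //; [exact: by_.1|exact: by'.1|exact: by_.2|exact: by'.2].
apply: le_trans (ler_normD _ _) _; rewrite !normrM mulrDr.
by apply: lerD; apply: ler_pM => //; [exact: H1|exact: H2].
Qed.

End LocalPolynomials.

(** * Inner products over the domain and its boundary *)

Section InnerProducts.
Context d (T : measurableType d) (R : realType).
Variables (mu : {measure set T -> \bar R}) (D : set T).
Hypothesis mD : measurable D.
Implicit Types f g k : T -> R.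

Definition ip f g : R := \int[mu]_(x in D) (f x * g x).

Lemma ipC f g : ip f g = ip g f.
Proof. by apply: eq_Rintegral => x _; rewrite mulrC. Qed.

Lemma ip_ge0 f : 0 <= ip f f.
Proof. by apply: Rintegral_ge0 => x _; rewrite -expr2 sqr_ge0. Qed.

Lemma ip_eq f f' g g' : (forall x, D x -> f x = f' x) -> (forall x, D x -> g x = g' x) ->
  ip f g = ip f' g'.
Proof. by move=> ff gg; apply: eq_Rintegral => x; rewrite inE => Dx; rewrite ff// gg. Qed.

Lemma ip_comb f g k (a : R) : sqint mu D f -> sqint mu D g -> sqint mu D k ->
  ip (fun x => f x + a * g x) k = ip f k + a * ip g k.
Proof.
move=> Lf Lg Lk; rewrite /ip.
rewrite (@eq_Rintegral _ _ _ _ _ (fun x => f x * k x + a * (g x * k x))); last first.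
  by move=> x _; rewrite mulrDl mulrA.
rewrite RintegralD//; first last.
- have := sqintM mD (sqintZ mD a Lg) Lk; apply: eq_integrable => // x _.
  by rewrite /= mulrA.
- exact: sqintM.
by rewrite RintegralZl//; exact: sqintM.
Qed.

Lemma measurable_fun_bigsetU (I : eqType) (L : seq I) (A : I -> set T) f :
  (forall i, i \in L -> measurable (A i) /\ measurable_fun (A i) f) ->
  measurable_fun (\big[setU/set0]_(i <- L) A i) f.
Proof.
elim: L => [|i L IH] H; first by rewrite big_nil; exact: measurable_fun_set0.
have [mA fA] := H i (mem_head _ _).
have HL := fun (j : I) jL => H j (@mem_behead _ (i :: L) j jL).
rewrite big_cons; apply/measurable_funU => //; last by split => //; exact: IH.
elim: L HL {IH H} => [|j L IH] H; first by rewrite big_nil.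
rewrite big_cons; apply: measurableU; first exact: (H j (mem_head _ _)).1.
by apply: IH => l lL; exact: H (@mem_behead _ (j :: L) l lL).
Qed.

Lemma bounded_bigsetU (I : eqType) (L : seq I) (A : I -> set T) f :
  (forall i, i \in L -> exists B, forall x, A i x -> `|f x| <= B) ->
  exists B, forall x, (\big[setU/set0]_(i <- L) A i) x -> `|f x| <= B.
Proof.
elim: L => [|i L IH] H; first by exists 0 => x; rewrite big_nil.
have [B HB] := H i (mem_head _ _).
have [B' HB'] := IH (fun (j : I) jL => H j (@mem_behead _ (i :: L) j jL)).
exists (Num.max B B') => x; rewrite big_cons => -[/HB|/HB'] h; rewrite le_max h ?orbT//.
Qed.

End InnerProducts.

Lemma measurable_side_point (R : realType) (s : side R) : measurable_fun setT (side_point s).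
Proof.
have H (a b : R) : measurable_fun setT (fun t : R => a + t * b).
  apply: measurable_funD; first exact: measurable_cst.
  by apply: measurable_funM; [exact: measurable_id|exact: measurable_cst].
exact: (measurable_fun_pair (H s.1.1 (s.2 - s.1).1) (H s.1.2 (s.2 - s.1).2)).
Qed.

Lemma measurable_bipoly_side (R : realType) k (q : R * R -> R) (s : side R) (A : set R) :
  bipoly k q -> measurable_fun A (q \o side_point s).
Proof.
move=> bq; apply: (@measurable_funS _ _ _ _ setT) => //.
exact: measurableT_comp (measurable_bipoly bq) (measurable_side_point s).
Qed.

Section Forms.
Variables (R : realType) (Omega : set (R * R)) (sides : seq (side R)) (k : nat).
Variables (Th : seq (triangle R)) (h : R).
Hypothesis hOmega : polygonal_domain Omega sides.
Hypothesis hTh : triangulation Omega sides Th.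
Hypothesis h0 : 0 < h.
Hypothesis hdiam : forall T, T \in Th -> diam T <= h.
Notation mu := (@lebesgue_measure R).
Notation mu2 := (plane_measure R).
Notation D := (mesh_interior Th).
Notation V := (FE_space k Omega Th).
Implicit Types (u w v l m : R * R -> R) (s : side R).

(** This discards the edges of the mesh, where [grad] may be only the default value of a limit. *)
Lemma domain_intE (f : R * R -> R) : domain_int Omega f = \int[mu2]_(x in D) f x.
Proof.
have [N [mN N0 sN]] := mesh_interior_null hTh.
have sD : D `<=` Omega by move=> x; exact: (mesh_interior_sub hOmega hTh).
have H := @integral_null _ _ _ mu2 Omega D N (fun x => (f x)%:E) sD sN mN N0.
exact: (congr1 (@fine R) H).
Qed.

Lemma mesh_interior_fin : (mu2 D < +oo)%E.
Proof.
have [B B0 HB] := domain_box hOmega.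
apply: (@le_lt_trans _ _ (mu2 (box 0 B))); last by rewrite measure_box ?ltry// ltW.
apply: le_measure; rewrite ?inE; [exact: measurable_mesh_interior|exact: measurable_box|].
by move=> x Dx; apply: HB; apply: subset_closure; exact: (mesh_interior_sub hOmega hTh).
Qed.

Definition gradx u (x : R * R) : R := (grad u x).1.
Definition grady u (x : R * R) : R := (grad u x).2.

Lemma FE_grad_sqint u : V u -> sqint mu2 D (gradx u) /\ sqint mu2 D (grady u).
Proof.
move=> Vu; have [B B0 HB] := domain_box hOmega.
have piece T : T \in Th -> exists p1 p2, [/\ bipoly k p1, bipoly k p2 &
    forall x, tri_interior T x -> grad u x = (p1 x, p2 x)].
  move=> TTh; have [p [p1 [p2 lp]]] := FE_local Vu TTh.
  exists p1, p2; split; [exact: lp_bipoly1 lp|exact: lp_bipoly2 lp|].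
  by move=> x; exact: (local_poly_grad (mesh_area hTh TTh) lp).
have inB T x : T \in Th -> tri_interior T x -> box 0 B x.
  by move=> TTh Tx; apply: HB; exact: (mesh_closure hTh TTh (tri_interior_hull hTh TTh Tx)).
have gen (pr : R * R -> R) : (forall T, T \in Th -> exists2 q, bipoly k q &
    forall x, tri_interior T x -> pr (grad u x) = q x) -> sqint mu2 D (pr \o grad u).
  move=> H; have [C HC] : exists C, forall x, D x -> `|pr (grad u x)| <= C.
    rewrite mesh_interiorE; apply: bounded_bigsetU => T TTh.
    have [q bq qE] := H T TTh; have [C HC] := bipoly_bounded B bq.
    by exists C => x Tx; rewrite qE//; apply: HC; exact: inB Tx.
  apply: (@sqint_bounded _ _ _ mu2 D (measurable_mesh_interior Th) (pr \o grad u) C mesh_interior_fin _ HC).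
  rewrite mesh_interiorE; apply: measurable_fun_bigsetU => T TTh.
  split; first exact: measurable_tri_interior.
  have [q bq qE] := H T TTh.
  apply: (eq_measurable_fun q) => [x|]; first by rewrite inE => Tx; exact/esym/qE.
  exact: measurable_funS (measurable_bipoly bq).
split; [apply: (gen fst)|apply: (gen snd)] => T TTh; have [p1 [p2 [b1 b2 E]]] := piece T TTh.
  by exists p1 => // x /E ->.
by exists p2 => // x /E ->.
Qed.

Definition dip (f g : R * R -> R) : R := ip mu2 D f g.

Lemma dipC f g : dip f g = dip g f. Proof. exact: ipC. Qed.

Lemma dip_ge0 f : 0 <= dip f f. Proof. exact: ip_ge0. Qed.

Lemma dip_eql f f' g : (forall x, D x -> f x = f' x) -> dip f g = dip f' g.
Proof. by move=> ff; exact: (ip_eq mu2 ff (fun x _ => erefl (g x))). Qed.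

Lemma dip_comb f g e (a : R) : sqint mu2 D f -> sqint mu2 D g -> sqint mu2 D e ->
  dip (fun x => f x + a * g x) e = dip f e + a * dip g e.
Proof. by move=> Lf Lg Le; exact: (@ip_comb _ _ _ mu2 D (measurable_mesh_interior Th) f g e a Lf Lg Le). Qed.

Definition gform u w : R := dip (gradx u) (gradx w) + dip (grady u) (grady w).

Lemma gformE u w : V u -> V w -> domain_int Omega (fun x => dot (grad u x) (grad w x)) = gform u w.
Proof.
move=> Vu Vw; rewrite domain_intE /gform /dip /ip -RintegralD//.
- exact: measurable_mesh_interior.
- by apply: sqintM; [exact: measurable_mesh_interior|exact: (FE_grad_sqint Vu).1|exact: (FE_grad_sqint Vw).1].
- by apply: sqintM; [exact: measurable_mesh_interior|exact: (FE_grad_sqint Vu).2|exact: (FE_grad_sqint Vw).2].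
Qed.

Lemma gformC u w : gform u w = gform w u.
Proof. by rewrite /gform dipC (dipC (grady u)). Qed.

Lemma gform_ge0 u : 0 <= gform u u.
Proof. by rewrite addr_ge0// dip_ge0. Qed.

Lemma grad_comb u w (a : R) x : V u -> V w -> D x ->
  grad (fun x => u x + a * w x) x = ((grad u x).1 + a * (grad w x).1, (grad u x).2 + a * (grad w x).2).
Proof.
move=> Vu Vw [T TTh Tx]; have [p [p1 [p2 lp]]] := FE_local Vu TTh.
have [q [q1 [q2 lq]]] := FE_local Vw TTh; have aT := mesh_area hTh TTh.
rewrite (local_poly_grad aT (local_poly_comb a lp lq) Tx).
by rewrite (local_poly_grad aT lp Tx) (local_poly_grad aT lq Tx).
Qed.

Lemma gform_comb u w v (a : R) : V u -> V w -> V v ->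
  gform (fun x => u x + a * w x) v = gform u v + a * gform w v.
Proof.
move=> Vu Vw Vv; rewrite /gform.
have [u1 u2] := FE_grad_sqint Vu; have [w1 w2] := FE_grad_sqint Vw; have [v1 v2] := FE_grad_sqint Vv.
have mD := measurable_mesh_interior Th.
have Ex x : D x -> gradx (fun x => u x + a * w x) x = gradx u x + a * gradx w x.
  by move=> Dx; rewrite /gradx grad_comb.
have Ey x : D x -> grady (fun x => u x + a * w x) x = grady u x + a * grady w x.
  by move=> Dx; rewrite /grady grad_comb.
rewrite (dip_eql _ Ex) (dip_eql _ Ey) (dip_comb a u1 w1 v1) (dip_comb a u2 w2 v2).
move: (dip (gradx u) _) (dip (grady u) _) (dip (gradx w) _) (dip (grady w) _) => A B C E; ring.
Qed.

Lemma gform_cauchy u w : V u -> V w -> gform u w ^+ 2 <= gform u u * gform w w.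
Proof.
move=> Vu Vw; apply: quadratic_cauchy; [exact: gform_ge0|exact: gform_ge0|] => t.
have := gform_ge0 (fun x => u x + t * w x).
have Vc := FE_comb t Vu Vw.
rewrite (gform_comb t Vu Vw Vc) (gformC u) (gformC w) (gform_comb t Vu Vw Vu) (gform_comb t Vu Vw Vw) (gformC w u).
move: (gform u u) (gform u w) (gform w w) => A B C.
by rewrite (_ : _ + _ = A + t * B *+ 2 + t ^+ 2 * C)//; rewrite mulr2n; ring.
Qed.

(** At a mesh vertex the inward normal may run outside a given element, so [dnormal] is identified
    only off this finite set. *)
Definition bnd_dom s : set R := `[0, 1]%classic `\` [set` side_vertices Th s].

Lemma side_vertices_null s : measurable [set` side_vertices Th s] /\ mu [set` side_vertices Th s] = 0%E.
Proof.
have C : countable [set` side_vertices Th s] by apply: finite_set_countable; exact: finite_seq.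
split; last exact: countable_lebesgue_measure0.
exact: countable_measurable.
Qed.

Lemma measurable_bnd_dom s : measurable (bnd_dom s).
Proof.
apply: measurableD; first exact: measurable_itv.
exact: (side_vertices_null s).1.
Qed.

Lemma bnd_intE (F : side R -> R * R -> R) : bnd_int sides F =
  \sum_(s <- sides) side_length s * \int[mu]_(t in bnd_dom s) F s (side_point s t).
Proof.
apply: eq_bigr => s _; congr (_ * _); congr fine.
have [mN N0] := side_vertices_null s.
apply: (@integral_null _ _ _ mu _ _ _ _ _ _ mN N0); first by move=> t [].
by move=> t [t01 nt]; apply: contrapT => Nt; apply: nt.
Qed.

Definition bL2 (f : side R -> R * R -> R) : Prop :=
  forall s, s \in sides -> sqint mu (bnd_dom s) (fun t => f s (side_point s t)).

Definition bform (f g : side R -> R * R -> R) : R :=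
  \sum_(s <- sides) side_length s *
    ip mu (bnd_dom s) (fun t => f s (side_point s t)) (fun t => g s (side_point s t)).

Lemma bformE f g : bnd_int sides (fun s x => f s x * g s x) = bform f g.
Proof. exact: bnd_intE. Qed.

Lemma bformC f g : bform f g = bform g f.
Proof. by apply: eq_bigr => s _; rewrite ipC. Qed.

Lemma bform_ge0 f : 0 <= bform f f.
Proof.
by rewrite sumr_ge0// => s _; rewrite mulr_ge0 ?enorm_ge0 ?ip_ge0.
Qed.

Lemma bform_eq f f' g g' :
  (forall s t, s \in sides -> bnd_dom s t -> f s (side_point s t) = f' s (side_point s t)) ->
  (forall s t, s \in sides -> bnd_dom s t -> g s (side_point s t) = g' s (side_point s t)) ->
  bform f g = bform f' g'.
Proof.
move=> ff gg; rewrite /bform big_seq [RHS]big_seq; apply: eq_bigr => s ss; congr (_ * _).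
by apply: ip_eq => t Dt; [exact: ff|exact: gg].
Qed.

Lemma bform_comb f g e (a : R) : bL2 f -> bL2 g -> bL2 e ->
  bform (fun s x => f s x + a * g s x) e = bform f e + a * bform g e.
Proof.
move=> Lf Lg Le; rewrite /bform mulr_sumr -big_split !big_seq; apply: eq_bigr => s ss /=.
rewrite ip_comb; [|exact: measurable_bnd_dom|exact: Lf|exact: Lg|exact: Le].
ring.
Qed.

Lemma bL2_comb f g (a : R) : bL2 f -> bL2 g -> bL2 (fun s x => f s x + a * g s x).
Proof.
move=> Lf Lg s ss; have mD := measurable_bnd_dom s.
by apply: sqintD => //; [exact: Lf|apply: sqintZ => //; exact: Lg].
Qed.

Lemma bL2_eq f g : (forall s t, s \in sides -> bnd_dom s t -> f s (side_point s t) = g s (side_point s t)) ->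
  bL2 f -> bL2 g.
Proof.
move=> fg Lf s ss; apply: sqint_eq (Lf s ss); first exact: measurable_bnd_dom.
by move=> t; rewrite inE => Dt; exact: fg.
Qed.

Lemma bform_cauchy f g : bL2 f -> bL2 g -> bform f g ^+ 2 <= bform f f * bform g g.
Proof.
move=> Lf Lg; apply: quadratic_cauchy; [exact: bform_ge0|exact: bform_ge0|] => t.
have := bform_ge0 (fun s x => f s x + t * g s x).
have Lc := bL2_comb t Lf Lg.
rewrite (bform_comb t Lf Lg Lc) (bformC f) (bformC g) (bform_comb t Lf Lg Lf) (bform_comb t Lf Lg Lg) (bformC g f).
move: (bform f f) (bform f g) (bform g g) => A B C.
by rewrite (_ : _ + _ = A + t * B *+ 2 + t ^+ 2 * C)//; rewrite mulr2n; ring.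
Qed.

Lemma bnd_L2_bL2 l : bnd_L2 sides l -> bL2 (fun _ => l).
Proof.
move=> H s ss; have [ml Il] := H s ss.
have mD := measurable_bnd_dom s.
have sub : bnd_dom s `<=` (`[0, 1]%classic : set R) by move=> t [].
split; first exact: measurable_funS ml.
exact: (@integrableS _ _ _ mu _ _ _ (measurable_itv _) mD sub Il).
Qed.

Lemma multiplier_bL2 (L : set (R * R -> R)) l : multiplier_space sides L -> L l -> bL2 (fun _ => l).
Proof.
move=> [n [b [Hb ->]]] [c ->] s ss.
apply: (@sqint_sum _ _ _ mu (bnd_dom s) (measurable_bnd_dom s) _ _ (fun j t => c j * b j (side_point s t))) => j.
by apply: sqintZ; [exact: measurable_bnd_dom|exact: bnd_L2_bL2].
Qed.

Lemma multiplier_comb (L : set (R * R -> R)) l m (a : R) : multiplier_space sides L -> L l -> L m ->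
  L (fun x => l x + a * m x).
Proof.
move=> [n [b [_ ->]]] [c ->] [e ->]; exists (fun j => c j + a * e j); apply/funext => x.
rewrite mulr_sumr -big_split; apply: eq_bigr => j _ /=; ring.
Qed.

Lemma bnd_dom_edge s t : s \in sides -> bnd_dom s t -> 
  [/\ 0 <= t <= 1, ~ is_vertex Th (side_point s t) & exists2 T, T \in Th & edge_set s T t].
Proof.
move=> ss [t01 nt]; rewrite /= in_itv /= in t01; split => //.
  by apply: (side_vertices_out hOmega ss); exact/negP.
by have [T [TTh _ hT]] := edges_cover hOmega hTh ss t01; exists T.
Qed.

Lemma bL2_pieces (f : side R -> R * R -> R) :
  (forall s T, s \in sides -> T \in Th -> exists2 q, bipoly k q &
    forall t, bnd_dom s t -> edge_set s T t -> f s (side_point s t) = q (side_point s t)) -> bL2 f.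
Proof.
move=> H s ss; have [B B0 HB] := domain_box hOmega.
pose A (T : triangle R) := bnd_dom s `&` edge_set s T.
have DE : bnd_dom s = \big[setU/set0]_(T <- Th) A T.
  rewrite -bigcup_seq; apply/seteqP; split => t; last by move=> [T _ []].
  by move=> Dt; have [_ _ [T TTh Et]] := bnd_dom_edge ss Dt; exists T.
have mA T : T \in Th -> measurable (A T).
  move=> TTh; apply: measurableI; first exact: measurable_bnd_dom.
  by apply: closed_measurable; exact: edge_set_closed (mesh_area hTh TTh).
have [C HC] : exists C, forall t, bnd_dom s t -> `|f s (side_point s t)| <= C.
  rewrite {1}DE; apply: (@bounded_bigsetU _ _ _ _ _ _ (fun t => f s (side_point s t))) => T TTh.
  have [q bq qE] := H s T ss TTh; have [C HC] := bipoly_bounded B bq.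
  exists C => t [Dt Et]; rewrite qE//; apply: HC; apply: HB.
  exact: (mesh_closure hTh TTh Et.2).
apply: (@sqint_bounded _ _ _ mu (bnd_dom s) (measurable_bnd_dom s) (fun t => f s (side_point s t)) C _ _ HC).
  apply: (@le_lt_trans _ _ (mu `[0, 1]%classic)); last by rewrite lebesgue_measure_itv /= lte_fin ltr01 ltry.
  by apply: le_measure; rewrite ?inE; [exact: measurable_bnd_dom|exact: measurable_itv|move=> t []].
rewrite DE; apply: measurable_fun_bigsetU => T TTh; split; first exact: mA.
have [q bq qE] := H s T ss TTh.
apply: (eq_measurable_fun (q \o side_point s)) => [t|]; first by rewrite inE => -[Dt Et] /=; rewrite qE.
exact: measurable_bipoly_side bq.
Qed.

End Forms.

Lemma sqrD_le (R : realFieldType) (a b : R) : (a + b) ^+ 2 <= 2 * (a ^+ 2 + b ^+ 2).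
Proof. by have := sqr_ge0 (a - b); rewrite !expr2; nra. Qed.

Section Traces.
Variables (R : realType) (Omega : set (R * R)) (sides : seq (side R)) (k : nat).
Variables (Th : seq (triangle R)) (h : R).
Hypothesis hOmega : polygonal_domain Omega sides.
Hypothesis hTh : triangulation Omega sides Th.
Hypothesis h0 : 0 < h.
Hypothesis hdiam : forall T, T \in Th -> diam T <= h.
Notation V := (FE_space k Omega Th).

Lemma dnormal_local s T (t : R) u p p1 p2 : s \in sides -> T \in Th -> bnd_dom Th s t -> edge_set s T t ->
  local_poly k T u p p1 p2 -> dnormal u s (side_point s t) =
    (side_normal s).1 * p1 (side_point s t) + (side_normal s).2 * p2 (side_point s t).
Proof.
move=> ss TTh Dt Et lp; have [t01 nv _] := bnd_dom_edge hOmega hTh ss Dt.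
have [x [y [z E]]] := edge_atP hOmega hTh h0 hdiam ss TTh t01 nv Et.2.
apply: (local_poly_dnormal lp Et.2); apply: filterS (edge_inside E) => r.
exact: (tri_interior_hull hTh TTh).
Qed.

Lemma trace_bL2 u : V u -> bL2 sides Th (fun _ => u).
Proof.
move=> Vu; apply: (bL2_pieces (k := k) hOmega hTh) => s T ss TTh.
have [p [p1 [p2 lp]]] := FE_local Vu TTh.
by exists p; [exact: lp_bipoly lp|move=> t _ [_ ht]; exact: (lp_eq lp ht)].
Qed.

Lemma dnormal_bL2 u : V u -> bL2 sides Th (dnormal u).
Proof.
move=> Vu; apply: (bL2_pieces (k := k) hOmega hTh) => s T ss TTh.
have [p [p1 [p2 lp]]] := FE_local Vu TTh.
exists (fun x => (side_normal s).1 * p1 x + (side_normal s).2 * p2 x).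
  by apply: bipolyD; apply: bipolyZ; [exact: lp_bipoly1 lp|exact: lp_bipoly2 lp].
by move=> t Dt Et; exact: (dnormal_local ss TTh Dt Et lp).
Qed.

Lemma dnormal_comb s (t : R) u w (a : R) : s \in sides -> bnd_dom Th s t -> V u -> V w ->
  dnormal (fun x => u x + a * w x) s (side_point s t) =
  dnormal u s (side_point s t) + a * dnormal w s (side_point s t).
Proof.
move=> ss Dt Vu Vw; have [_ _ [T TTh Et]] := bnd_dom_edge hOmega hTh ss Dt.
have [p [p1 [p2 lp]]] := FE_local Vu TTh; have [q [q1 [q2 lq]]] := FE_local Vw TTh.
rewrite (dnormal_local ss TTh Dt Et (local_poly_comb a lp lq)).
by rewrite (dnormal_local ss TTh Dt Et lp) (dnormal_local ss TTh Dt Et lq); ring.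
Qed.

End Traces.

(* The gradient is polynomial on T, so its maximum there is attained, up to a
   constant, on a whole box inside T. *)
Lemma FE_oscillation (R : realType) (k : nat) (K : R) : 1 <= K -> exists2 C : R, 0 < C &
  forall (Omega : set (R * R)) (sides : seq (side R)) Th (h : R) ctr,
  polygonal_domain Omega sides -> triangulation Omega sides Th -> 0 < h ->
  (forall T, T \in Th -> diam T <= h) ->
  (forall T, T \in Th -> [set y | enorm (y - ctr T) <= h / K] `<=` hull T) ->
  forall u, FE_space k Omega Th u -> exists o : triangle R -> R,
  [/\ forall T, 0 <= o T,
      forall T y y', T \in Th -> hull T y -> hull T y' -> `|u y - u y'| <= o T,
      forall T s t, T \in Th -> s \in sides -> bnd_dom Th s t -> edge_set s T t ->
        `|dnormal u s (side_point s t)| <= o T / h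
    & \sum_(T <- Th) o T ^+ 2 <= C * gform Th u u].
Proof.
move=> K1; have K0 : 0 < K by exact: lt_le_trans K1.
have [delta [C [d0 C0 HC]]] := bipoly_reverse_bound k K1.
exists (2 * (K * C / (2 * delta)) ^+ 2).
  by rewrite mulr_gt0// exprn_gt0// divr_gt0// mulr_gt0.
move=> Omega sides Th h ctr hOmega hTh h0 hdiam hball u Vu.
have r0_gt0 : 0 < h / K by rewrite divr_gt0.
have Kr : K * (h / K) = h by rewrite mulrC divfK// gt_eqF.
(* [d.1] holds bounds for the two partial derivatives of the polynomial over the box of half-width h
   around [ctr T], which contains T; [d.2] holds the centres of the small boxes where they are
   attained up to C. *)
pose P (T : triangle R) (d : (R * R) * ((R * R) * (R * R))) := T \in Th ->
  [/\ 0 <= d.1.1, 0 <= d.1.2,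
    [/\ forall y y', hull T y -> hull T y' -> `|u y - u y'| <= h * (d.1.1 + d.1.2) &
      forall s t, s \in sides -> bnd_dom Th s t -> edge_set s T t ->
        `|dnormal u s (side_point s t)| <= d.1.1 + d.1.2],
    box d.2.1 (delta * (h / K)) `<=` box (ctr T) (h / K / 2) /\
    box d.2.2 (delta * (h / K)) `<=` box (ctr T) (h / K / 2) &
    forall z, tri_interior T z ->
      (box d.2.1 (delta * (h / K)) z -> d.1.1 <= C * `|gradx u z|) /\
      (box d.2.2 (delta * (h / K)) z -> d.1.2 <= C * `|grady u z|)].
have [T|d Hd] := @choice _ _ P.
  have [TTh|nT] := boolP (T \in Th); last first.
    by exists 0 => TTh; rewrite TTh in nT.
  have aT := mesh_area hTh TTh.
  have [p [p1 [p2 lp]]] := FE_local Vu TTh.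
  have [b1 [S1 [S10 HS1 sub1 rev1]]] := HC p1 (lp_bipoly1 lp) (ctr T) _ r0_gt0.
  have [b2 [S2 [S20 HS2 sub2 rev2]]] := HC p2 (lp_bipoly2 lp) (ctr T) _ r0_gt0.
  rewrite Kr in HS1 HS2.
  have hb y : hull T y -> box (ctr T) h y by exact: (hull_ctr_box h0 K1 hdiam hball TTh).
  exists ((S1, S2), (b1, b2)) => _ /=; split => //; first split.
  - move=> y y' hy hy'; rewrite (lp_eq lp hy) (lp_eq lp hy').
    have [d1 d2] := mesh_hull_diam hdiam TTh hy hy'.
    exact: (local_poly_osc lp HS1 HS2 (hb _ hy) (hb _ hy') d1 d2).
  - move=> s t ss Dt Et; rewrite (dnormal_local hOmega hTh h0 hdiam ss TTh Dt Et lp).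
    have n1 := normal_unit (side_neq hOmega ss).
    have [n1' n2'] := enorm_coord (side_normal s).
    have e1 : enorm (side_normal s) <= 1 by rewrite enorm_le1// n1.
    move: (side_normal s) {n1} n1' n2' e1 => n n1' n2' e1.
    apply: le_trans (ler_normD _ _) _; rewrite !normrM; apply: lerD.
      rewrite -[S1]mul1r; apply: ler_pM => //; first exact: le_trans e1.
      by apply: HS1; apply: hb; exact: Et.2.
    rewrite -[S2]mul1r; apply: ler_pM => //; first exact: le_trans e1.
    by apply: HS2; apply: hb; exact: Et.2.
  - move=> z Tz; rewrite /gradx /grady (local_poly_grad aT lp Tz) /=.
    by split=> [/rev1|/rev2].
pose o T := if T \in Th then h * ((d T).1.1 + (d T).1.2) else 0.
exists o; split.
- move=> T; rewrite /o; case: ifP => // TTh; have [S1 S2 _ _ _] := Hd T TTh.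
  by rewrite mulr_ge0 ?addr_ge0// ltW.
- move=> T y y' TTh hy hy'; rewrite /o TTh; have [_ _ [H _] _ _] := Hd T TTh; exact: H.
- move=> T s t TTh ss Dt Et; rewrite /o TTh mulrAC divff ?gt_eqF// mul1r.
  by have [_ _ [_ H] _ _] := Hd T TTh; exact: H.
have uTh : uniq Th by case: hTh => -[].
have mD := measurable_mesh_interior Th.
(* Used for both partial derivatives: the small boxes are disjoint and inside elements, so the
   integral of g^2 is at least the sum of their areas times (S T / C)^2. *)
have comp (S : triangle R -> R) (b : triangle R -> R * R) (g : R * R -> R) :
    sqint (plane_measure R) (mesh_interior Th) g ->
    (forall T, T \in Th -> 0 <= S T) ->
    (forall T, T \in Th -> box (b T) (delta * (h / K)) `<=` box (ctr T) (h / K / 2)) ->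
    (forall T z, T \in Th -> tri_interior T z -> box (b T) (delta * (h / K)) z -> S T <= C * `|g z|) ->
    \sum_(T <- Th) (h * S T) ^+ 2 <= (K * C / (2 * delta)) ^+ 2 * dip Th g g.
  move=> Lg S0 sb HS.
  have dr : 0 <= delta * (h / K) by rewrite mulr_ge0// ltW.
  have int T : T \in Th -> box (b T) (delta * (h / K)) `<=` tri_interior T.
    by move=> TTh z /(sb T TTh) bz; exact: (ctr_box_interior hTh h0 K1 hball TTh bz).
  have hB T : T \in Th -> [/\ measurable (box (b T) (delta * (h / K))),
      box (b T) (delta * (h / K)) `<=` mesh_interior Th &
      (plane_measure R (box (b T) (delta * (h / K))) < +oo)%E].
    move=> TTh; split; [exact: measurable_box|by move=> z /(int T TTh) Tz; exists T|].
    by rewrite measure_box ?ltry.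
  have Ig := @sqintM _ _ _ (plane_measure R) _ mD _ _ Lg Lg.
  have := @step_le_Rintegral _ _ _ (plane_measure R) (mesh_interior Th) mD _ Th (fun T => (S T / C) ^+ 2) _ hB (fun x => g x * g x) Ig.
  rewrite -/(dip Th g g) => H; have {}H : \sum_(T <- Th) (S T / C) ^+ 2 * (2 * (delta * (h / K))) ^+ 2 <= dip Th g g.
    rewrite (eq_bigr (fun T => (S T / C) ^+ 2 * fine (plane_measure R (box (b T) (delta * (h / K)))))); last first.
      by move=> T _; rewrite measure_box.
    apply: H => z Dz.
    apply: (@sum_indic_disjoint _ _ _ _ h K ctr hTh h0 K1 hball Th (fun T => (S T / C) ^+ 2) (fun T => box (b T) (delta * (h / K))) (g z * g z) z uTh) => //.
      by rewrite -expr2 sqr_ge0.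
    move=> T TTh bz; rewrite -expr2 -[g z ^+ 2]real_normK ?num_real//.
    rewrite lerXn2r ?nnegrE ?normr_ge0 ?divr_ge0 ?S0 ?(ltW C0)//.
    by rewrite ler_pdivrMr// mulrC; apply: HS => //; exact: (int T TTh).
  apply: le_trans (ler_wpM2l (sqr_ge0 _) H); rewrite mulr_sumr; apply: ler_sum => T _.
  rewrite -!exprMn le_eqVlt; apply/orP; left; apply/eqP; congr (_ ^+ 2).
  by field; rewrite !gt_eqF.
have [ux uy] := FE_grad_sqint hOmega hTh Vu.
have H1 := comp (fun T => (d T).1.1) (fun T => (d T).2.1) (gradx u) ux.
have H2 := comp (fun T => (d T).1.2) (fun T => (d T).2.2) (grady u) uy.
have {}H1 : \sum_(T <- Th) (h * (d T).1.1) ^+ 2 <= (K * C / (2 * delta)) ^+ 2 * dip Th (gradx u) (gradx u).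
  apply: H1 => [T TTh|T TTh|T z TTh Tz bz]; have [a1 _ _ [s1 _] r1] := Hd T TTh => //.
  by have [r _] := r1 z Tz; exact: r.
have {}H2 : \sum_(T <- Th) (h * (d T).1.2) ^+ 2 <= (K * C / (2 * delta)) ^+ 2 * dip Th (grady u) (grady u).
  apply: H2 => [T TTh|T TTh|T z TTh Tz bz]; have [_ a1 _ [_ s1] r1] := Hd T TTh => //.
  by have [_ r] := r1 z Tz; exact: r.
rewrite /gform -mulrA mulrDr; apply: le_trans (ler_wpM2l _ (lerD H1 H2)) => //.
rewrite -big_split mulr_sumr big_seq [leRHS]big_seq; apply: ler_sum => T TTh; rewrite /o TTh /=.
rewrite mulrDr; exact: sqrD_le.
Qed.

(** * The interpolant *)

Lemma poly2_monomial (R : realType) k i j (a : R) : (i + j <= k)%N ->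
  poly2 k (fun x : R * R => a * (x.1 ^+ i * x.2 ^+ j)).
Proof.
move=> ijk; exists (fun i' j' => if (i' == i) && (j' == j) then a else 0); apply/funext => x.
have ik : (i < k.+1)%N by rewrite ltnS (leq_trans (leq_addr j i)).
have jk : (j < (k - i).+1)%N by rewrite ltnS leq_subRL// -ltnS.
rewrite (bigD1 (Ordinal ik))//= (bigD1 (Ordinal jk))//= !eqxx mulrA.
rewrite !big1 ?addr0// => [i' ii|j' jj].
  apply: big1 => j' _; rewrite (_ : (_ == i :> nat) = false) ?mul0r//.
  exact: negbTE.
by rewrite (_ : (_ == j :> nat) = false) ?andbF ?mul0r//; exact: negbTE.
Qed.

Lemma poly2_affine (R : realType) k (phi : R * R -> R) (g : R * R) : (1 <= k)%N ->
  (forall x y, phi x = phi y + dot g (x - y)) -> poly2 k phi.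
Proof.
move=> k1 aff.
have := poly2_comb 1 (poly2_comb 1 (poly2_monomial (phi 0) (leq0n k : (0 + 0 <= k)%N))
  (poly2_monomial g.1 (k1 : (1 + 0 <= k)%N))) (poly2_monomial g.2 (k1 : (0 + 1 <= k)%N)).
rewrite (_ : (fun x => _) = phi)//; apply/funext => x.
by rewrite (aff x 0) subr0 /dot !expr0 !expr1 !mul1r !mulr1 addrA.
Qed.

Lemma affine_derive (R : realType) (phi : R * R -> R) (g x v : R * R) :
  (forall x y, phi x = phi y + dot g (x - y)) -> is_derive x v phi (v.1 * g.1 + v.2 * g.2).
Proof.
move=> aff; apply: is_derive_quotient => t _.
by rewrite (aff _ x) addrK addrAC subrr add0r dotZr /dot; ring.
Qed.

Lemma bipoly_cst (R : realType) k (a : R) : bipoly k (fun _ : R * R => a).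
Proof.
rewrite (_ : (fun=> a) = (fun x : R * R => a * (x.1 ^+ 0 * x.2 ^+ 0))).
  by apply: bipolyZ; exact: bipoly_monomial.
by apply/funext => x; rewrite !expr0 !mulr1.
Qed.

Lemma poly2_bipoly (R : realType) k (p : R * R -> R) : poly2 k p -> bipoly k p.
Proof. by move=> /poly2_derive[p1 [p2 []]]. Qed.

Section Interpolant.
Variables (R : realType) (Omega : set (R * R)) (sides : seq (side R)) (k : nat).
Variables (Th : seq (triangle R)) (h K : R) (ctr : triangle R -> R * R).
Hypothesis hOmega : polygonal_domain Omega sides.
Hypothesis hTh : triangulation Omega sides Th.
Hypotheses (h0 : 0 < h) (K1 : 1 <= K) (k1 : (1 <= k)%N).
Hypothesis hdiam : forall T, T \in Th -> diam T <= h.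
Hypothesis hball : forall T, T \in Th -> [set y | enorm (y - ctr T) <= h / K] `<=` hull T.
Variable val : R * R -> R.
Implicit Types (T : triangle R) (x : R * R).

Definition interp_on T x : R := \sum_(v <- T) val v * bary T v x.
Definition interp_grad T : R * R := \sum_(v <- T) val v *: gbary T v.

Lemma interp_on_affine T x y : interp_on T x = interp_on T y + dot (interp_grad T) (x - y).
Proof.
rewrite /interp_grad dotC dot_sumr -big_split; apply: eq_bigr => v _.
by rewrite dotZr (baryE _ _ x y) mulrDr dotC.
Qed.

(** On a shared edge or vertex the first element containing x is used, which [interpE] shows to be
    harmless. The degenerate default triangle is reached only outside the closure of Omega. *)
Definition interp x : R :=
  interp_on (nth [tuple 0; 0; 0] Th (find (fun T => `[< hull T x >]) Th)) x.

Lemma interp_on_vertex T v : T \in Th -> v \in T -> interp_on T v = val v.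
Proof.
move=> TTh vT; have aT := mesh_area hTh TTh.
rewrite /interp_on (big_rem v)//= bary_at// eqxx mulr1 big_seq big1 ?addr0// => w.
rewrite mem_rem_uniq ?tri_uniq// inE => /andP[wv wT].
by rewrite bary_at// (negbTE wv) mulr0.
Qed.

(** Two affine pieces agree at the common vertices, hence on their hull, which is all that two
    elements share. *)
Lemma interpE T x : T \in Th -> hull T x -> interp x = interp_on T x.
Proof.
move=> TTh hx; rewrite /interp; set T' := nth _ _ _.
have hasT : has (fun T => `[< hull T x >]) Th by apply/hasP; exists T => //; exact/asboolP.
have T'Th : T' \in Th by rewrite mem_nth// -has_find.
have hx' : hull T' x by have := nth_find [tuple 0; 0; 0] hasT => /asboolP.
have [->//|TT'] := eqVneq T T'.
case: hTh => _ /(_ _ _ TTh T'Th TT') [_ HI] _ _.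
have : (hull T `&` hull T') x by [].
rewrite HI => hc; apply/eqP; rewrite -subr_eq0; apply/eqP.
apply: (@hull_eq0 _ _ _ (fun y => interp_on T' y - interp_on T y) (interp_grad T' - interp_grad T)) hc.
  move=> y z; rewrite (interp_on_affine T' y z) (interp_on_affine T y z).
  by rewrite /dot /=; ring.
move=> v; rewrite mem_filter => /andP[vT' vT].
by rewrite !interp_on_vertex// subrr.
Qed.

Lemma hull_closed T : T \in Th -> closed (hull T).
Proof.
move=> TTh; have aT := mesh_area hTh TTh.
have cl v : closed (bary T v @^-1` `[0, +oo[).
  by apply: (continuous_closedP _).1; [exact: bary_continuous|exact: interval_closed].
have [a [b [c [E _]]]] := tri_seq T.
have memE w : (w \in T) = (w \in [:: a; b; c]) by rewrite -E.
rewrite (_ : hull T = bary T a @^-1` `[0, +oo[ `&` (bary T b @^-1` `[0, +oo[ `&` bary T c @^-1` `[0, +oo[)).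
  by do 2?apply: closedI.
apply/seteqP; split => x; rewrite /= !in_itv /= !andbT.
  by move=> /(hull_baryP aT) H; split; [|split]; apply: H; rewrite memE !inE eqxx ?orbT.
move=> [Ha [Hb Hc]]; apply/(hull_baryP aT) => v.
by rewrite memE !inE => /or3P[] /eqP ->.
Qed.

Lemma interp_continuous : {within closure Omega, continuous interp}.
Proof.
rewrite (_ : closure Omega = \big[setU/set0]_(T <- Th) hull T); last first.
  rewrite -bigcup_seq; apply/seteqP; split => x.
    by move=> /(closure_mesh hTh) [T TTh Tx]; exists T.
  by move=> [T TTh Tx]; exact: (mesh_closure hTh TTh Tx).
suff H S : {subset S <= Th} -> {within \big[setU/set0]_(T <- S) hull T, continuous interp} by exact: H.
elim: S => [|T S IH] sub.
  by rewrite big_nil; exact: continuous_subspace0.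
rewrite big_cons; have TTh := sub T (mem_head _ _).
apply: withinU_continuous.
- exact: hull_closed.
- have sS : {subset S <= Th} by move=> T' T'S; apply: sub; rewrite inE T'S orbT.
  elim: S sS {IH sub} => [|T' S IH] sS; first by rewrite big_nil; exact: closed0.
  rewrite big_cons; apply: closedU; first by apply: hull_closed; apply: sS; exact: mem_head.
  by apply: IH => T2 T2S; apply: sS; rewrite inE T2S orbT.
- apply: (@subspace_eq_continuous _ _ _ (interp_on T)).
    by move=> x; rewrite inE => hx; rewrite -(interpE TTh hx).
  apply: continuous_subspaceT.
  rewrite (_ : interp_on T = fun x => interp_on T 0 + dot (interp_grad T) x); last first.
    by apply/funext => x; rewrite (interp_on_affine _ x 0) subr0.
  by move=> x; apply: cvgD; [exact: cvg_cst|exact: dot_continuous].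
- by apply: IH => T' T'S; apply: sub; rewrite inE T'S orbT.
Qed.

Lemma interp_FE : FE_space k Omega Th interp.
Proof.
split; first exact: interp_continuous.
move=> T TTh; exists (interp_on T); last by move=> x; exact: interpE.
exact: (poly2_affine k1 (interp_on_affine T)).
Qed.

Lemma interp_local T : T \in Th ->
  local_poly k T interp (interp_on T) (fun=> (interp_grad T).1) (fun=> (interp_grad T).2).
Proof.
move=> TTh; split.
- exact: poly2_bipoly (poly2_affine k1 (interp_on_affine T)).
- exact: bipoly_cst.
- exact: bipoly_cst.
- by move=> x v; apply: affine_derive; exact: interp_on_affine.
- by move=> x; exact: interpE.
Qed.

Lemma interp_grad_bound T : T \in Th ->
  `|(interp_grad T).1| <= K / h * \sum_(v <- T) `|val v| /\
  `|(interp_grad T).2| <= K / h * \sum_(v <- T) `|val v|.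
Proof.
move=> TTh; rewrite /interp_grad !(big_morph fst (id1 := 0) (op1 := +%R)) // !(big_morph snd (id1 := 0) (op1 := +%R)) //.
rewrite mulr_sumr; split; apply: le_trans (ler_norm_sum _ _ _) _;
  rewrite big_seq [leRHS]big_seq; apply: ler_sum => v vT; rewrite /= /GRing.scale /= normrM mulrC;
  apply: ler_wpM2r => //; have [g1 g2] := gbary_mesh hTh h0 K1 hball TTh vT => //.
Qed.

(** 8 K^2 is the product of 2 partial derivatives, the bound (2 h)^2 for the area of an element and
    the factor (K / h)^2 of the squared gradient. *)
Lemma interp_gform : gform Th interp interp <=
  8 * K ^+ 2 * \sum_(T <- Th) (\sum_(v <- T) `|val v|) ^+ 2.
Proof.
pose c T := (K / h * \sum_(v <- T) `|val v|) ^+ 2.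
have mD := measurable_mesh_interior Th.
have hB T : T \in Th -> [/\ measurable (tri_interior T), tri_interior T `<=` mesh_interior Th &
    (plane_measure R (tri_interior T) < +oo)%E].
  move=> TTh; split; [exact: measurable_tri_interior|by move=> z Tz; exists T|].
  apply: (@le_lt_trans _ _ (plane_measure R (mesh_interior Th))); last exact: (mesh_interior_fin hOmega hTh).
  by apply: le_measure; rewrite ?inE; [exact: measurable_tri_interior|exact: mD|move=> z Tz; exists T].
have area T : T \in Th -> fine (plane_measure R (tri_interior T)) <= (2 * h) ^+ 2.
  move=> TTh; have h1 := ltW h0; have mb := measure_box (ctr T) h1.
  have : (plane_measure R (tri_interior T) <= plane_measure R (box (ctr T) h))%E.
    apply: le_measure; rewrite ?inE; [exact: measurable_tri_interior|exact: measurable_box|].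
    by move=> z Tz; apply: (hull_ctr_box h0 K1 hdiam hball TTh); exact: (tri_interior_hull hTh TTh).
  rewrite mb; have [_ _ fT] := hB T TTh.
  have fin : plane_measure R (tri_interior T) \is a fin_num by rewrite ge0_fin_numE.
  by rewrite -[X in (X <= _)%E -> _](fineK fin) lee_fin.
have c0 T : 0 <= c T by exact: sqr_ge0.
have comp (g : R * R -> R) : sqint (plane_measure R) (mesh_interior Th) g ->
    (forall T z, T \in Th -> tri_interior T z -> `|g z| <= K / h * \sum_(v <- T) `|val v|) ->
    dip Th g g <= (2 * h) ^+ 2 * \sum_(T <- Th) c T.
  move=> Lg Hg; have Ig := @sqintM _ _ _ (plane_measure R) _ mD _ _ Lg Lg.
  apply: (@le_trans _ _ (\sum_(T <- Th) c T * fine (plane_measure R (tri_interior T)))); last first.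
    rewrite mulr_sumr big_seq [leRHS]big_seq; apply: ler_sum => T TTh.
    by rewrite mulrC; apply: ler_wpM2r => //; exact: area.
  apply: (@Rintegral_le_step _ _ _ (plane_measure R) _ mD _ Th c _ hB (fun x => g x * g x) Ig) => z [T TTh Tz].
  rewrite (big_rem T)//= indicE mem_set// mulr1; apply: ler_wpDr.
    by apply: sumr_ge0 => T' _; rewrite mulr_ge0// indicE.
  rewrite -expr2 -[g z ^+ 2]real_normK ?num_real// lerXn2r ?nnegrE ?normr_ge0//; last exact: Hg.
  by rewrite mulr_ge0 ?sumr_ge0// divr_ge0 ?(ltW h0)// (le_trans ler01 K1).
have [ux uy] := FE_grad_sqint hOmega hTh interp_FE.
have H1 := comp _ ux; have H2 := comp _ uy.
have G T z : T \in Th -> tri_interior T z -> grad interp z = interp_grad T.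
  move=> TTh Tz; rewrite (local_poly_grad (mesh_area hTh TTh) (interp_local TTh) Tz).
  by case: (interp_grad T).
rewrite /gform; apply: le_trans (lerD (H1 _) (H2 _)) _.
- by move=> T z TTh Tz; rewrite /gradx (G T)//; exact: (interp_grad_bound TTh).1.
- by move=> T z TTh Tz; rewrite /grady (G T)//; exact: (interp_grad_bound TTh).2.
rewrite /c (eq_bigr (fun T => (K / h) ^+ 2 * (\sum_(v <- T) `|val v|) ^+ 2)) => [|T _]; last exact: exprMn.
rewrite -mulr_sumr le_eqVlt; apply/orP; left; apply/eqP; move: (\sum_(_ <- _) _) => S.
by field; rewrite gt_eqF.
Qed.

End Interpolant.

(** * Flux through the boundary *)

Section SideIntegrals.
Variables (R : realType) (Omega : set (R * R)) (sides : seq (side R)).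
Variables (Th : seq (triangle R)) (h K : R) (ctr : triangle R -> R * R).
Hypothesis hOmega : polygonal_domain Omega sides.
Hypothesis hTh : triangulation Omega sides Th.
Hypotheses (h0 : 0 < h) (K1 : 1 <= K).
Hypothesis hdiam : forall T, T \in Th -> diam T <= h.
Hypothesis hball : forall T, T \in Th -> [set y | enorm (y - ctr T) <= h / K] `<=` hull T.
Notation mu := (@lebesgue_measure R).
Implicit Types (T : triangle R) (s : side R).

Definition side_elements s : seq (triangle R) := [seq T <- Th | `[< edge_on s T >]].

Lemma side_elementsP s T : T \in side_elements s <-> T \in Th /\ edge_on s T.
Proof. by rewrite mem_filter; split=> [/andP[/asboolP]|[? ?]] //; apply/andP; split => //; exact/asboolP. Qed.

Lemma side_elements_uniq s : uniq (side_elements s).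
Proof. by apply: filter_uniq; case: hTh => -[]. Qed.

Definition edge_part s T : set R := bnd_dom Th s `&` edge_set s T.

Lemma edge_part_measurable s T : T \in Th -> measurable (edge_part s T).
Proof.
move=> TTh; apply: measurableI; first exact: measurable_bnd_dom.
by apply: closed_measurable; exact: edge_set_closed (mesh_area hTh TTh).
Qed.

Lemma edge_part_fin s T : T \in Th -> (mu (edge_part s T) < +oo)%E.
Proof.
move=> TTh; apply: (@le_lt_trans _ _ (mu `[0%R, 1%R]%classic)); last first.
  by rewrite lebesgue_measure_itv /= lte_fin ltr01 ltry.
apply: le_measure; rewrite ?inE; [exact: edge_part_measurable|exact: measurable_itv|].
by move=> t [[]].
Qed.

Lemma edge_part_measure s T : s \in sides -> T \in side_elements s ->
  h / (2 * K) <= side_length s * fine (mu (edge_part s T)) <= 4 * h.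
Proof.
move=> ss /side_elementsP[TTh eT].
suff -> : mu (edge_part s T) = mu (edge_set s T) by exact: (edge_set_measure hOmega hTh h0 K1 hdiam hball).
have aT := mesh_area hTh TTh; have mE : measurable (edge_set s T) by apply: closed_measurable; exact: edge_set_closed.
have [mN N0] := side_vertices_null Th s.
apply/eqP; rewrite eq_le; apply/andP; split.
  apply: le_measure; rewrite ?inE//; [exact: edge_part_measurable|by move=> t []].
apply: (@le_trans _ _ (mu (edge_part s T `|` [set` side_vertices Th s]))).
  apply: le_measure; rewrite ?inE//; first by apply: measurableU => //; exact: edge_part_measurable.
  move=> t Et; have [tv|tv] := pselect ([set` side_vertices Th s] t); first by right.
  by left; split => //; split => //; rewrite /= in_itv /=; exact: Et.1.
rewrite -[leRHS]adde0 -N0; apply: measureU2 => //.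
exact: edge_part_measurable.
Qed.

Lemma side_elements_cover s t : s \in sides -> bnd_dom Th s t ->
  exists2 T, T \in side_elements s & edge_part s T t.
Proof.
move=> ss Dt; have [t01 _ _] := bnd_dom_edge hOmega hTh ss Dt.
have [T [TTh eT hT]] := edges_cover hOmega hTh ss t01.
by exists T; [exact/side_elementsP|].
Qed.

Lemma edge_part_edge s T t : s \in sides -> T \in Th -> edge_part s T t ->
  exists x y z, edge_at h s T t x y z.
Proof.
move=> ss TTh [Dt [t01 hT]]; have [_ nv _] := bnd_dom_edge hOmega hTh ss Dt.
exact: (edge_atP hOmega hTh h0 hdiam ss TTh t01 nv hT).
Qed.

(** Just inside the domain, along the normal at the point, the interiors of both elements contain
    the same points. *)
Lemma edge_part_disjoint s T T' t : s \in sides -> T \in Th -> T' \in Th ->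
  edge_part s T t -> edge_part s T' t -> T = T'.
Proof.
move=> ss TTh T'Th Et Et'.
have [x [y [z E]]] := edge_part_edge ss TTh Et.
have [x' [y' [z' E']]] := edge_part_edge ss T'Th Et'.
have [r [I I']] := filter_ex (filterI (edge_inside E) (edge_inside E')).
exact: (tri_interior_uniq hTh TTh T'Th I (tri_interior_hull hTh T'Th I')).
Qed.

Lemma edge_part_step s (c : triangle R -> R) T t : s \in sides -> T \in side_elements s ->
  edge_part s T t -> \sum_(T' <- side_elements s) c T' * \1_(edge_part s T') t = c T.
Proof.
move=> ss Ts Et; have [TTh _] := (side_elementsP s T).1 Ts.
rewrite (big_rem T)//= indicE mem_set// mulr1 big_seq big1 ?addr0// => T'.
rewrite mem_rem_uniq ?side_elements_uniq// inE => /andP[T'T /side_elementsP[T'Th _]].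
rewrite indicE memNset ?mulr0// => Et'; move/eqP: T'T; apply.
exact: (edge_part_disjoint ss T'Th TTh Et' Et).
Qed.

Section Bounds.
Variables (s : side R) (F : R -> R) (c : triangle R -> R).
Hypothesis ss : s \in sides.
Hypothesis IF : mu.-integrable (bnd_dom Th s) (EFin \o F).

Let hB T : T \in side_elements s ->
  [/\ measurable (edge_part s T), edge_part s T `<=` bnd_dom Th s & (mu (edge_part s T) < +oo)%E].
Proof.
move=> /side_elementsP[TTh _]; split; [exact: edge_part_measurable|by move=> t []|exact: edge_part_fin].
Qed.

Lemma side_integral_ge : (forall T t, T \in side_elements s -> edge_part s T t -> c T <= F t) ->
  \sum_(T <- side_elements s) c T * (side_length s * fine (mu (edge_part s T))) <=
  side_length s * \int[mu]_(t in bnd_dom Th s) F t.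
Proof.
move=> H; rewrite (eq_bigr (fun T => side_length s * (c T * fine (mu (edge_part s T))))); last first.
  by move=> T _; ring.
rewrite -mulr_sumr; apply: ler_wpM2l; first exact: enorm_ge0.
apply: (@step_le_Rintegral _ _ _ mu _ (measurable_bnd_dom Th s) _ (side_elements s) c (edge_part s) hB F IF).
move=> t Dt; have [T Ts Et] := side_elements_cover ss Dt.
by rewrite (edge_part_step c ss Ts Et); exact: H.
Qed.

Lemma side_integral_le : (forall T, T \in side_elements s -> 0 <= c T) ->
  (forall T t, T \in side_elements s -> edge_part s T t -> F t <= c T) ->
  side_length s * \int[mu]_(t in bnd_dom Th s) F t <= 4 * h * \sum_(T <- side_elements s) c T.
Proof.
move=> c0 H; apply: (@le_trans _ _ (\sum_(T <- side_elements s) c T * (side_length s * fine (mu (edge_part s T))))).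
  rewrite [leRHS](eq_bigr (fun T => side_length s * (c T * fine (mu (edge_part s T))))); last first.
    by move=> T _; ring.
  rewrite -mulr_sumr; apply: ler_wpM2l; first exact: enorm_ge0.
  apply: (@Rintegral_le_step _ _ _ mu _ (measurable_bnd_dom Th s) _ (side_elements s) c (edge_part s) hB F IF).
  move=> t Dt; have [T Ts Et] := side_elements_cover ss Dt.
  by rewrite (edge_part_step c ss Ts Et); exact: H.
rewrite mulr_sumr big_seq [leRHS]big_seq; apply: ler_sum => T Ts; rewrite mulrC.
by apply: ler_wpM2r; [exact: c0|have /andP[] := edge_part_measure ss Ts].
Qed.

End Bounds.
End SideIntegrals.

Lemma sqr_norm_le (R : realDomainType) (x b : R) : `|x| <= b -> x ^+ 2 <= b ^+ 2.
Proof. by move=> xb; rewrite -[x ^+ 2]real_normK ?num_real// lerXn2r ?nnegrE// (le_trans _ xb). Qed.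

Lemma sqr_sum_le (R : realFieldType) (I : Type) (L : seq I) (x : I -> R) :
  (\sum_(i <- L) x i) ^+ 2 <= (size L)%:R * \sum_(i <- L) x i ^+ 2.
Proof.
elim: L => [|i L IH]; first by rewrite !big_nil expr0n mul0r.
have H : 2 * x i * (\sum_(j <- L) x j) <= (size L)%:R * x i ^+ 2 + \sum_(j <- L) x j ^+ 2.
  elim: L {IH} => [|j L IH] /=; first by rewrite !big_nil mulr0 mul0r addr0.
  rewrite !big_cons -[(size L).+1]addn1 natrD; have := sqr_ge0 (x i - x j); rewrite sqrrB mulr2n; lra.
rewrite !big_cons /= -[(size L).+1]addn1 natrD; move: IH H.
move: (\sum_(j <- L) x j) (\sum_(j <- L) x j ^+ 2) (size L)%:R => S Q n; lra.
Qed.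

Lemma sum_filter_le (R : realDomainType) (I : eqType) (L : seq I) (P : pred I) (f : I -> R) :
  (forall i, 0 <= f i) -> \sum_(i <- L | P i) f i <= \sum_(i <- L) f i.
Proof. by move=> f0; rewrite [leRHS](bigID P)/= lerDl sumr_ge0. Qed.

(** * Elementary inequalities for the flux *)

Section Arithmetic.
Variable R : realType.
Implicit Types a c o p q r g K e h m : R.

(* Here c is the value of u at a boundary point, and p, q, r and - c * g are h times
   the contributions of the vertices to the normal derivative of the interpolant;
   the interpolant vanishes at the third vertex in the first lemma. *)
Lemma flux_good c o K p q g : `|p| <= 2 * K * o -> `|q| <= 2 * K * o -> g <= -1 ->
  c ^+ 2 / 2 - 8 * K ^+ 2 * o ^+ 2 <= c * (p + q - c * g).
Proof.
move=> Hp Hq Hg; have B := ler_normD p q.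
have C : - (`|c| * (4 * K * o)) <= c * (p + q).
  rewrite lerNl; apply: le_trans (ler_norm _) _; rewrite normrN normrM; apply: ler_wpM2l => //; lra.
have E : 0 <= c ^+ 2 * (- g - 1) by rewrite mulr_ge0 ?sqr_ge0//; lra.
have := sqr_ge0 (`|c| - 4 * K * o); rewrite sqrrB real_normK ?num_real// mulr2n => S.
have -> : c * (p + q - c * g) = c * (p + q) + c ^+ 2 * (- g - 1) + c ^+ 2 by ring.
move: C E S; rewrite !exprMn; lra.
Qed.

Lemma flux_any c o K e p q r : 0 < e -> `|p| <= 2 * K * o -> `|q| <= 2 * K * o -> `|r| <= 2 * K * o ->
  - e * c ^+ 2 - 9 * K ^+ 2 / e * o ^+ 2 <= c * (p + q + r).
Proof.
move=> e0 Hp Hq Hr; have B := ler_normD p q; have B' := ler_normD (p + q) r.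
have C : - (`|c| * (6 * K * o)) <= c * (p + q + r).
  rewrite lerNl; apply: le_trans (ler_norm _) _; rewrite normrN normrM; apply: ler_wpM2l => //; lra.
apply: le_trans C.
have := mulr_ge0 (ltW e0) (sqr_ge0 (`|c| - 3 * K * o / e)).
rewrite sqrrB real_normK ?num_real// mulr2n !exprMn.
have -> : e * (c ^+ 2 - (`|c| * (3 * K * o / e) + `|c| * (3 * K * o / e)) + 3 ^+ 2 * K ^+ 2 * o ^+ 2 * e^-1 ^+ 2)
   = e * c ^+ 2 - 6 * `|c| * (K * o) + 9 * K ^+ 2 / e * o ^+ 2 by field; rewrite gt_eqF.
lra.
Qed.

Lemma sqr_close c a o : `|c - a| <= o -> a ^+ 2 / 2 - o ^+ 2 <= c ^+ 2 /\ c ^+ 2 <= 2 * a ^+ 2 + 2 * o ^+ 2.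
Proof.
move=> /sqr_norm_le; have := sqr_ge0 (c - a / 2); have := sqr_ge0 (c - 2 * a); rewrite !expr2; split; nra.
Qed.

Lemma sqr_sum3_le (x y z t A B C : R) : `|x - y| <= z + t ->
  y ^+ 2 <= A -> z ^+ 2 <= B -> t ^+ 2 <= C * B -> x ^+ 2 <= 3 * A + (3 + 3 * C) * B.
Proof.
move=> /ler_normlP[H1 H2] Hy Hz Ht; have /sqr_norm_le Hx : `|x| <= `|y| + `|z| + `|t|.
  have := ler_norm y; have := ler_norm (- y); have := ler_norm z; have := ler_norm t.
  by rewrite normrN ler_norml; move=> *; apply/andP; split; lra.
have := sqr_ge0 (`|y| - `|z|); have := sqr_ge0 (`|y| - `|t|); have := sqr_ge0 (`|z| - `|t|).
rewrite !sqrrB !mulr2n !real_normK ?num_real//; move: Hx.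
rewrite !sqrrD !mulr2n !real_normK ?num_real//; lra.
Qed.

(* Ag and Ab are the sums of squared edge values over good and bad elements; e makes
   the negative contribution of the latter half of the positive one of the former. *)
Lemma flux_arith K M e Ag Ab D S beta : 1 <= K -> 1 <= M -> e = (384 * K * M)^-1 ->
  0 <= Ag -> 0 <= D -> Ab <= M * (3 * Ag + (3 + 3 * M) * D) ->
  Ag / (8 * K) - 8 * e * Ab - 4 * beta * D <= S ->
  (Ag + Ab) / (16 * K * (1 + 3 * M)) - ((1 + M) / (8 * K) + 4 * beta) * D <= S.
Proof.
move=> K1 M1 eE Ag0 D0 HAb; apply: le_trans.
have K0 : 0 < K by lra.
have M0 : 0 < M by lra.
(* 384 = 8 * 3 * 16: the bad values then cost Ag / (16 K), half of the available Ag / (8 K). *)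
have e1 : 8 * e * Ab <= (Ag + (1 + M) * D) / (16 * K).
  have -> : (Ag + (1 + M) * D) / (16 * K) = 8 * e * (M * (3 * Ag + (3 + 3 * M) * D)).
    by rewrite eE; field; rewrite !gt_eqF.
  apply: ler_wpM2l HAb; have KM := mulr_gt0 K0 M0.
  have KM' : 0 < 384 * K * M by rewrite -mulrA; lra.
  rewrite eE; have := KM'; rewrite -invr_gt0; lra.
have M3 : 0 < 1 + 3 * M by lra.
have e2 : (Ag + Ab) / (16 * K * (1 + 3 * M)) <= (Ag + (1 + M) * D) / (16 * K).
  rewrite ler_pdivrMr ?mulr_gt0//.
  have -> : (Ag + (1 + M) * D) / (16 * K) * (16 * K * (1 + 3 * M)) = (Ag + (1 + M) * D) * (1 + 3 * M).
    by field; rewrite gt_eqF.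
  move: HAb; have := mulr_ge0 (ltW M0) D0; nra.
have e3 : (Ag + (1 + M) * D) / (16 * K) + (Ag + (1 + M) * D) / (16 * K) = Ag / (8 * K) + (1 + M) / (8 * K) * D.
  by field; rewrite gt_eqF.
lra.
Qed.

(** m is the length of an edge: a positive contribution keeps at least its value on the shortest
    edge, and a negative one costs at most that on the longest. *)
Lemma flux_weight (alpha beta x y h K m : R) : 0 < h -> 1 <= K -> 0 <= x -> 0 <= beta -> 0 <= y ->
  h / (2 * K) <= m <= 4 * h ->
  (if 0 <= alpha then alpha / (2 * K) else 4 * alpha) * x - 4 * beta * y <= (alpha * x - beta * y) / h * m.
Proof.
move=> h0 K1 x0 b0 y0 /andP[m1 m2]; have K0 : 0 < K by lra.
have [n1 n2] : (2 * K)^-1 <= m / h /\ m / h <= 4.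
  rewrite ler_pdivlMr// ler_pdivrMr//; split => //.
  by rewrite mulrC.
rewrite [leRHS](_ : _ = (m / h) * (alpha * x) - (m / h) * (beta * y)); last by field; rewrite gt_eqF.
apply: lerB; last by have := ler_wpM2r (mulr_ge0 b0 y0) n2; rewrite !mulrA.
case: ifP => a0.
  rewrite (_ : alpha / (2 * K) * x = (2 * K)^-1 * (alpha * x)); last by ring.
  by apply: ler_wpM2r => //; exact: mulr_ge0.
have ax : alpha * x <= 0 by rewrite mulr_le0_ge0// ltW// ltNge a0.
rewrite -[leLHS]mulrA; exact: ler_wnM2r.
Qed.

End Arithmetic.

Section Flux.
Variables (R : realType) (Omega : set (R * R)) (sides : seq (side R)) (k : nat).
Variables (Th : seq (triangle R)) (h K : R) (ctr : triangle R -> R * R).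
Hypothesis hOmega : polygonal_domain Omega sides.
Hypothesis hTh : triangulation Omega sides Th.
Hypotheses (h0 : 0 < h) (K1 : 1 <= K) (k1 : (1 <= k)%N).
Hypothesis hdiam : forall T, T \in Th -> diam T <= h.
Hypothesis hball : forall T, T \in Th -> [set y | enorm (y - ctr T) <= h / K] `<=` hull T.
Variable M : R.
Hypothesis M1 : 1 <= M.
Hypothesis bad_count : forall s, s \in sides ->
  (size [seq T <- Th | `[< edge_on s T /\ bad_edge Omega s T >]])%:R <= M.
Hypothesis resolved : forall s, s \in sides -> exists2 T, T \in Th & meshes_side Omega s T.
Notation mu := (@lebesgue_measure R).
Notation V := (FE_space k Omega Th).
Variables (u : R * R -> R) (o : triangle R -> R).
Hypothesis Vu : V u.
Hypothesis o0 : forall T, 0 <= o T.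
Hypothesis osc : forall T y y', T \in Th -> hull T y -> hull T y' -> `|u y - u y'| <= o T.
Implicit Types (T : triangle R) (s : side R).

Local Notation E := (side_elements Th).
Let K0 : 0 < K. Proof. exact: lt_le_trans K1. Qed.

(** A representative of u on the edge; by [osc] any other point of it would give the same up to
    [o T]. The default parameter 0 concerns only elements that do not meet s. *)
Definition edge_value s T : R := u (side_point s (xget 0 (edge_set s T))).
Definition bnd_value (v : R * R) : R := if `[< polygon_boundary Omega v >] then u v else 0.
Local Notation a := edge_value.
Local Notation w := (interp Th bnd_value).
Let good s T := ~~ `[< bad_edge Omega s T >].
Let D := \sum_(T <- Th) o T ^+ 2.

Lemma edge_set_nonempty s T : T \in E s -> edge_set s T !=set0.
Proof.
move=> /side_elementsP[TTh [x [y [xT _ _ [t t01 xE] _]]]].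
exists t; split; first by rewrite /= in_itv in t01.
by rewrite xE; exact: (vertex_hull (mesh_area hTh TTh) xT).
Qed.

Lemma edge_point s T : T \in E s -> edge_set s T (xget 0 (edge_set s T)).
Proof. by move=> Ts; exact: xgetPex (edge_set_nonempty Ts). Qed.

Lemma edge_value_close s T p : T \in E s -> hull T p -> `|u p - a s T| <= o T.
Proof.
move=> Ts hp; have [TTh _] := (side_elementsP _ _ _).1 Ts.
exact: (osc TTh hp (edge_point Ts).2).
Qed.

Lemma osc_sum_ge0 : 0 <= D.
Proof. by apply: sumr_ge0 => T _; exact: sqr_ge0. Qed.

Lemma osc_sum_side s : \sum_(T <- E s) o T ^+ 2 <= D.
Proof. by rewrite big_filter; apply: sum_filter_le => T; exact: sqr_ge0. Qed.

(** A chain of bad edges leads to a good one. At most M oscillations are summed on the way, which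
    Cauchy-Schwarz turns into M * D; the factor 3 comes from squaring a sum of three terms. *)
Lemma bad_value s T : s \in sides -> T \in E s -> ~~ good s T ->
  a s T ^+ 2 <= 3 * (\sum_(T' <- E s | good s T') a s T' ^+ 2) + (3 + 3 * M) * D.
Proof.
move=> ss Ts bad; have [Tg TgTh mTg] := resolved ss.
have [eTg gTg] := meshes_side_good hTh ss TgTh mTg.
have Tgs : Tg \in E s by exact/side_elementsP.
have ggT : good s Tg by apply/negP => /asboolP.
(* Empty off the elements of s, so that [J] is closed for every index, as the chain lemma
   demands. *)
pose J T := if T \in E s then edge_set s T else set0.
have [T' [T's gT' H]] : exists T', [/\ T' \in E s, good s T' & forall t t', J T t -> J T' t' ->
    `|u (side_point s t) - u (side_point s t')| <= o T' + \sum_(j <- E s | ~~ good s j) o j].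
  apply: (@chain_to_good R _ (E s) J (good s) (fun t => u (side_point s t)) o
    (side_elements_uniq hTh s) _ _ _ _ o0 _ T Tg Ts bad Tgs ggT).
  - move=> i; rewrite /J; case: ifP => [/side_elementsP[iTh _]|_]; last exact: closed0.
    exact: edge_set_closed (mesh_area hTh iTh).
  - by move=> i t; rewrite /J; case: ifP => // _ [t01 _]; rewrite /= in_itv.
  - move=> t t01; have [i [iTh ei hi]] := edges_cover hOmega hTh ss t01.
    have Ei : i \in E s by exact/side_elementsP.
    by exists i => //; rewrite /J Ei.
  - by move=> i Ei; rewrite /J Ei; exact: edge_set_nonempty.
  - move=> i Ei t t'; rewrite /J Ei => -[_ ht] [_ ht'].
    by apply: osc => //; have [] := (side_elementsP _ _ _).1 Ei.
have := H _ _ _ _; rewrite /J Ts T's => /(_ _ _ (edge_point Ts) (edge_point T's)).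
rewrite -/(a s T) -/(a s T') => {}H.
have B1 : a s T' ^+ 2 <= \sum_(T' <- E s | good s T') a s T' ^+ 2.
  rewrite -big_filter (big_rem T')/=; last by rewrite mem_filter gT' T's.
  by rewrite lerDl sumr_ge0// => i _; exact: sqr_ge0.
have B2 : o T' ^+ 2 <= D.
  have [T'Th _] := (side_elementsP _ _ _).1 T's.
  by rewrite /D (big_rem T')//= lerDl sumr_ge0// => i _; exact: sqr_ge0.
have B3 : (\sum_(j <- E s | ~~ good s j) o j) ^+ 2 <= M * D.
  rewrite -big_filter; apply: le_trans (sqr_sum_le _ _) _.
  apply: ler_pM => //; first by apply: sumr_ge0 => i _; exact: sqr_ge0.
    apply: le_trans (bad_count ss); rewrite ler_nat -filter_predI !size_filter.
    apply: sub_count => i /= /andP[/negPn /asboolP b /asboolP e]; exact/asboolP.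
  by rewrite big_filter; apply: le_trans (osc_sum_side s); apply: sum_filter_le => i; exact: sqr_ge0.
exact: sqr_sum3_le H B1 B2 B3.
Qed.

Lemma bad_values s : s \in sides -> \sum_(T <- E s | ~~ good s T) a s T ^+ 2 <=
  M * (3 * (\sum_(T <- E s | good s T) a s T ^+ 2) + (3 + 3 * M) * D).
Proof.
move=> ss; set Q := 3 * _ + _.
have Q0 : 0 <= Q.
  by rewrite addr_ge0 ?mulr_ge0 ?osc_sum_ge0 ?sumr_ge0//; [move=> T _; exact: sqr_ge0|have := M1; lra].
rewrite -big_filter; apply: (@le_trans _ _ ((size [seq T <- E s | ~~ good s T])%:R * Q)).
  rewrite mulr_natl -count_predT -iter_addr_0 -big_const_seq big_seq [leRHS]big_seq; apply: ler_sum => T.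
  by rewrite mem_filter => /andP[bT Ts]; exact: bad_value.
apply: ler_wpM2r => //; apply: le_trans (bad_count ss); rewrite ler_nat -filter_predI !size_filter.
by apply: sub_count => i /= /andP[/negPn /asboolP b /asboolP e]; exact/asboolP.
Qed.

(** Subtracting the constant u at the boundary point is free because the [gbary T v] sum to zero. A
    boundary vertex then contributes only an oscillation of u, while an interior one contributes - u
    times its own slope. *)
Lemma interp_dnormal s T t : s \in sides -> T \in Th -> edge_part Th s T t ->
  h * dnormal w s (side_point s t) =
  \sum_(v <- T) (bnd_value v - u (side_point s t)) * (h * dot (gbary T v) (side_normal s)).
Proof.
move=> ss TTh [Dt Et]; rewrite (dnormal_local hOmega hTh h0 hdiam ss TTh Dt Et (interp_local hTh k1 bnd_value TTh)).
have -> : (side_normal s).1 * (interp_grad bnd_value T).1 + (side_normal s).2 * (interp_grad bnd_value T).2 =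
    dot (side_normal s) (interp_grad bnd_value T) by [].
have -> : interp_grad bnd_value T = \sum_(v <- T) (bnd_value v - u (side_point s t)) *: gbary T v.
  under eq_bigr do rewrite scalerBl.
  by rewrite sumrB -scaler_sumr (gbary_sum (mesh_area hTh TTh)) scaler0 subr0.
rewrite dot_sumr mulr_sumr; apply: eq_bigr => v _; rewrite dotZr dotC; ring.
Qed.

Lemma bnd_value_boundary s v : s \in sides -> closed_side s v -> bnd_value v = u v.
Proof.
by move=> ss sv; rewrite /bnd_value; case: asboolP => // -[]; exact: (closed_side_boundary hOmega ss sv).
Qed.

(** Coefficients of the squared oscillation: 1 / 2 from replacing u^2 / 2 by the edge value and 8
    K^2 from [flux_good] on good edges; 2 e from the same replacement in e u^2 and 9 K^2 / e from
    [flux_any] on bad ones. *)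
Definition flux_beta (e : R) : R := 1 / 2 + 8 * K ^+ 2 + 2 * e + 9 * K ^+ 2 / e.

Lemma flux_point (e : R) s T t : 0 < e -> s \in sides -> T \in E s -> edge_part Th s T t ->
  ((if good s T then 1 / 4 else - (2 * e)) * a s T ^+ 2 - flux_beta e * o T ^+ 2) / h <=
  u (side_point s t) * dnormal w s (side_point s t).
Proof.
move=> e0 ss Ts Et; have [TTh eT] := (side_elementsP _ _ _).1 Ts; have aT := mesh_area hTh TTh.
have [x [y [z P]]] := edge_part_edge hOmega hTh h0 hdiam ss TTh Et.
have ht := Et.2.2.
rewrite ler_pdivrMr// -mulrA [_ * h]mulrC (interp_dnormal ss TTh Et) (edge_sum P).
set c := u (side_point s t).
have n1 := normal_unit (side_neq hOmega ss).
have [m1 m2] := enorm_coord (side_normal s).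
have e1 : enorm (side_normal s) <= 1 by rewrite enorm_le1// n1.
have G v d : v \in T -> `|d| <= o T -> `|d * (h * dot (gbary T v) (side_normal s))| <= 2 * K * o T.
  move=> vT dT; have [g1 g2] := gbary_mesh hTh h0 K1 hball TTh vT.
  have B := dot_coord_bound g1 g2 (le_trans m1 e1) (le_trans m2 e1).
  rewrite normrM mulrC [`|h * _|]normrM (gtr0_norm h0); apply: ler_pM => //; first by rewrite mulr_ge0// ltW.
  have := ler_wpM2l (ltW h0) B; rewrite (_ : h * (2 * (K / h) * 1) = 2 * K)//.
  by field; rewrite gt_eqF.
have C v : v \in T -> `|u v - c| <= o T.
  by move=> vT; apply: osc => //; exact: vertex_hull.
have Gx : `|(bnd_value x - c) * (h * dot (gbary T x) (side_normal s))| <= 2 * K * o T.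
  by rewrite (bnd_value_boundary ss (edge_sx P)); apply: G; [exact: edge_xT P|apply: C; exact: edge_xT P].
have Gy : `|(bnd_value y - c) * (h * dot (gbary T y) (side_normal s))| <= 2 * K * o T.
  by rewrite (bnd_value_boundary ss (edge_sy P)); apply: G; [exact: edge_yT P|apply: C; exact: edge_yT P].
have [q1 q2] := sqr_close (edge_value_close Ts ht); rewrite -/c in q1 q2.
have K2 := sqr_ge0 K; have A2 := sqr_ge0 (a s T); have O2 := sqr_ge0 (o T).
have Ke : 0 <= 9 * K ^+ 2 / e by rewrite divr_ge0 ?mulr_ge0// ltW.
have eO : 0 <= e * o T ^+ 2 by rewrite mulr_ge0// ltW.
have eA : 0 <= e * a s T ^+ 2 by rewrite mulr_ge0// ltW.
have KO : 0 <= K ^+ 2 * o T ^+ 2 by rewrite mulr_ge0.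
have KeO : 0 <= 9 * K ^+ 2 / e * o T ^+ 2 by rewrite mulr_ge0.
have [Bz|Bz] := pselect (polygon_boundary Omega z).
  have -> : good s T = false.
    apply/negbTE/negPn/asboolP; exists z; [exact: edge_zT P|split => //; exact: edge_sz P].
  have vz : bnd_value z = u z by rewrite /bnd_value; case: asboolP.
  have Gz : `|(bnd_value z - c) * (h * dot (gbary T z) (side_normal s))| <= 2 * K * o T.
    by rewrite vz; apply: G; [exact: edge_zT P|apply: C; exact: edge_zT P].
  have := flux_any c e0 Gx Gy Gz; apply: le_trans.
  have := ler_wpM2l (ltW e0) q2; rewrite /flux_beta; move: (9 * K ^+ 2 / e) KeO => X KeO; lra.
have vz : bnd_value z = 0 by rewrite /bnd_value; case: asboolP.
have Gz : h * dot (gbary T z) (side_normal s) <= -1.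
  by have := ler_wpM2l (ltW h0) (edge_gz P); rewrite mulrN divff ?gt_eqF.
have := flux_good c Gx Gy Gz; rewrite vz sub0r mulNr; apply: le_trans.
rewrite /flux_beta; move: (9 * K ^+ 2 / e) KeO => X KeO.
by case: ifP => _; lra.
Qed.

Lemma flux_side (e beta : R) s : e = (384 * K * M)^-1 -> beta = flux_beta e -> s \in sides ->
  (\sum_(T <- E s) a s T ^+ 2) / (16 * K * (1 + 3 * M)) - ((1 + M) / (8 * K) + 4 * beta) * D <=
  side_length s * ip mu (bnd_dom Th s) (fun t => u (side_point s t)) (fun t => dnormal w s (side_point s t)).
Proof.
move=> eE bE ss; have M0 : 0 < M by exact: lt_le_trans M1.
have e0 : 0 < e by rewrite eE invr_gt0; have := mulr_gt0 K0 M0; rewrite -mulrA; lra.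
have b0 : 0 <= beta.
  have K2 := sqr_ge0 K.
  have Ke : 0 <= 9 * K ^+ 2 / e by rewrite divr_ge0 ?mulr_ge0// ltW.
  rewrite bE /flux_beta; move: (9 * K ^+ 2 / e) Ke => X; lra.
have Lu := trace_bL2 hOmega hTh Vu.
have Lw := dnormal_bL2 hOmega hTh h0 hdiam (interp_FE hTh k1 bnd_value).
have IF := @sqintM _ _ _ mu _ (measurable_bnd_dom Th s) _ _ (Lu s ss) (Lw s ss).
pose c T := ((if good s T then 1 / 4 else - (2 * e)) * a s T ^+ 2 - beta * o T ^+ 2) / h.
have H := side_integral_ge hOmega hTh h0 hdiam (c := c) ss IF.
rewrite [X in X / _](bigID (good s))/=.
apply: (flux_arith K1 M1 eE _ osc_sum_ge0 (bad_values ss)).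
  by apply: sumr_ge0 => T _; exact: sqr_ge0.
apply: le_trans (H _); last by move=> T t Ts Et; rewrite /c bE; exact: flux_point.
apply: (@le_trans _ _ (\sum_(T <- E s) ((if good s T then 1 / (8 * K) else - (8 * e)) * a s T ^+ 2 - 4 * beta * o T ^+ 2))).
  rewrite sumrB -mulr_sumr; apply: lerB; last first.
    by apply: ler_wpM2l; [rewrite mulr_ge0|exact: osc_sum_side].
  rewrite [leRHS](bigID (good s))/= le_eqVlt; apply/orP; left; apply/eqP; congr (_ + _).
    by rewrite mulr_suml; apply: eq_bigr => T ->; ring.
  by rewrite -mulNr mulr_sumr; apply: eq_bigr => T /negbTE ->; ring.
rewrite big_seq [leRHS]big_seq; apply: ler_sum => T Ts; rewrite /c.
have m := edge_part_measure hOmega hTh h0 K1 hdiam hball ss Ts.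
have := flux_weight (if good s T then 1 / 4 else - (2 * e)) h0 K1 (sqr_ge0 (a s T)) b0 (sqr_ge0 (o T)) m.
apply: le_trans; apply: lerB => //; apply: ler_wpM2r; first exact: sqr_ge0.
case: ifP => _.
  rewrite divr_ge0// le_eqVlt; apply/orP; left; apply/eqP; field; rewrite gt_eqF//.
rewrite (_ : (0 <= - (2 * e)) = false); last by apply/negbTE; rewrite -ltNge oppr_lt0 mulr_gt0.
by rewrite le_eqVlt; apply/orP; left; apply/eqP; ring.
Qed.

End Flux.

Lemma ler_sum_mem (R : realDomainType) (I : eqType) (L : seq I) (f : I -> R) i :
  i \in L -> (forall j, 0 <= f j) -> f i <= \sum_(j <- L) f j.
Proof. by move=> iL f0; rewrite (big_rem i)//= lerDl sumr_ge0. Qed.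

Lemma ler_sum_const (R : realDomainType) (I : eqType) (L : seq I) (f : I -> R) (c : R) :
  (forall i, i \in L -> f i <= c) -> \sum_(i <- L) f i <= (size L)%:R * c.
Proof.
move=> H; rewrite mulr_natl -count_predT -iter_addr_0 -big_const_seq big_seq [leRHS]big_seq.
exact: ler_sum.
Qed.

Section Bounds.
Variables (R : realType) (Omega : set (R * R)) (sides : seq (side R)) (k : nat).
Variables (Th : seq (triangle R)) (h K : R) (ctr : triangle R -> R * R).
Hypothesis hOmega : polygonal_domain Omega sides.
Hypothesis hTh : triangulation Omega sides Th.
Hypotheses (h0 : 0 < h) (K1 : 1 <= K) (k1 : (1 <= k)%N).
Hypothesis hdiam : forall T, T \in Th -> diam T <= h.
Hypothesis hball : forall T, T \in Th -> [set y | enorm (y - ctr T) <= h / K] `<=` hull T.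
Notation V := (FE_space k Omega Th).
Variables (u : R * R -> R) (o : triangle R -> R).
Hypothesis Vu : V u.
Hypothesis o0 : forall T, 0 <= o T.
Hypothesis osc : forall T y y', T \in Th -> hull T y -> hull T y' -> `|u y - u y'| <= o T.
Implicit Types (T : triangle R) (s : side R).

Local Notation E := (side_elements Th).
Local Notation a := (edge_value u).
Local Notation val := (bnd_value Omega u).
Local Notation w := (interp Th val).
Let D := \sum_(T <- Th) o T ^+ 2.
Let A := \sum_(s <- sides) \sum_(T <- E s) a s T ^+ 2.
Let q s T := 2 * a s T ^+ 2 + 2 * o T ^+ 2.

Lemma bform_le f (c : side R -> triangle R -> R) : bL2 sides Th f -> (forall s T, 0 <= c s T) ->
  (forall s T t, s \in sides -> T \in E s -> edge_part Th s T t -> f s (side_point s t) ^+ 2 <= c s T) ->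
  bform sides Th f f <= 4 * h * \sum_(s <- sides) \sum_(T <- E s) c s T.
Proof.
move=> Lf c0 H; rewrite /bform mulr_sumr big_seq [leRHS]big_seq; apply: ler_sum => s ss.
have If := @sqintM _ _ _ (@lebesgue_measure R) _ (measurable_bnd_dom Th s) _ _ (Lf s ss) (Lf s ss).
apply: (side_integral_le hOmega hTh h0 K1 hdiam hball (c := c s) ss If) => // T t Ts Et.
by rewrite -expr2; exact: H.
Qed.

Lemma local_sum_le : \sum_(s <- sides) \sum_(T <- E s) q s T <= 2 * (A + (size sides)%:R * D).
Proof.
rewrite mulrDr /A mulr_sumr -[(size _)%:R * D]mulr1 -mulrA mulr1.
have S : \sum_(s <- sides) \sum_(T <- E s) o T ^+ 2 <= (size sides)%:R * D.
  by apply: ler_sum_const => s _; exact: osc_sum_side.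
apply: le_trans (lerD (lexx _) (ler_wpM2l _ S)) => //.
rewrite mulr_sumr -big_split le_eqVlt; apply/orP; left; apply/eqP.
by apply: eq_bigr => s _; rewrite /= !mulr_sumr -big_split.
Qed.

Let q0 s T : 0 <= q s T. Proof. by rewrite addr_ge0// mulr_ge0// sqr_ge0. Qed.

Let point_q s T p : T \in E s -> hull T p -> u p ^+ 2 <= q s T.
Proof. by move=> Ts hp; have [] := sqr_close (edge_value_close hTh osc Ts hp). Qed.

Lemma trace_bound : bform sides Th (fun=> u) (fun=> u) <= 8 * h * (A + (size sides)%:R * D).
Proof.
apply: le_trans (bform_le (trace_bL2 hOmega hTh Vu) q0 _) _; last first.
  rewrite (_ : 8 * h * _ = 4 * h * (2 * (A + (size sides)%:R * D))); last by ring.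
  by apply: ler_wpM2l; [rewrite mulr_ge0// ltW|exact: local_sum_le].
by move=> s T t ss Ts [_ [_ ht]]; exact: point_q.
Qed.

Lemma interp_trace_bound : bform sides Th (fun=> w) (fun=> w) <= 8 * h * (A + (size sides)%:R * D).
Proof.
have Vw := interp_FE hTh k1 val.
apply: le_trans (bform_le (trace_bL2 hOmega hTh Vw) q0 _) _; last first.
  rewrite (_ : 8 * h * _ = 4 * h * (2 * (A + (size sides)%:R * D))); last by ring.
  by apply: ler_wpM2l; [rewrite mulr_ge0// ltW|exact: local_sum_le].
move=> s T t ss Ts [_ [_ ht]]; have [TTh _] := (side_elementsP _ _ _).1 Ts; have aT := mesh_area hTh TTh.
have V1 v : v \in T -> `|val v| <= `|a s T| + o T.
  move=> vT; have := edge_value_close hTh osc Ts (vertex_hull aT vT) => C.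
  rewrite /bnd_value; case: ifP => _; last by rewrite normr0 addr_ge0.
  by have := ler_normD (a s T) (u v - a s T); rewrite addrC subrK; lra.
have W : `|w (side_point s t)| <= `|a s T| + o T.
  rewrite (interpE hTh val TTh ht) /interp_on.
  apply: le_trans (ler_norm_sum _ _ _) _.
  rewrite -[leRHS]mulr1 -(bary_sum aT (side_point s t)) mulr_sumr big_seq [leRHS]big_seq.
  apply: ler_sum => v vT; have b0 := (hull_baryP aT _).1 ht v vT.
  by rewrite normrM (ger0_norm b0); apply: ler_wpM2r => //; exact: V1.
apply: le_trans (sqr_norm_le W) _; rewrite /q -mulrDr -[a s T ^+ 2]real_normK ?num_real//.
exact: sqrD_le.
Qed.

Lemma dnormal_bound : (forall T s t, T \in Th -> s \in sides -> bnd_dom Th s t -> edge_set s T t ->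
    `|dnormal u s (side_point s t)| <= o T / h) ->
  bform sides Th (dnormal u) (dnormal u) <= 4 * (size sides)%:R * D / h.
Proof.
move=> odn; apply: le_trans (bform_le (c := fun _ T => (o T / h) ^+ 2) (dnormal_bL2 hOmega hTh h0 hdiam Vu) _ _) _.
- by move=> s T; exact: sqr_ge0.
- move=> s T t ss /side_elementsP[TTh _] [Dt Et]; apply: sqr_norm_le; exact: odn.
rewrite (_ : 4 * _ * D / h = 4 * h * ((size sides)%:R * (D / h ^+ 2))); last by field; rewrite gt_eqF.
apply: ler_wpM2l; first by rewrite mulr_ge0// ltW.
apply: ler_sum_const => s _; under eq_bigr do rewrite exprMn exprVn.
rewrite -mulr_suml; apply: ler_wpM2r; last exact: osc_sum_side.
by rewrite invr_ge0 sqr_ge0.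
Qed.

(** The interpolant also lives on elements that have only a vertex on the boundary. Its value there
    is charged to an element with an edge on a side containing that vertex. *)
Let touch T T' := `[< exists2 v, v \in T & hull T' v >].

Let touch_count T' : T' \in Th -> (size [seq T <- Th | touch T T'])%:R <= 16 * K ^+ 2.
Proof.
move=> T'Th; rewrite (_ : 16 * K ^+ 2 = (2 * 2 * K) ^+ 2); last by ring.
apply: (mesh_count hTh h0 K1 hball (c := ctr T')) => //.
- by apply: filter_uniq; case: hTh => -[].
- by move=> T; rewrite mem_filter => /andP[].
move=> T; rewrite mem_filter => /andP[/asboolP[v vT hv] TTh] p bp.
have hp := ctr_box h0 K1 hball TTh bp.
have [p1 p2] := mesh_hull_diam hdiam TTh hp (vertex_hull (mesh_area hTh TTh) vT).
have [v1 v2] := hull_ctr_box h0 K1 hdiam hball T'Th hv.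
split.
  by have := ler_distD v.1 p.1 (ctr T').1; lra.
by have := ler_distD v.2 p.2 (ctr T').2; lra.
Qed.

Let val_le T v : T \in Th -> v \in T ->
  val v ^+ 2 <= \sum_(s <- sides) \sum_(T' <- E s) (if touch T T' then q s T' else 0).
Proof.
move=> TTh vT.
have p0 s T' : 0 <= (if touch T T' then q s T' else 0) by case: ifP.
have S0 s : 0 <= \sum_(T' <- E s) (if touch T T' then q s T' else 0) by apply: sumr_ge0.
rewrite /bnd_value; case: asboolP => [Bv|_]; last by rewrite expr0n; exact: sumr_ge0.
have [s ss [t t01 tv]] := boundary_closed_side hOmega Bv.
have t01' : 0 <= t <= 1 by rewrite /= in_itv in t01.
have [T' [T'Th eT' hT']] := edges_cover hOmega hTh ss t01'.
have Ts' : T' \in E s by exact/side_elementsP.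
apply: le_trans (ler_sum_mem ss S0); apply: le_trans (ler_sum_mem Ts' (p0 s)).
rewrite tv in hT'; rewrite (_ : touch T T' = true); last by apply/asboolP; exists v.
exact: point_q.
Qed.

(** 2304 = 8 * 9 * 16 * 2: [interp_gform], the square of a sum over three vertices, the number of
    elements touching a given one, and [local_sum_le]. *)
Lemma interp_energy_bound : gform Th w w <= 2304 * K ^+ 4 * (A + (size sides)%:R * D).
Proof.
apply: le_trans (interp_gform hOmega hTh h0 K1 k1 hdiam hball val) _.
pose Q T := \sum_(s <- sides) \sum_(T' <- E s) (if touch T T' then q s T' else 0).
have B1 : \sum_(T <- Th) (\sum_(v <- T) `|val v|) ^+ 2 <= 9 * \sum_(T <- Th) Q T.
  rewrite mulr_sumr big_seq [leRHS]big_seq; apply: ler_sum => T TTh.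
  apply: le_trans (sqr_sum_le _ _) _; rewrite size_tuple.
  apply: (@le_trans _ _ (3 * (3 * Q T))); last by rewrite mulrA le_eqVlt; apply/orP; left; apply/eqP; ring.
  apply: ler_wpM2l => //; rewrite -[X in X%:R * _](size_tuple T); apply: ler_sum_const => v vT.
  by rewrite real_normK ?num_real//; exact: val_le.
have B2 : \sum_(T <- Th) Q T <= 16 * K ^+ 2 * \sum_(s <- sides) \sum_(T <- E s) q s T.
  rewrite exchange_big mulr_sumr; apply: ler_sum => s _.
  rewrite exchange_big mulr_sumr big_seq [leRHS]big_seq; apply: ler_sum => T' /side_elementsP[T'Th _].
  rewrite -big_mkcond -big_filter; apply: le_trans (ler_sum_const (c := q s T') _) _; first by [].
  by apply: ler_wpM2r => //; exact: touch_count.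
have K2 := sqr_ge0 K.
apply: le_trans (ler_wpM2l _ B1) _; first by rewrite mulr_ge0.
apply: le_trans (ler_wpM2l _ (ler_wpM2l _ B2)) _ => //; first by rewrite mulr_ge0.
apply: le_trans (ler_wpM2l _ (ler_wpM2l _ (ler_wpM2l _ local_sum_le))) _ => //; try by rewrite mulr_ge0.
by move: (A + _) => X; rewrite le_eqVlt; apply/orP; left; apply/eqP; ring.
Qed.

End Bounds.

(** All that stability needs from the geometry. A is the sum of squared edge values of u; it stays
    abstract because only these inequalities are used afterwards. The first conclusion is the
    inverse estimate for the normal derivative. *)
Lemma test_function (R : realType) (k : nat) (K : R) (Omega : set (R * R)) (sides : seq (side R)) :
  (1 <= k)%N -> 1 <= K -> polygonal_domain Omega sides ->
  exists c C : R, [/\ 0 < c, 0 < C & forall Th (h : R) ctr,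
  triangulation Omega sides Th -> 0 < h ->
  (forall T, T \in Th -> diam T <= h) ->
  (forall T, T \in Th -> [set y | enorm (y - ctr T) <= h / K] `<=` hull T) ->
  (forall s, s \in sides -> exists2 T, T \in Th & meshes_side Omega s T) ->
  (forall v, FE_space k Omega Th v ->
     bform sides Th (dnormal v) (dnormal v) <= C / h * gform Th v v) /\
  forall u, FE_space k Omega Th u -> exists w A, [/\ FE_space k Omega Th w, 0 <= A,
     c * A - C * gform Th u u <= bform sides Th (fun=> u) (dnormal w),
     gform Th w w <= C * (A + gform Th u u) &
     bform sides Th (fun=> w) (fun=> w) <= C * h * (A + gform Th u u) /\
     bform sides Th (fun=> u) (fun=> u) <= C * h * (A + gform Th u u)]].
Proof.
move=> k1 K1 hOmega; have K0 : 0 < K by exact: lt_le_trans K1.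
have [C0 C0_gt0 HC] := FE_oscillation k K1.
have [M0 HM0] := bad_edges_bounded hOmega K1.
pose M := Num.max 1 M0; have M1 : 1 <= M by rewrite le_max lexx.
pose n : R := (size sides)%:R; have n0 : 0 <= n by [].
pose c2 := (1 + M) / (8 * K) + 4 * flux_beta K (384 * K * M)^-1.
have c2_ge0 : 0 <= c2.
  have KM : 0 < K * M by rewrite mulr_gt0// (lt_le_trans _ M1).
  have e0 : 0 < (384 * K * M)^-1 by rewrite invr_gt0 -mulrA; lra.
  rewrite /c2 /flux_beta; move: (_^-1) e0 => e e0.
  have h1 : 0 <= (1 + M) / (8 * K) by rewrite divr_ge0 ?mulr_ge0 ?(ltW K0)//; lra.
  have h2 : 0 <= 9 * K ^+ 2 / e by rewrite divr_ge0 ?mulr_ge0 ?sqr_ge0// ltW.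
  have h3 := sqr_ge0 K; move: ((1 + M) / _) (9 * _ / e) h1 h2 => x y h1 h2; lra.
(* One constant for all conclusions: the summands pay for the oscillations lost in the flux, for the
   inverse estimate, and for the energy and trace bounds; 1 makes it positive. *)
pose C := n * c2 * C0 + 4 * n * C0 + (2304 * K ^+ 4 + 8) * (1 + n * C0) + 1.
have nC0 : 0 <= n * C0 by rewrite mulr_ge0// ltW.
have ncC : 0 <= n * c2 * C0 by rewrite mulrAC mulr_ge0.
have K4 : 0 <= K ^+ 4 by rewrite exprn_ge0// ltW.
have K4n : 0 <= K ^+ 4 * (n * C0) by rewrite mulr_ge0.
exists (16 * K * (1 + 3 * M))^-1, C; split.
- rewrite invr_gt0 mulr_gt0//; [by rewrite mulr_gt0|lra].
- by rewrite /C; lra.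
move=> Th h ctr hTh h0 hdiam hball resolved.
have bad s : s \in sides -> (size [seq T <- Th | `[< edge_on s T /\ bad_edge Omega s T >]])%:R <= M.
  by move=> ss; rewrite le_max (HM0 Th h ctr)// orbT.
split=> [v Vv|u Vu].
  have [b [b0 osc odn HD]] := HC Omega sides Th h ctr hOmega hTh h0 hdiam hball v Vv.
  apply: le_trans (dnormal_bound hOmega hTh h0 K1 hdiam hball Vv odn) _.
  rewrite [leRHS]mulrAC; apply: ler_wpM2r; first by rewrite invr_ge0 ltW.
  apply: le_trans (ler_wpM2l _ HD) _; first by rewrite mulr_ge0.
  rewrite mulrA; apply: ler_wpM2r; first exact: gform_ge0.
  by rewrite -/n /C; lra.
have [b [b0 osc odn HD]] := HC Omega sides Th h ctr hOmega hTh h0 hdiam hball u Vu.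
pose D := \sum_(T <- Th) b T ^+ 2.
pose A := \sum_(s <- sides) \sum_(T <- side_elements Th s) edge_value u s T ^+ 2.
have A0 : 0 <= A by do 2 (apply: sumr_ge0 => ? _); exact: sqr_ge0.
have G0 := gform_ge0 Th u.
have nD : n * D <= n * C0 * gform Th u u by rewrite -mulrA; apply: ler_wpM2l.
exists (interp Th (bnd_value Omega u)), A; split => //.
- exact: (interp_FE hTh k1 (bnd_value Omega u)).
- apply: (@le_trans _ _ ((16 * K * (1 + 3 * M))^-1 * A - n * c2 * D)).
    have := ler_wpM2l c2_ge0 nD; have := mulr_ge0 K4n G0; have := mulr_ge0 K4 G0; have := mulr_ge0 nC0 G0.
    by rewrite /C; lra.
  have -> : n * c2 * D = \sum_(s <- sides) c2 * D.
    by rewrite big_const_seq iter_addr_0 count_predT -mulr_natl mulrA.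
  rewrite mulrC /A mulr_suml -sumrB.
  rewrite /bform big_seq [leRHS]big_seq; apply: ler_sum => s ss.
  exact: (flux_side hOmega hTh h0 K1 k1 hdiam hball M1 bad resolved Vu b0 osc erefl erefl ss).
- apply: le_trans (interp_energy_bound hOmega hTh h0 K1 k1 hdiam hball osc) _.
  have := mulr_ge0 nC0 A0; have := mulr_ge0 K4n A0; have := mulr_ge0 K4 A0; have := mulr_ge0 ncC A0.
  have := mulr_ge0 nC0 G0; have := mulr_ge0 K4n G0; have := mulr_ge0 K4 G0; have := mulr_ge0 ncC G0.
  by have := ler_wpM2l K4 nD; rewrite -/D -/A -/n /C; lra.
have H : 8 * h * (A + n * D) <= C * h * (A + gform Th u u).
  rewrite ![_ * h]mulrC -!mulrA; apply: ler_wpM2l; first exact: ltW.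
  have := mulr_ge0 nC0 A0; have := mulr_ge0 K4n A0; have := mulr_ge0 K4 A0; have := mulr_ge0 ncC A0.
  have := mulr_ge0 nC0 G0; have := mulr_ge0 K4n G0; have := mulr_ge0 K4 G0; have := mulr_ge0 ncC G0.
  by rewrite /C; lra.
split; apply: le_trans H.
  exact: (interp_trace_bound hOmega hTh h0 K1 k1 hdiam hball b0 osc).
exact: (trace_bound hOmega hTh h0 K1 hdiam hball Vu osc).
Qed.

(** * Stability *)

Lemma young (R : realFieldType) (t X Y e : R) : 0 < e -> 0 <= X -> 0 <= Y -> t ^+ 2 <= X * Y ->
  `|t| <= e * Y + X / (4 * e).
Proof.
move=> e0 X0 Y0 H.
have b0 : 0 <= e * Y + X / (4 * e) by rewrite addr_ge0 ?mulr_ge0 ?invr_ge0 ?mulr_ge0// ltW.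
rewrite -(ler_pXn2r (n := 2)) ?nnegrE// real_normK ?num_real//; apply: le_trans H _.
rewrite -subr_ge0 (_ : _ - _ = (e * Y - X / (4 * e)) ^+ 2) ?sqr_ge0//.
by field; rewrite gt_eqF.
Qed.

Lemma Rintegral_eq0 d (T : measurableType d) (R : realType) (mu : {measure set T -> \bar R}) (D : set T) (f : T -> R) :
  (forall x, D x -> f x = 0) -> \int[mu]_(x in D) f x = 0.
Proof.
move=> H; rewrite /Rintegral (eq_integral (cst 0%E)) ?integral0// => x.
by rewrite inE => /H ->.
Qed.

Section Stability.
Variables (R : realType) (Omega : set (R * R)) (sides : seq (side R)) (k : nat).
Variables (Th : seq (triangle R)) (h : R) (L : set (R * R -> R)).
Hypothesis hOmega : polygonal_domain Omega sides.
Hypothesis hTh : triangulation Omega sides Th.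
Hypotheses (h0 : 0 < h).
Hypothesis hdiam : forall T, T \in Th -> diam T <= h.
Hypothesis hL : multiplier_space sides L.
Variables (gamma zeta : R).
Hypotheses (gamma0 : 0 < gamma) (zeta0 : 0 < zeta).
Notation V := (FE_space k Omega Th).
Notation mu := (@lebesgue_measure R).
Implicit Types (u v w l m z : R * R -> R) (a : R).

Local Notation B := (bform sides Th).
Local Notation tr l := (fun _ : side R => l).

Lemma gform_comb_le u w a : V u -> V w ->
  gform Th (fun x => u x + a * w x) (fun x => u x + a * w x) <= 2 * (gform Th u u + a ^+ 2 * gform Th w w).
Proof.
move=> Vu Vw.
have E b : gform Th (fun x => u x + b * w x) (fun x => u x + b * w x) =
    gform Th u u + 2 * b * gform Th u w + b ^+ 2 * gform Th w w.
  have Vc := FE_comb b Vu Vw.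
  rewrite (gform_comb hOmega hTh b Vu Vw Vc) (gformC Th u) (gformC Th w).
  rewrite (gform_comb hOmega hTh b Vu Vw Vu) (gform_comb hOmega hTh b Vu Vw Vw) (gformC Th w u).
  by move: (gform Th u u) (gform Th u w) (gform Th w w) => x y z; ring.
have := gform_ge0 Th (fun x => u x + - a * w x); rewrite !E.
move: (gform Th u u) (gform Th u w) (gform Th w w) => x y z; lra.
Qed.

Lemma bform_comb_sqr_le f g a : bL2 sides Th f -> bL2 sides Th g ->
  B (fun s x => f s x + a * g s x) (fun s x => f s x + a * g s x) <= 2 * (B f f + a ^+ 2 * B g g).
Proof.
move=> Lf Lg.
have E b : B (fun s x => f s x + b * g s x) (fun s x => f s x + b * g s x) =
    B f f + 2 * b * B f g + b ^+ 2 * B g g.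
  have Lc := bL2_comb b Lf Lg.
  rewrite (bform_comb b Lf Lg Lc) (bformC sides Th f) (bformC sides Th g).
  rewrite (bform_comb b Lf Lg Lf) (bform_comb b Lf Lg Lg) (bformC sides Th g f).
  by move: (B f f) (B f g) (B g g) => x y z; ring.
have := bform_ge0 sides Th (fun s x => f s x + - a * g s x); rewrite !E.
move: (B f f) (B f g) (B g g) => x y z; lra.
Qed.

Lemma bformZ f g a : bL2 sides Th f -> bL2 sides Th g -> B (fun s x => a * f s x) g = a * B f g.
Proof.
move=> Lf Lg; rewrite /bform mulr_sumr big_seq [RHS]big_seq; apply: eq_bigr => s ss.
rewrite mulrCA; congr (_ * _); have mD := measurable_bnd_dom Th s.
have If := @sqintM _ _ _ mu _ mD _ _ (Lf s ss) (Lg s ss).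
rewrite /ip -(@RintegralZl _ _ _ mu _ _ _ mD If).
by apply: eq_Rintegral => t _; rewrite mulrA.
Qed.

Lemma bformZZ f a : bL2 sides Th f -> B (fun s x => a * f s x) (fun s x => a * f s x) = a ^+ 2 * B f f.
Proof.
move=> Lf; have Lz : bL2 sides Th (fun s x => a * f s x).
  by move=> s ss; apply: sqintZ; [exact: measurable_bnd_dom|exact: Lf].
by rewrite (bformZ a Lf Lz) bformC (bformZ a Lf Lf) mulrA expr2.
Qed.

(** The quantity controlled by the stabilisation. Since l is recovered as the defect minus the
    normal derivative, it replaces l as an unknown in all estimates. *)
Definition defect u l (s : side R) x : R := l x + dnormal u s x.
Local Notation nu := defect.

Let Ltr u : V u -> bL2 sides Th (tr u). Proof. exact: trace_bL2. Qed.
Let Ldn u : V u -> bL2 sides Th (dnormal u). Proof. by move=> Vu; exact: (dnormal_bL2 hOmega hTh h0 hdiam Vu). Qed.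
Let Lmul l : L l -> bL2 sides Th (tr l). Proof. exact: multiplier_bL2. Qed.

Lemma defect_bL2 u l : V u -> L l -> bL2 sides Th (nu u l).
Proof.
move=> Vu Ll; have := bL2_comb 1 (Lmul Ll) (Ldn Vu).
by apply: bL2_eq => s t _ _; rewrite mul1r.
Qed.

Lemma A_BHE u l v m : V u -> L l -> V v -> L m -> A_BH Omega sides gamma h u l v m =
  gform Th u v + B (tr l) (tr v) - B (tr m) (tr u) + gamma * (h * B (nu u l) (nu v m)).
Proof.
move=> Vu Ll Vv Lm; rewrite /A_BH (gformE hOmega hTh Vu Vv).
rewrite (bformE sides Th (tr l) (tr v)) (bformE sides Th (tr m) (tr u)); congr (_ + gamma * _).
rewrite (bformE sides Th (fun s x => h * nu u l s x) (nu v m)).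
exact: bformZ (defect_bL2 Vu Ll) (defect_bL2 Vv Lm).
Qed.

Lemma defect_comb u l w z a f : V u -> L l -> V w -> L z -> bL2 sides Th f ->
  B f (nu (fun x => u x + a * w x) (fun x => l x + a * z x)) = B f (nu u l) + a * B f (nu w z).
Proof.
move=> Vu Ll Vw Lz Lf; rewrite bformC.
rewrite -(bformC sides Th (nu u l)) -(bformC sides Th (nu w z)).
rewrite -(bform_comb a (defect_bL2 Vu Ll) (defect_bL2 Vw Lz) Lf).
apply: bform_eq => // s t ss Dt; rewrite /defect (dnormal_comb hOmega hTh h0 hdiam a ss Dt Vu Vw).
ring.
Qed.

Lemma A_BH_comb u l v m w z a : V u -> L l -> V v -> L m -> V w -> L z ->
  A_BH Omega sides gamma h u l (fun x => v x + a * w x) (fun x => m x + a * z x) =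
  A_BH Omega sides gamma h u l v m + a * A_BH Omega sides gamma h u l w z.
Proof.
move=> Vu Ll Vv Lm Vw Lz.
rewrite !A_BHE//; [|exact: FE_comb|exact: (multiplier_comb a hL)].
rewrite (defect_comb a Vv Lm Vw Lz (defect_bL2 Vu Ll)).
rewrite gformC (gform_comb hOmega hTh a Vv Vw Vu) !(gformC Th _ u).
rewrite (bformC sides Th (tr l)) (bform_comb a (Ltr Vv) (Ltr Vw) (Lmul Ll)) !(bformC sides Th _ (tr l)).
rewrite (bform_comb a (Lmul Lm) (Lmul Lz) (Ltr Vu)).
move: (gform Th u v) (gform Th u w) (B (tr l) (tr v)) (B (tr l) (tr w)) (B (tr m) (tr u)) (B (tr z) (tr u))
  (B (nu u l) (nu v m)) (B (nu u l) (nu w z)).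
by move=> x1 x2 x3 x4 x5 x6 x7 x8; ring.
Qed.

(** The two coupling terms are skew and cancel on the diagonal, so testing with the pair itself
    controls neither the trace of u nor a constant u. *)
Lemma A_BH_diag u l : V u -> L l ->
  A_BH Omega sides gamma h u l u l = gform Th u u + gamma * (h * B (nu u l) (nu u l)).
Proof. by move=> Vu Ll; rewrite A_BHE// addrK. Qed.

Lemma grad_normE u : V u -> grad_norm Omega u = Num.sqrt (gform Th u u).
Proof. by move=> Vu; rewrite /grad_norm (gformE hOmega hTh Vu Vu). Qed.

Lemma bnd_norm_scaled a f : bL2 sides Th (tr f) ->
  bnd_norm sides (fun x => a * f x) = Num.sqrt (a ^+ 2 * B (tr f) (tr f)).
Proof.
move=> Lf; rewrite /bnd_norm; congr Num.sqrt; rewrite -(bformZZ a Lf) -bformE.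
by congr bnd_int; apply/funext => s; apply/funext => x; rewrite expr2.
Qed.

Lemma norm_LhE l : L l -> norm_Lh sides h l = Num.sqrt (h * B (tr l) (tr l)).
Proof. by move=> Ll; rewrite /norm_Lh bnd_norm_scaled ?sqr_sqrtr ?(ltW h0)//; exact: Lmul. Qed.

Lemma norm_1hE u : V u ->
  norm_1h Omega sides zeta h u = Num.sqrt (gform Th u u + zeta * (h^-1 * B (tr u) (tr u))).
Proof.
move=> Vu; rewrite /norm_1h grad_normE// sqr_sqrtr ?gform_ge0//; congr (Num.sqrt (_ + _ * _)).
rewrite bnd_norm_scaled; last exact: Ltr.
rewrite sqr_sqrtr; last by rewrite mulr_ge0 ?bform_ge0// sqr_ge0.
by rewrite exprVn sqr_sqrtr// ltW.
Qed.

(** A zero pair has v = 0 on the open set Omega only; continuity up to the closure extends this to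
    the boundary. *)
Lemma pair_zero_forms v m : V v -> L m -> Defs.pair_zero Omega sides v m ->
  [/\ gform Th v v = 0, B (tr v) (tr v) = 0 & B (tr m) (tr m) = 0].
Proof.
move=> Vv Lm [v0 m0].
have oOmega : open Omega by case: hOmega => -[].
have cv0 x : closure Omega x -> v x = 0.
  move=> Ox; apply/eqP; apply: contrapT => /negP vx.
  have /subspace_continuousP /(_ x Ox) C := Vv.1.
  have : \forall y \near v x, y != 0 by exact: open_neq.
  move=> /C; rewrite /= /within /= => N.
  have [y [Oy Ny]] := Ox _ N.
  have : v y != 0 by exact: Ny (subset_closure Oy).
  by rewrite v0// eqxx.
split.
- rewrite -(gformE hOmega hTh Vv Vv) /domain_int; apply: Rintegral_eq0 => x Ox.
  have N : \forall y \near x, v y = cst 0 y by apply: filterS (oOmega x Ox) => y; exact: v0.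
  by rewrite /grad !(near_eq_derive _ N) !derive_cst /dot /= !mul0r addr0.
- rewrite (bform_eq (f' := fun _ _ => 0) (g' := fun _ _ => 0)).
    by rewrite /bform big1// => s _; rewrite /ip Rintegral_eq0 ?mulr0// => t _; rewrite mul0r.
  + move=> s t ss [t01 _]; apply: cv0.
    by apply: (closed_side_boundary hOmega ss _).1; exists t.
  + move=> s t ss [t01 _]; apply: cv0.
    by apply: (closed_side_boundary hOmega ss _).1; exists t.
rewrite /bform big_seq big1// => s ss; have [N [mN N0 HN]] := m0 s ss.
rewrite /ip [X in _ * X](_ : _ = 0) ?mulr0//.
have D1 : bnd_dom Th s `\` N `<=` bnd_dom Th s by move=> t [].
have D2 : bnd_dom Th s `\` (bnd_dom Th s `\` N) `<=` N.
  by move=> t [Dt nt]; apply: contrapT => Nt; apply: nt.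
have := @integral_null _ _ _ mu _ _ _ (fun t => (m (side_point s t) * m (side_point s t))%:E) D1 D2 mN N0.
move=> /(congr1 (@fine R)) E; rewrite /Rintegral E -/(Rintegral _ _ _).
apply: Rintegral_eq0 => t [[t01 _] Nt]; rewrite (_ : m _ = 0) ?mul0r//.
by apply: contrapT => mt; apply: Nt; apply: HN => H; apply: mt; exact: H.
Qed.

End Stability.

Lemma addr3_eq0 (R : realDomainType) (x y z : R) : 0 <= x -> 0 <= y -> 0 <= z -> x + y + z = 0 -> x = 0 /\ y = 0.
Proof. by move=> x0 y0 z0 H; split; lra. Qed.

(** * Constants of the stability estimate *)

Section Constants.
Variable R : realType.
Variables c C Cz cz gamma zeta : R.

(* The test pair is (u + mixing * w, l + mixing * z), where w comes from
   [test_function] and z lifts w through the multiplier assumption. *)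
Definition coupling_cst : R := C + c / 2 +
  3 / c * (2 * C + C ^+ 2 + Cz ^+ 2 * C + gamma ^+ 2 * cz ^+ 2 * C + gamma ^+ 2 * C ^+ 2).
(** Chosen so that [mixing * coupling_cst] is half of [Num.min 1 gamma]: the loss caused by the
    second test pair is absorbed by half of the diagonal. *)
Definition mixing : R := Num.min 1 gamma / (2 * coupling_cst).
Definition coercivity_cst : R := Num.min (Num.min 1 gamma / 2) (mixing * c / 2).
Definition norm_cst : R := 6 + 4 * C + 2 * mixing ^+ 2 * C + 2 * zeta * C * (1 + mixing ^+ 2)
  + 2 * mixing ^+ 2 * cz ^+ 2 * C.

Hypotheses (c0 : 0 < c) (C0 : 0 < C) (Cz0 : 0 < Cz) (cz0 : 0 < cz) (gamma0 : 0 < gamma) (zeta0 : 0 < zeta).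

Lemma coupling_cst_gt0 : 0 < coupling_cst.
Proof.
rewrite /coupling_cst !addr_gt0 ?divr_gt0// mulr_gt0 ?divr_gt0//.
by rewrite !addr_gt0// ?mulr_gt0// ?exprn_gt0.
Qed.

Lemma mixing_gt0 : 0 < mixing.
Proof. by rewrite divr_gt0 ?lt_min ?ltr01// mulr_gt0// coupling_cst_gt0. Qed.

Lemma coercivity_cst_gt0 : 0 < coercivity_cst.
Proof. by rewrite lt_min !divr_gt0 ?lt_min ?ltr01//= mulr_gt0// mixing_gt0. Qed.

Lemma norm_cst_gt0 : 0 < norm_cst.
Proof.
rewrite /norm_cst; have m2 := sqr_ge0 mixing; move: (mixing ^+ 2) m2 => m m2.
have Cg := ltW C0; have zg := ltW zeta0; have z2 := sqr_ge0 cz; move: (cz ^+ 2) z2 => z z2.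
have h1 := mulr_ge0 m2 Cg; have h2 := mulr_ge0 zg Cg; have h3 := mulr_ge0 h2 m2.
have h4 := mulr_ge0 (mulr_ge0 m2 z2) Cg; lra.
Qed.

(** Six mixed terms are split by Young's inequality, each spending c / 12 of A + G at the price 3 /
    c times a multiple of G or S. Together they use half of the c * A offered by the flux F. *)
Lemma coupling_arith (G A S W t1 t2 t3 t4 t5 t6 tz F : R) : 0 <= G -> 0 <= A -> 0 <= S -> 
  W <= C * (A + G) -> t1 ^+ 2 <= G * W -> t2 ^+ 2 <= S * C * (A + G) -> t3 ^+ 2 <= C ^+ 2 * G * (A + G) ->
  t4 ^+ 2 <= Cz ^+ 2 * G * W -> t5 ^+ 2 <= S * cz ^+ 2 * W -> t6 ^+ 2 <= S * C * W ->
  tz <= t4 -> c * A - C * G <= F ->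
  c / 2 * A - coupling_cst * (G + S) <= t1 + (t2 - t3) - (tz - F) + gamma * (t5 + t6).
Proof.
move=> G0 A0 S0 HW H1 H2 H3 H4 H5 H6 Hz HF.
have Y0 : 0 <= A + G by exact: addr_ge0.
have e0 : 0 < c / 12 by rewrite divr_gt0.
have young6 t X : 0 <= X -> t ^+ 2 <= X * (A + G) -> `|t| <= c / 12 * (A + G) + 3 / c * X.
  move=> X0 /(young e0 X0 Y0); rewrite (_ : X / (4 * (c / 12)) = 3 / c * X)//.
  by field; rewrite gt_eqF.
have sub X t : 0 <= X -> t ^+ 2 <= X * W -> t ^+ 2 <= X * C * (A + G).
  by move=> X0 H; apply: le_trans H _; rewrite -mulrA; exact: ler_wpM2l.
have C2 := sqr_ge0 C; have Cz2 := sqr_ge0 Cz; have cz2 := sqr_ge0 cz; have g2 := sqr_ge0 gamma.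
have y1 := young6 t1 (G * C) (mulr_ge0 G0 (ltW C0)) (sub _ _ G0 H1).
have y2 := young6 t2 (S * C) (mulr_ge0 S0 (ltW C0)) H2.
have y3 := young6 t3 (C ^+ 2 * G) (mulr_ge0 C2 G0) H3.
have CG := mulr_ge0 Cz2 G0.
have y4 := young6 t4 (Cz ^+ 2 * G * C) (mulr_ge0 CG (ltW C0)) (sub _ _ CG H4).
have Scz := mulr_ge0 S0 cz2.
have y5 : `|gamma * t5| <= c / 12 * (A + G) + 3 / c * (gamma ^+ 2 * (S * cz ^+ 2 * C)).
  apply: young6; first by rewrite !mulr_ge0// ltW.
  by rewrite exprMn -[leRHS]mulrA; apply: ler_wpM2l => //; exact: sub.
have SC := mulr_ge0 S0 (ltW C0).
have y6 : `|gamma * t6| <= c / 12 * (A + G) + 3 / c * (gamma ^+ 2 * (S * C * C)).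
  apply: young6; first by rewrite !mulr_ge0// ltW.
  by rewrite exprMn -[leRHS]mulrA; apply: ler_wpM2l => //; exact: sub.
have i0 : 0 <= 3 / c by rewrite divr_ge0// ltW.
have cr1 := mulr_ge0 i0 (mulr_ge0 S0 (ltW C0)); have cr2 := mulr_ge0 i0 (mulr_ge0 G0 (ltW C0)).
have cr3 := mulr_ge0 i0 (mulr_ge0 C2 S0).
have cr4 := mulr_ge0 i0 (mulr_ge0 (mulr_ge0 Cz2 S0) (ltW C0)).
have cr5 := mulr_ge0 i0 (mulr_ge0 (mulr_ge0 (mulr_ge0 g2 cz2) G0) (ltW C0)).
have cr6 := mulr_ge0 i0 (mulr_ge0 (mulr_ge0 g2 C2) G0).
have cr7 := mulr_ge0 (ltW C0) S0; have cr8 := mulr_ge0 (ltW c0) S0.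
have n1 := lerNnormlW y1; have n2 := lerNnormlW y2; have n3 := ler_normlW y3.
have n4 := ler_normlW y4; have n5 := lerNnormlW y5; have n6 := lerNnormlW y6.
rewrite /coupling_cst; move: (3 / c) i0 n1 n2 n3 n4 n5 n6 cr1 cr2 cr3 cr4 cr5 cr6 => i i0 n1 n2 n3 n4 n5 n6 cr1 cr2 cr3 cr4 cr5 cr6.
rewrite mulrDr; lra.
Qed.

Lemma coercivity_arith (G A S T : R) : 0 <= G -> 0 <= A -> 0 <= S ->
  c / 2 * A - coupling_cst * (G + S) <= T ->
  coercivity_cst * (G + S + A) <= G + gamma * S + mixing * T.
Proof.
move=> G0 A0 S0 H.
set m := Num.min 1 gamma.
have mG : m * G <= G by rewrite -[leRHS]mul1r; apply: ler_wpM2r => //; rewrite ge_min lexx.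
have mS : m * S <= gamma * S by apply: ler_wpM2r => //; rewrite ge_min lexx orbT.
have MT := ler_wpM2l (ltW mixing_gt0) H.
have E : mixing * (coupling_cst * (G + S)) = m / 2 * (G + S).
  by rewrite /mixing -/m; field; rewrite gt_eqF// coupling_cst_gt0.
have k1 : coercivity_cst * (G + S) <= m / 2 * (G + S).
  by apply: ler_wpM2r; [exact: addr_ge0|rewrite ge_min lexx].
have k2 : coercivity_cst * A <= mixing * c / 2 * A.
  by apply: ler_wpM2r => //; rewrite ge_min lexx orbT.
rewrite mulrBr E in MT; move: MT k1 k2 mG mS; move: (coercivity_cst) (mixing) => x y; lra.
Qed.

Lemma norm_arith (G S A Gw Bu Bw Bl Bz Gv Bv Bm : R) : 0 <= G -> 0 <= S -> 0 <= A ->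
  Gw <= C * (A + G) -> Bu <= C * (A + G) -> Bw <= C * (A + G) ->
  Bl <= 2 * (S + C * G) -> Bz <= cz ^+ 2 * Gw -> Gv <= 2 * (G + mixing ^+ 2 * Gw) ->
  Bv <= 2 * (Bu + mixing ^+ 2 * Bw) -> Bm <= 2 * (Bl + mixing ^+ 2 * Bz) ->
  [/\ G + zeta * Bu <= norm_cst * (G + S + A), Bl <= norm_cst * (G + S + A),
      Gv + zeta * Bv <= norm_cst * (G + S + A) & Bm <= norm_cst * (G + S + A)].
Proof.
move=> G0 S0 A0 HGw HBu HBw HBl HBz HGv HBv HBm.
rewrite /norm_cst; have m0 := sqr_ge0 mixing; move: (mixing ^+ 2) m0 HGv HBv HBm => m m0 HGv HBv HBm.
have y0 := sqr_ge0 cz; move: (cz ^+ 2) y0 HBz => y y0 HBz.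
have Cg := ltW C0; have zg := ltW zeta0.
have X0 : 0 <= G + S + A by rewrite !addr_ge0.
have AX : A + G <= G + S + A by lra.
have CX := ler_wpM2l Cg AX.
have GX : G <= G + S + A by lra.
have SX : S <= G + S + A by lra.
have CG := ler_wpM2l Cg GX.
move: (G + S + A) X0 CX GX SX CG => X X0 CX GX SX CG.
have {}HGw := le_trans HGw CX; have {}HBu := le_trans HBu CX; have {}HBw := le_trans HBw CX.
have CX0 := mulr_ge0 Cg X0; have zCX0 := mulr_ge0 zg CX0; have mCX0 := mulr_ge0 m0 CX0.
have zmCX0 := mulr_ge0 zg mCX0; have ymCX0 := mulr_ge0 y0 mCX0.
have k1 := ler_wpM2l zg HBu; have k2 := ler_wpM2l zg HBv; have k3 := ler_wpM2l (mulr_ge0 zg m0) HBw.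
have k4 := ler_wpM2l m0 HGw; have k5 := ler_wpM2l m0 HBz; have k6 := ler_wpM2l (mulr_ge0 m0 y0) HGw.
split; lra.
Qed.

End Constants.

(** * The inf-sup estimate on one mesh *)

Section InfSup.
Variables (R : realType) (Omega : set (R * R)) (sides : seq (side R)) (k : nat).
Variables (Th : seq (triangle R)) (h : R) (L : set (R * R -> R)).
Hypothesis hOmega : polygonal_domain Omega sides.
Hypothesis hTh : triangulation Omega sides Th.
Hypotheses (h0 : 0 < h).
Hypothesis hdiam : forall T, T \in Th -> diam T <= h.
Hypothesis hL : multiplier_space sides L.
Variables (c C Cz cz gamma zeta : R).
Hypotheses (c0 : 0 < c) (C0 : 0 < C) (Cz0 : 0 < Cz) (cz0 : 0 < cz) (gamma0 : 0 < gamma) (zeta0 : 0 < zeta).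
Notation V := (FE_space k Omega Th).
Implicit Types (u v w l m z : R * R -> R) (a : R).
Hypothesis hM : multiplier_assumption Omega sides h V L Cz cz.
Local Notation B := (bform sides Th).
Local Notation tr l := (fun _ : side R => l).
Local Notation nu := defect.
Local Notation G := (gform Th).
Hypothesis hInv : forall v, V v -> B (dnormal v) (dnormal v) <= C / h * G v v.

Let Ltr u : V u -> bL2 sides Th (tr u). Proof. exact: trace_bL2. Qed.
Let Ldn u : V u -> bL2 sides Th (dnormal u).
Proof. by move=> Vu; exact: (dnormal_bL2 hOmega hTh h0 hdiam Vu). Qed.
Let Lmul l : L l -> bL2 sides Th (tr l). Proof. exact: multiplier_bL2. Qed.
Let Lnu u l : V u -> L l -> bL2 sides Th (nu u l).
Proof. by move=> Vu Ll; exact: (defect_bL2 hOmega hTh h0 hdiam hL Vu Ll). Qed.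

Lemma multiplier_lift w : V w -> exists z, [/\ L z,
  forall u, V u -> B (tr u) (nu w z) <= Cz * Num.sqrt (G u u) * Num.sqrt (G w w) &
  h * B (tr z) (tr z) <= cz ^+ 2 * G w w].
Proof.
move=> Vw; have [z Lz [H1 H2]] := hM Vw; exists z; split => //.
  move=> u Vu; have := H1 u Vu; rewrite (grad_normE hOmega hTh Vu) (grad_normE hOmega hTh Vw).
  rewrite (bformE sides Th (tr u) (fun s x => dnormal w s x + z x)).
  rewrite (_ : (fun s x => dnormal w s x + z x) = nu w z)//.
  by apply/funext => s; apply/funext => x; rewrite /defect addrC.
move: H2; rewrite (grad_normE hOmega hTh Vw) (bnd_norm_scaled _ (Lmul Lz)) sqr_sqrtr ?(ltW h0)// => H2.
have hB : 0 <= h * B (tr z) (tr z) by rewrite mulr_ge0 ?bform_ge0// ltW.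
have := lerXn2r 2 _ _ H2; rewrite !nnegrE sqrtr_ge0 mulr_ge0 ?sqrtr_ge0 ?(ltW cz0)//.
by rewrite exprMn !sqr_sqrtr ?gform_ge0//; apply.
Qed.

(** Eliminating l and z in favour of the defects produces the flux with a plus sign. The remaining
    terms pair the energy of u or its defect with a norm of w or z, except the integral of u against
    the defect of w, which the lift bounds. *)
Lemma coupling u l w z A : V u -> L l -> V w -> L z -> 0 <= A ->
  c * A - C * G u u <= B (tr u) (dnormal w) ->
  G w w <= C * (A + G u u) -> B (tr w) (tr w) <= C * h * (A + G u u) ->
  B (tr u) (nu w z) <= Cz * Num.sqrt (G u u) * Num.sqrt (G w w) ->
  h * B (tr z) (tr z) <= cz ^+ 2 * G w w ->
  c / 2 * A - coupling_cst c C Cz cz gamma * (G u u + h * B (nu u l) (nu u l)) <=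
  A_BH Omega sides gamma h u l w z.
Proof.
move=> Vu Ll Vw Lz A0 HF HW HB H4 Hz.
have Lul := Lnu Vu Ll; have Lwz := Lnu Vw Lz.
rewrite (A_BHE hOmega hTh h0 hdiam hL gamma Vu Ll Vw Lz).
have E1 : B (tr l) (tr w) = B (nu u l) (tr w) - B (dnormal u) (tr w).
  have := bform_comb (-1) Lul (Ldn Vu) (Ltr Vw); rewrite mulN1r => <-.
  by apply: bform_eq => // s t _ _; rewrite /defect mulN1r addrK.
have E2 : B (tr z) (tr u) = B (tr u) (nu w z) - B (tr u) (dnormal w).
  rewrite (bformC _ _ (tr z)) !(bformC _ _ (tr u)).
  have := bform_comb (-1) Lwz (Ldn Vw) (Ltr Vu); rewrite mulN1r => <-.
  by apply: bform_eq => // s t _ _; rewrite /defect mulN1r addrK.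
have E3 : h * B (nu u l) (nu w z) = h * B (nu u l) (tr z) + h * B (nu u l) (dnormal w).
  rewrite -mulrDr !(bformC _ _ (nu u l)).
  have := bform_comb 1 (Lmul Lz) (Ldn Vw) Lul; rewrite mul1r => <-.
  by congr (_ * _); apply: bform_eq => // s t _ _; rewrite /defect mul1r.
rewrite E1 E2 E3.
have G0 := gform_ge0 Th u; have W0 := gform_ge0 Th w.
have S0 : 0 <= h * B (nu u l) (nu u l) by rewrite mulr_ge0 ?bform_ge0// ltW.
have ch1 := gform_cauchy hOmega hTh Vu Vw.
have ch2 := bform_cauchy Lul (Ltr Vw); have ch3 := bform_cauchy (Ldn Vu) (Ltr Vw).
have ch5 := bform_cauchy Lul (Lmul Lz); have ch6 := bform_cauchy Lul (Ldn Vw).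
have nn := bform_ge0 sides Th (nu u l).
have iu := hInv Vu; have iw := hInv Vw.
apply: (@coupling_arith R c C Cz cz gamma c0 C0 cz0 gamma0 (G u u) A (h * B (nu u l) (nu u l)) (G w w)
  (G u w) (B (nu u l) (tr w)) (B (dnormal u) (tr w)) (Cz * Num.sqrt (G u u) * Num.sqrt (G w w))
  (h * B (nu u l) (tr z)) (h * B (nu u l) (dnormal w)) (B (tr u) (nu w z)) (B (tr u) (dnormal w))
  G0 A0 S0 HW ch1 _ _ _ _ _ H4 HF).
- apply: le_trans ch2 _; apply: le_trans (ler_wpM2l nn HB) _.
  by move: (B _ _) (G u u) => x y; rewrite le_eqVlt; apply/orP; left; apply/eqP; ring.
- apply: le_trans ch3 _; apply: le_trans (ler_pM (bform_ge0 _ _ _) (bform_ge0 _ _ _) iu HB) _.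
  by move: (G u u) => x; rewrite le_eqVlt; apply/orP; left; apply/eqP; field; rewrite gt_eqF.
- by move: (G u u) (G w w) G0 W0 => x y x0 y0; rewrite !exprMn (sqr_sqrtr x0) (sqr_sqrtr y0).
- rewrite exprMn; apply: le_trans (ler_wpM2l (sqr_ge0 h) ch5) _.
  rewrite -[leRHS]mulrA; apply: le_trans (ler_wpM2l S0 Hz).
  by move: (B _ _) (B _ _) => x y; rewrite le_eqVlt; apply/orP; left; apply/eqP; ring.
- rewrite exprMn; apply: le_trans (ler_wpM2l (sqr_ge0 h) ch6) _.
  apply: le_trans (ler_wpM2l (sqr_ge0 h) (ler_wpM2l nn iw)) _.
  by move: (B _ _) (G w w) => x y; rewrite le_eqVlt; apply/orP; left; apply/eqP; field; rewrite gt_eqF.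
Qed.

Lemma norms_le v m X : V v -> L m ->
  G v v + zeta * (h^-1 * B (tr v) (tr v)) <= X -> h * B (tr m) (tr m) <= X ->
  norm_1h Omega sides zeta h v + norm_Lh sides h m <= 2 * Num.sqrt X.
Proof.
move=> Vv Lm H1 H2; rewrite (norm_1hE hOmega hTh h0 zeta Vv) (norm_LhE Th h0 hL Lm).
by rewrite mulr2n mulrDl mul1r; apply: lerD; exact: ler_wsqrtr.
Qed.

(** l is the defect minus the normal derivative, and the inverse estimate bounds the latter. *)
Lemma multiplier_le u l : V u -> L l ->
  h * B (tr l) (tr l) <= 2 * (h * B (nu u l) (nu u l) + C * G u u).
Proof.
move=> Vu Ll; have := bform_comb_sqr_le (-1) (Lnu Vu Ll) (Ldn Vu).
rewrite (bform_eq (f' := tr l) (g' := tr l)); last first.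
- by move=> s t _ _; rewrite /defect mulN1r addrK.
- by move=> s t _ _; rewrite /defect mulN1r addrK.
rewrite sqrrN expr1n mul1r => H; apply: le_trans (ler_wpM2l (ltW h0) H) _.
rewrite mulrCA; apply: ler_wpM2l => //; rewrite mulrDr lerD2l.
apply: le_trans (ler_wpM2l (ltW h0) (hInv Vu)) _.
by rewrite le_eqVlt; apply/orP; left; apply/eqP; field; rewrite gt_eqF.
Qed.

Lemma A_BH_null u l v m : V u -> L l -> V v -> L m ->
  G u u * G v v = 0 -> B (tr l) (tr l) * B (tr v) (tr v) = 0 ->
  B (tr m) (tr m) * B (tr u) (tr u) = 0 -> B (nu u l) (nu u l) * B (nu v m) (nu v m) = 0 ->
  A_BH Omega sides gamma h u l v m = 0.
Proof.
move=> Vu Ll Vv Lm E1 E2 E3 E4; rewrite (A_BHE hOmega hTh h0 hdiam hL gamma Vu Ll Vv Lm).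
have Z (t : R) : t ^+ 2 <= 0 -> t = 0.
  by move=> t0; apply/eqP; rewrite -sqrf_eq0 eq_le t0 sqr_ge0.
rewrite (Z (G u v)); last by rewrite -E1; exact: (gform_cauchy hOmega hTh Vu Vv).
rewrite (Z (B (tr l) (tr v))); last by rewrite -E2; exact: (bform_cauchy (Lmul Ll) (Ltr Vv)).
rewrite (Z (B (tr m) (tr u))); last by rewrite -E3; exact: (bform_cauchy (Lmul Lm) (Ltr Vu)).
rewrite (Z (B (nu u l) (nu v m))); last by rewrite -E4; exact: (bform_cauchy (Lnu Vu Ll) (Lnu Vv Lm)).
by rewrite !mulr0 subr0 !addr0.
Qed.

Lemma defect_null v m : V v -> L m -> G v v = 0 -> B (tr m) (tr m) = 0 -> B (nu v m) (nu v m) = 0.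
Proof.
move=> Vv Lm Gv Bm; apply/eqP; rewrite eq_le bform_ge0 andbT.
have := bform_comb_sqr_le 1 (Lmul Lm) (Ldn Vv); rewrite Bm expr1n mul1r add0r.
rewrite (bform_eq (f' := nu v m) (g' := nu v m)); last first.
- by move=> s t _ _; rewrite /defect mul1r.
- by move=> s t _ _; rewrite /defect mul1r.
have := hInv Vv; rewrite Gv mulr0; lra.
Qed.

Lemma A_BH_null_right u l v m : V u -> L l -> V v -> L m ->
  G v v = 0 -> B (tr v) (tr v) = 0 -> B (tr m) (tr m) = 0 -> A_BH Omega sides gamma h u l v m = 0.
Proof.
move=> Vu Ll Vv Lm Gv Bv Bm; apply: A_BH_null => //.
- by rewrite Gv mulr0.
- by rewrite Bv mulr0.
- by rewrite Bm mul0r.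
- by rewrite (defect_null Vv Lm Gv Bm) mulr0.
Qed.

Lemma norms_ge0 v m : 0 <= norm_1h Omega sides zeta h v + norm_Lh sides h m.
Proof. by rewrite addr_ge0// sqrtr_ge0. Qed.

(** Division by zero would turn a quotient of the supremum into 0. If the norms vanish, so do all
    forms of (v, m), including its defect by the inverse estimate, and Cauchy-Schwarz annihilates
    [A_BH]. *)
Lemma norms_gt0 u l v m : V u -> L l -> V v -> L m -> A_BH Omega sides gamma h u l v m != 0 ->
  0 < norm_1h Omega sides zeta h v + norm_Lh sides h m.
Proof.
move=> Vu Ll Vv Lm; apply: contraNT; rewrite -leNgt.
rewrite (norm_1hE hOmega hTh h0 zeta Vv) (norm_LhE Th h0 hL Lm) => N0.
have Bv := bform_ge0 sides Th (tr v); have Bm := bform_ge0 sides Th (tr m); have Gv := gform_ge0 Th v.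
have s1 := sqrtr_ge0 (G v v + zeta * (h^-1 * B (tr v) (tr v))).
have s2 := sqrtr_ge0 (h * B (tr m) (tr m)).
have hB : 0 <= zeta * (h^-1 * B (tr v) (tr v)) by rewrite !mulr_ge0 ?invr_ge0// ltW.
have : Num.sqrt (h * B (tr m) (tr m)) == 0 by apply/eqP; lra.
rewrite sqrtr_eq0 pmulr_rle0// => Bm0.
have : Num.sqrt (G v v + zeta * (h^-1 * B (tr v) (tr v))) == 0 by apply/eqP; lra.
rewrite sqrtr_eq0 => GB.
have : zeta * (h^-1 * B (tr v) (tr v)) <= 0 by lra.
rewrite pmulr_rle0// pmulr_rle0 ?invr_gt0// => Bv0.
apply/eqP; apply: A_BH_null_right => //; apply/eqP; rewrite eq_le ?Gv ?Bv ?Bm ?andbT//.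
by lra.
Qed.

Lemma not_pair_zero u l v m : V u -> L l -> V v -> L m -> A_BH Omega sides gamma h u l v m != 0 ->
  ~ Defs.pair_zero Omega sides v m.
Proof.
move=> Vu Ll Vv Lm /eqP AN /(pair_zero_forms hOmega hTh Vv Lm)[Gv Bv Bm]; apply: AN.
exact: A_BH_null_right.
Qed.

Lemma FE_cst a : V (fun=> a).
Proof.
split; first by move=> x; exact: cvg_cst.
move=> T TTh; exists (fun=> a) => //; exists (fun i j => if (i == 0%N) && (j == 0%N) then a else 0).
apply/funext => x; rewrite big_ord_recl big_ord_recl /= !expr0 !mulr1.
rewrite big1 ?addr0 => [|j _]; last by rewrite !mul0r.
rewrite big1 ?addr0// => i _; apply: big1 => j _.
by rewrite !mul0r.
Qed.

(** With X = G + S + A, energy, scaled squared defect and boundary term, the norms of (u, l) and of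
    the test pair are both at most 2 sqrt (norm_cst X), while the form is at least coercivity_cst X.
    The product of the norms against the form gives 4 norm_cst / coercivity_cst. *)
Lemma inf_sup u l : V u -> L l ->
  (exists w A, [/\ V w, 0 <= A,
     c * A - C * G u u <= B (tr u) (dnormal w),
     G w w <= C * (A + G u u) &
     B (tr w) (tr w) <= C * h * (A + G u u) /\
     B (tr u) (tr u) <= C * h * (A + G u u)]) ->
  ((norm_1h Omega sides zeta h u + norm_Lh sides h l)%:E <=
   (4 * norm_cst c C Cz cz gamma zeta / coercivity_cst c C Cz cz gamma)%:E *
     BH_sup Omega sides gamma zeta h V L u l)%E.
Proof.
move=> Vu Ll [w [A [Vw A0 HF HW [HBw HBu]]]].
have [z [Lz Hz1 Hz2]] := multiplier_lift Vw.
pose d := mixing c C Cz cz gamma.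
pose v x := u x + d * w x; pose m x := l x + d * z x.
have Vv : V v by exact: FE_comb.
have Lm : L m by exact: (multiplier_comb d hL).
pose S := h * B (nu u l) (nu u l); pose X := G u u + S + A.
have G0 := gform_ge0 Th u; have S0 : 0 <= S by rewrite mulr_ge0 ?bform_ge0// ltW.
have X0 : 0 <= X by exact: addr_ge0 (addr_ge0 G0 S0) A0.
have cc0 := coercivity_cst_gt0 c0 C0 Cz0 cz0 gamma0.
have nc0 := norm_cst_gt0 c Cz cz gamma C0 zeta0.
set c6 := coercivity_cst _ _ _ _ _ in cc0 *; set c8 := norm_cst _ _ _ _ _ _ in nc0 *.
have coer : c6 * X <= A_BH Omega sides gamma h u l v m.
  rewrite (A_BH_comb hOmega hTh h0 hdiam hL gamma d Vu Ll Vu Ll Vw Lz).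
  rewrite (A_BH_diag hOmega hTh h0 hdiam hL gamma Vu Ll).
  apply: (coercivity_arith c0 C0 Cz0 cz0 gamma0 G0 A0 S0).
  exact: (coupling Vu Ll Vw Lz A0 HF HW HBw (Hz1 u Vu) Hz2).
have hi : 0 <= h^-1 by rewrite invr_ge0 ltW.
have scaled f : B (tr f) (tr f) <= C * h * (A + G u u) -> h^-1 * B (tr f) (tr f) <= C * (A + G u u).
  move=> H; apply: le_trans (ler_wpM2l hi H) _.
  by move: (G u u) => x; rewrite le_eqVlt; apply/orP; left; apply/eqP; field; rewrite gt_eqF.
have comb f g (b : R) : 0 <= b -> bL2 sides Th f -> bL2 sides Th g ->
    b * B (fun s x => f s x + d * g s x) (fun s x => f s x + d * g s x) <=
    2 * (b * B f f + d ^+ 2 * (b * B g g)).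
  move=> b0 Lf Lg; apply: le_trans (ler_wpM2l b0 (bform_comb_sqr_le d Lf Lg)) _.
  by move: (B _ _) (B _ _) => x y; rewrite le_eqVlt; apply/orP; left; apply/eqP; ring.
have [N1 N2 N3 N4] := @norm_arith R c C Cz cz gamma zeta C0 zeta0 _ _ _ _ _ _ _ _ _ _ _ G0 S0 A0 HW (scaled u HBu) (scaled w HBw)
  (multiplier_le Vu Ll) Hz2 (gform_comb_le hOmega hTh d Vu Vw)
  (comb _ _ _ hi (Ltr Vu) (Ltr Vw)) (comb _ _ _ (ltW h0) (Lmul Ll) (Lmul Lz)).
have Nu := norms_le Vu Ll N1 N2.
have Nv : norm_1h Omega sides zeta h v + norm_Lh sides h m <= 2 * Num.sqrt (c8 * X).
  exact: norms_le Vv Lm N3 N4.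
have K0 : 0 <= 4 * c8 / c6 by rewrite divr_ge0 ?mulr_ge0// ltW.
have upper v' m' : V v' -> L m' -> ~ Defs.pair_zero Omega sides v' m' ->
    ((A_BH Omega sides gamma h u l v' m' / (norm_1h Omega sides zeta h v' + norm_Lh sides h m'))%:E
     <= BH_sup Omega sides gamma zeta h V L u l)%E.
  by move=> Vv' Lm' nz; apply: ereal_sup_ubound; exists v', m'.
(* If X = 0, the left side is zero and the supremum only has to be nonnegative. A pair with quotient
   0 shows this, and the function 1, nonzero since Omega is nonempty, makes it admissible. *)
have [X00|XN] := eqVneq X 0.
  have [Gu Su0] : G u u = 0 /\ S = 0 by exact: addr3_eq0 G0 S0 A0 X00.
  rewrite -/X X00 !mulr0 in N1 N2; rewrite -/X X00 mulr0 sqrtr0 mulr0 in Nu.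
  have Bl : B (tr l) (tr l) = 0.
    apply/eqP; rewrite eq_le bform_ge0 andbT.
    by move: N2; rewrite pmulr_rle0.
  have Bu : B (tr u) (tr u) = 0.
    apply/eqP; rewrite eq_le bform_ge0 andbT.
    by move: N1; rewrite Gu add0r pmulr_rle0// pmulr_rle0 ?invr_gt0.
  apply: (@le_trans _ _ 0%E); first by rewrite lee_fin.
  apply: mule_ge0; first by rewrite lee_fin.
  have [x Ox] : Omega !=set0 by case: hOmega => -[].
  have A1 : A_BH Omega sides gamma h u l (fun=> 1) l = 0.
    apply: (A_BH_null Vu Ll (FE_cst 1) Ll); first by rewrite Gu mul0r.
    - by rewrite Bl mul0r.
    - by rewrite Bu mulr0.
    - by rewrite (defect_null Vu Ll Gu Bl) mul0r.
  have := upper (fun=> 1) l (FE_cst 1) Ll; rewrite A1 mul0r; apply.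
  by move=> -[/(_ x Ox)/eqP]; rewrite oner_eq0.
have Xgt : 0 < X by rewrite lt_def XN.
have Apos : 0 < A_BH Omega sides gamma h u l v m by apply: lt_le_trans coer; exact: mulr_gt0.
have AN : A_BH Omega sides gamma h u l v m != 0 by rewrite gt_eqF.
have Npos := norms_gt0 Vu Ll Vv Lm AN.
have K0' : (0 <= (4 * c8 / c6)%:E)%E by rewrite lee_fin.
apply: le_trans (lee_wpmul2l K0' (upper v m Vv Lm (not_pair_zero Vu Ll Vv Lm AN))).
rewrite -EFinM lee_fin mulrA ler_pdivlMr//.
apply: le_trans (ler_pM (norms_ge0 u l) (norms_ge0 v m) Nu Nv) _.
have sq : Num.sqrt (c8 * X) * Num.sqrt (c8 * X) = c8 * X.
  by rewrite -expr2 sqr_sqrtr// mulr_ge0// ltW.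
rewrite mulrACA sq; apply: (@le_trans _ _ (4 * c8 / c6 * (c6 * X))); last exact: ler_wpM2l.
by rewrite le_eqVlt; apply/orP; left; apply/eqP; field; rewrite gt_eqF.
Qed.

End InfSup.

(** * Passing from mesh families to h, K and inscribed disks *)

Section MeshSize.
Variables (R : realType) (Omega : set (R * R)) (sides : seq (side R)) (Th : seq (triangle R)).
Hypothesis hOmega : polygonal_domain Omega sides.
Hypothesis hTh : triangulation Omega sides Th.
Implicit Types T : triangle R.

Lemma diam_mesh_size T : T \in Th -> diam T <= mesh_size Th.
Proof. by move=> TTh; exact: (@le_bigmax_seq _ _ _ _ _ T predT (fun T => diam T) TTh isT). Qed.

Lemma mesh_size_gt0 (kappa : R) : shape_regular kappa Th -> 0 < mesh_size Th.
Proof.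
move=> sh; have [x Ox] : Omega !=set0 by case: hOmega => -[].
have [T TTh _] := closure_mesh hTh (subset_closure Ox).
have [c [r [r0 _ sub]]] := sh T TTh.
apply: lt_le_trans (diam_mesh_size TTh); apply: (lt_le_trans r0).
have h1 : hull T (c + (r, 0)).
  apply: sub => /=; rewrite addrC addKr /enorm /dot /= mulr0 addr0 -expr2 sqrtr_sqr.
  by rewrite gtr0_norm.
have h2 : hull T c.
  by apply: sub => /=; rewrite subrr /enorm /dot /= mulr0 addr0 sqrtr0 ltW.
have [d1 _] := hull_diam h1 h2; apply: le_trans d1.
by rewrite /= addrAC subrr add0r ler_norm.
Qed.

(** Each T contains a disk of radius r with mesh_size <= rho * diam T <= rho * kappa * r. The
    maximum with 1 secures 1 <= K and only shrinks the disks. *)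
Lemma inscribed_balls (kappa rho : R) : 0 < kappa -> 0 < rho ->
  shape_regular kappa Th -> quasi_uniform rho Th ->
  exists ctr : triangle R -> R * R, forall T, T \in Th ->
    [set y | enorm (y - ctr T) <= mesh_size Th / Num.max 1 (rho * kappa)] `<=` hull T.
Proof.
move=> kappa0 rho0 sh qu.
have [T|ctr H] := @choice _ _ (fun T x => T \in Th ->
    [set y | enorm (y - x) <= mesh_size Th / Num.max 1 (rho * kappa)] `<=` hull T); last by exists ctr.
have [TTh|nT] := boolP (T \in Th); last by exists 0 => TTh; case/negP: nT.
have [x [r [r0 dr sub]]] := sh T TTh; exists x => _ y /= xy; apply: sub.
apply: le_trans xy _; rewrite ler_pdivrMr ?lt_max ?ltr01//.
apply: le_trans (qu T TTh) _; apply: le_trans (ler_wpM2l (ltW rho0) dr) _.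
by rewrite mulrA mulrC; apply: ler_wpM2l; [exact: ltW|rewrite le_max lexx orbT].
Qed.

End MeshSize.

Theorem theorem4p1 (R : realType) (kappa : R) (hkappa : 0 < kappa) :
  exists N : nat,
  forall (Omega : set (R * R)) (sides : seq (side R))
    (hOmega : polygonal_domain Omega sides)
    (k : nat) (hk : (1 <= k)%N)
    (gamma zeta : R) (hgamma : 0 < gamma) (hzeta : 0 < zeta)
    (rho : R) (hrho : 0 < rho)
    (I : Type) (Th : I -> seq (triangle R)) (L : I -> set (R * R -> R))
    (hTh : forall i, triangulation Omega sides (Th i))
    (hshape : forall i, shape_regular kappa (Th i))
    (hquasi : forall i, quasi_uniform rho (Th i))
    (hsides : forall i, sides_resolved N Omega sides (Th i))
    (hL : forall i, multiplier_space sides (L i)),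
  (exists Cz cz : R, [/\ 0 < Cz, 0 < cz &
     forall i, multiplier_assumption Omega sides (mesh_size (Th i))
                 (FE_space k Omega (Th i)) (L i) Cz cz]) ->
  exists2 C : R, 0 < C &
  forall (i : I) (u l : R * R -> R),
    FE_space k Omega (Th i) u -> L i l ->
    ((norm_1h Omega sides zeta (mesh_size (Th i)) u
      + norm_Lh sides (mesh_size (Th i)) l)%:E
     <= C%:E * BH_sup Omega sides gamma zeta (mesh_size (Th i))
                 (FE_space k Omega (Th i)) (L i) u l)%E.
Proof.
(* One element per side that touches no other part of the boundary is enough as the goal of the
   chains of bad edges. *)
exists 1%N => Omega sides hOmega k hk gamma zeta hgamma hzeta rho hrho I Th L hTh hshape hquasi hsides hL.
move=> [Cz [cz [Cz0 cz0 hM]]].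
have K1 : 1 <= Num.max 1 (rho * kappa) by rewrite le_max lexx.
have [c [C [c0 C0 H]]] := test_function hk K1 hOmega.
exists (4 * norm_cst c C Cz cz gamma zeta / coercivity_cst c C Cz cz gamma).
  rewrite divr_gt0 ?mulr_gt0//; first exact: norm_cst_gt0.
  exact: coercivity_cst_gt0.
move=> i u l Vu Ll.
have h0 := mesh_size_gt0 hOmega (hTh i) (hshape i).
have [ctr hball] := inscribed_balls hkappa hrho (hshape i) (hquasi i).
have resolved s : s \in sides -> exists2 T, T \in Th i & meshes_side Omega s T.
  by move=> ss; have := hsides i s ss; rewrite -has_count => /hasP[T TTh /asboolP mT]; exists T.
have [hInv hTest] := H (Th i) (mesh_size (Th i)) ctr (hTh i) h0 (@diam_mesh_size _ (Th i)) hball resolved.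
exact: (inf_sup hOmega (hTh i) h0 (@diam_mesh_size _ (Th i)) (hL i) c0 C0 Cz0 cz0 hgamma hzeta (hM i) hInv Vu Ll (hTest u Vu)).
Qed.
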